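(* Let $m=2k+1$ with $k\in\mathbb{N}$, $\mu\in\{-1,1\}$, and consider the odd-order equation $$\frac{\partial u(t,x)}{\partial t}=\mu\frac{\partial^m u(t,x)}{\partial x^m},\qquad t>0,\ x\in\mathbb{R},$$ with random initial condition $u(0,x)=\eta(x)=M(x)+\xi(x)$, whose solution field is taken to be $$u(t,x)=\int_{\mathbb{R}}M(x-y)\,u_m(t,y)\,dy+\frac{1}{2\pi}\int_{\mathbb{R}}e^{i\lambda x+i\mu(-1)^{\frac{m-1}{2}}\lambda^m t}\sqrt{f(\lambda)}\,W(d\lambda),$$ where $u_m(t,y)=\frac{1}{2\pi}\int_{\mathbb{R}}e^{-i\lambda y-i\mu(-1)^{\frac{m-1}{2}}t\lambda^m}d\lambda$. Suppose the covariance function of $\xi$ satisfies Assumption B with $A_0=0$. For $\varepsilon>0$ define the kernel-averaged rescaled field $$\overline U^g_\varepsilon(t,x)=\varepsilon^{-1/4}\left[\int_{\mathbb{R}}e^{-(x_1-x)^2}u\big(t\varepsilon^{-m/2},x_1\varepsilon^{-1/2}\big)dx_1-\mathbb{E}\int_{\mathbb{R}}e^{-(x_1-x)^2}u\big(t\varepsilon^{-m/2},x_1\varepsilon^{-1/2}\big)dx_1\right].$$ Then, as $\varepsilon\to0$, the finite-dimensional distributions of $\overline U^g_\varepsilon$ converge weakly to those of the zero-mean Gaussian random field $$U^g_0(t,x)=\frac{\sqrt{C}}{2\sqrt{\pi}}\int_{\mathbb{R}}e^{i(\lambda x+\mu(-1)^{\frac{m-1}{2}}\lambda^m t)}e^{-\lambda^2/4}\,W(d\lambda),\qquad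 C:=\sum_{j=1}^n c_1(\kappa_j)A_jK_{\frac{\kappa_j-1}{2}}(|w_j|)\,|w_j|^{\frac{\kappa_j-1}{2}},$$ with covariance function $$\operatorname{Cov}(U^g_0(t,x),U^g_0(t',x'))=\frac{C}{4\pi}\int_{\mathbb{R}}\cos\!\Big(\lambda(x-x')+\mu(-1)^{\frac{m-1}{2}}(t-t')\lambda^m\Big)e^{-\lambda^2/2}\,d\lambda.$$
   Context: $(\Omega,\mathscr F,\mathbb P)$ is a complete probability space. $M:\mathbb{R}\to\mathbb{R}$ is a deterministic function for which the convolution integrals above are well defined. $\xi(x)$, $x\in\mathbb{R}$, is a real-valued, measurable, mean-square continuous, stationary Gaussian process with $\mathbb{E}\xi(x)=0$, $\mathbb{E}\xi^2(x)=1$, absolutely continuous spectral measure with spectral density $f$, and spectral representation $\xi(x)=\int_{\mathbb{R}}e^{i\lambda x}\sqrt{f(\lambda)}\,W(d\lambda)$, where $W$ is a complex Gaussian white-noise random measure on $\mathbb{R}$ chosen symmetric about the origin (so that all fields are real-valued), integrals being understood in $L_2(\Omega)$. Assumption B: the covariance function of $\xi$ is $r(x)=\sum_{j=0}^n A_j\frac{\cos(w_jx)}{(1+x^2)^{\kappa_j/2}}$, $x\in\mathbb{R}$, where $A_j\ge0$, $\sum_{j=0}^nA_j=1$, $w_0=0$, $w_j\neq0$ for $j\ge1$, and $\kappa_j\in(0,1)$ for $j=0,\dots,n$. Its spectral density is $$f(\lambda)=\sum_{j=0}^n\frac{c_1(\kappa_j)}{2}A_j\left(\frac{K_{\frac{\kappa_j-1}{2}}(|\lambda+w_j|)}{|\lambda+w_j|^{\frac{1-\kappa_j}{2}}}+\frac{K_{\frac{\kappa_j-1}{2}}(|\lambda-w_j|)}{|\lambda-w_j|^{\frac{1-\kappa_j}{2}}}\right),$$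 with $c_1(\kappa)=2^{\frac{1-\kappa}{2}}/(\sqrt{\pi}\,\Gamma(\kappa/2))$ and $K_\nu$ the modified Bessel function of the second kind. *)

(* Defs.v *)
From HB Require Import structures.
From mathcomp Require Import all_boot all_order all_algebra.
From mathcomp Require Import all_classical all_reals all_analysis.
Set Implicit Arguments. Unset Strict Implicit. Unset Printing Implicit Defensive.
Import Order.TTheory GRing.Theory Num.Theory.
Import numFieldNormedType.Exports.
Local Open Scope classical_set_scope.
Local Open Scope ring_scope.

Section defs.
Context {R : realType}.
Notation mu := (@lebesgue_measure R).

(* real-valued Lebesgue integral over R (0 if the extended integral is infinite) *)
Definition LInt (g : R -> R) : R := fine (\int[mu]_x (g x)%:E)%E.

Definition Rint_on (A : set R) (g : R -> R) : R := fine (\int[mu]_(x in A) (g x)%:E)%E.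

Definition Expect {d} {T : measurableType d} (P : probability T R) (X : T -> R) : R :=
  fine (\int[P]_w (X w)%:E)%E.

Definition cosh (s : R) : R := (expR s + expR (- s)) / 2.

Definition GammaF (s : R) : R :=
  Rint_on `]0, +oo[ (fun x => x `^ (s - 1) * expR (- x)).

Definition BesselK (nu z : R) : R :=
  Rint_on `]0, +oo[ (fun s => expR (- (z * cosh s)) * cosh (nu * s)).

Definition c1 (kappa : R) : R :=
  2 `^ ((1 - kappa) / 2) / (Num.sqrt pi * GammaF (kappa / 2)).

Definition specB (n : nat) (A w kappa : nat -> R) (l : R) : R :=
  \sum_(j < n.+1)
    (c1 (kappa j) / 2 * A j *
     (BesselK ((kappa j - 1) / 2) `|l + w j| / `|l + w j| `^ ((1 - kappa j) / 2)
      + BesselK ((kappa j - 1) / 2) `|l - w j| / `|l - w j| `^ ((1 - kappa j) / 2))).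

Definition constC (n : nat) (A w kappa : nat -> R) : R :=
  \sum_(1 <= j < n.+1)
    (c1 (kappa j) * A j * BesselK ((kappa j - 1) / 2) `|w j|
       * `|w j| `^ ((kappa j - 1) / 2)).

Definition centered_gaussian {d} {T : measurableType d} (P : probability T R)
  (X : T -> R) (v : R) : Prop :=
  if v == 0 then P [set w | X w != 0] = 0%E
  else forall B : set R, measurable B ->
         P (X @^-1` B) = normal_prob 0 (Num.sqrt v) B.

Definition sq_integrable (a : R -> R) : Prop :=
  measurable_fun setT a /\ mu.-integrable setT (fun x => (a x ^+ 2)%:E).

(* (a, b) = real and imaginary parts of a Hermitian function phi = a + i b
   (phi(-l) = conj phi(l)) in L2(R) *)
Definition herm_L2 (a b : R -> R) : Prop :=
  (forall l, a (- l) = a l) /\ (forall l, b (- l) = - b l)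
  /\ sq_integrable a /\ sq_integrable b.

(* I a b = \int (a(l) + i b(l)) W(dl) for a complex Gaussian white noise
   random measure W symmetric about the origin (E|W(dl)|^2 = dl);
   on Hermitian integrands it is real-valued, centered Gaussian with
   variance \int |phi|^2, and linear (a.s.). *)
Definition sym_white_noise_integral {d} {T : measurableType d}
  (P : probability T R) (I : (R -> R) -> (R -> R) -> T -> R) : Prop :=
  (forall a b, herm_L2 a b ->
     measurable_fun setT (I a b) /\
     centered_gaussian P (I a b) (LInt (fun l => a l ^+ 2 + b l ^+ 2)))
  /\ (forall a b a' b' (al be : R), herm_L2 a b -> herm_L2 a' b' ->
     {ae P, forall w, I (fun l => al * a l + be * a' l)
                        (fun l => al * b l + be * b' l) w
                      = al * I a b w + be * I a' b' w}).

(* u_m(t, y) = (1/2pi) \int e^{-i l y - i theta t l^m} dl, as the (improper)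
   limit of integrals over [-L, L]; the imaginary part vanishes there by
   oddness, so only the cosine part is kept. *)
Definition um (m : nat) (theta t y : R) : R :=
  lim ((fun L => (2 * pi)^-1 *
          Rint_on `[- L, L] (fun l => cos (l * y + theta * t * l ^+ m)))
        @ +oo).

Definition conv_term (m : nat) (theta : R) (M : R -> R) (t x : R) : R :=
  LInt (fun y => M (x - y) * um m theta t y).

Definition Ubar {d} {T : measurableType d} (P : probability T R) (m : nat)
  (theta : R) (M : R -> R) (V : R -> R -> T -> R) (eps t x : R) (w : T) : R :=
  let u := fun s y w' => conv_term m theta M s y + V s y w' in
  let Y := fun w' => LInt (fun x1 => expR (- (x1 - x) ^+ 2) *
             u (t * eps `^ (- (m%:R / 2))) (x1 * eps `^ (- (1 / 2))) w') in
  eps `^ (- (1 / 4)) * (Y w - Expect P Y).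

End defs.

(* Main.v *)
(** Write [c = eps^(-1/2)]. The deterministic part of the averaged field cancels,
    and a stochastic Fubini theorem (an [L2] computation of [E (Z - I psi)^2])
    shows that the rest is almost surely the white noise integral of
    [(c / 4 pi)^(1/2) g(c l) sqrt (f l)], where
    [g l = exp (i (l x + theta l^m t) - l^2 / 4)]. Hence all linear combinations
    are centered Gaussian, with covariances [(4 pi)^-1 \int c q(c l) f(l) dl]
    for the Gaussian-dominated function [q = Re (g (conj g'))]. Since [A_0 = 0], the
    singularities of the integrable spectral density [f] stay away from [0], so [f]
    is continuous at [0] with [f 0 = C] and the covariances converge to
    [C / (4 pi) \int q]. Weak convergence follows by the Cramer-Wold argument:
    Gaussian expectations of trigonometric polynomials depend continuously on the
    covariance, and a bounded continuous [h] on [R^N] is within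
    [delta (1 + |x|^2)] of a trigonometric polynomial, namely a Bernstein
    polynomial in the variables [(1 + sin (x_i / L)) / 2]. *)
Require Import Defs.
From mathcomp Require Import all_boot all_order all_algebra.
From mathcomp Require Import interval_inference ring lra.
From mathcomp Require Import all_classical all_reals all_analysis.
From mathcomp Require Import measurable_realfun.
Set Implicit Arguments. Unset Strict Implicit. Unset Printing Implicit Defensive.
Import Order.TTheory GRing.Theory Num.Theory.
Import numFieldNormedType.Exports.
Local Open Scope classical_set_scope.
Local Open Scope ring_scope.

(** The exponents come from one substitution. Since [l ^ m * t * c ^ m = (c * l) ^ m * t], the phase
    at time [t * c ^ m] and position [x * c] depends on [l] only through [c * l]. The Gaussian
    kernel contributes its Fourier transform [sqrt pi * exp (- (c * l) ^ 2 / 4)], and the square of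
    [eps ^ (-1/4) * sqrt pi / (2 * pi)] is [c / (4 * pi)]: the prefactor [eps ^ (-1/4)] is the one
    that turns the squared integrand into an approximate identity. The noise is known only through
    [I], and both its linearity and the representation of [V] hold outside null sets that depend on
    the integrand. Space integrals therefore cannot be exchanged with [I] path by path; second
    moments can, so random variables are identified through a vanishing mean square. The density [f]
    is unbounded near [w j] and [- w j] whenever [A j > 0], so rescaling [l] leaves no constant
    bound on [f (l / c)]; far from the origin the estimates use the integrability of [f] instead.
    The quadratic weight in the approximation of [h] plays the part of tightness: its mean involves
    only the diagonal covariances, which converge. *)

(** * Real-valued integrals and Fubini's theorem *)

Section real_integral.
Context d (T : measurableType d) (R : realType) (m : {measure set T -> \bar R}).
Implicit Types f g : T -> R.

Lemma integrable_le f g : measurable_fun setT f -> (forall x, `|f x| <= g x) ->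
  m.-integrable setT (EFin \o g) -> m.-integrable setT (EFin \o f).
Proof.
move=> mf fg ig; apply: le_integrable ig => //; first exact/measurable_EFinP.
move=> x _ /=; rewrite lee_fin (le_trans (fg x))//; exact: ler_norm.
Qed.

Lemma integrable_measurable f : m.-integrable setT (EFin \o f) ->
  measurable_fun setT f.
Proof. by move=> /integrableP[/measurable_EFinP]. Qed.

Lemma integrable_add f g : m.-integrable setT (EFin \o f) ->
  m.-integrable setT (EFin \o g) -> m.-integrable setT (EFin \o (fun x => f x + g x)).
Proof. by move=> fi gi; exact: integrableD fi gi. Qed.

Lemma integrable_sub f g : m.-integrable setT (EFin \o f) ->
  m.-integrable setT (EFin \o g) -> m.-integrable setT (EFin \o (fun x => f x - g x)).
Proof. by move=> fi gi; exact: integrableB fi gi. Qed.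

Lemma integrable_scale k f : m.-integrable setT (EFin \o f) ->
  m.-integrable setT (EFin \o (fun x => k * f x)).
Proof. by move=> fi; exact: (@integrableZl _ _ _ m setT measurableT k _ fi). Qed.

Lemma integrable_sum_real (I : Type) (r : seq I) (f : I -> T -> R) :
  (forall i, m.-integrable setT (EFin \o f i)) ->
  m.-integrable setT (EFin \o (fun x => \sum_(i <- r) f i x)).
Proof.
move=> fi; elim: r => [|i r IH].
  rewrite (_ : _ \o _ = cst 0%E); first exact: integrable0.
  by apply/funext => x /=; rewrite big_nil.
rewrite (_ : _ \o _ = EFin \o (fun x => f i x + \sum_(j <- r) f j x)).
  exact: integrable_add.
by apply/funext => x /=; rewrite big_cons.
Qed.

Lemma Rintegral_sum (I : Type) (r : seq I) (f : I -> T -> R) :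
  (forall i, m.-integrable setT (EFin \o f i)) ->
  \int[m]_x (\sum_(i <- r) f i x) = \sum_(i <- r) \int[m]_x f i x.
Proof.
move=> fi; elim: r => [|i r IH].
  under eq_Rintegral do rewrite big_nil.
  by rewrite big_nil /Rintegral integral0.
under eq_Rintegral do rewrite big_cons.
rewrite RintegralD//; last exact: integrable_sum_real.
by rewrite IH big_cons.
Qed.

Lemma integral_Rintegral f : m.-integrable setT (EFin \o f) ->
  (\int[m]_x (f x)%:E)%E = (\int[m]_x f x)%:E.
Proof. by move=> fi; rewrite /Rintegral fineK//; exact: integrable_fin_num. Qed.

Lemma Rintegral_norm_le f g : measurable_fun setT f ->
  (forall x, `|f x| <= g x) -> m.-integrable setT (EFin \o g) ->
  `|\int[m]_x f x| <= \int[m]_x g x.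
Proof.
move=> mf fg gi; have fi := integrable_le mf fg gi.
apply: le_trans (le_normr_Rintegral _ fi) _ => //.
by apply: le_Rintegral => //; exact: integrable_norm.
Qed.

Lemma ae_eq_Rintegral f g : measurable_fun setT f -> measurable_fun setT g ->
  {ae m, forall x, f x = g x} -> \int[m]_x f x = \int[m]_x g x.
Proof.
move=> mf mg fg; rewrite /Rintegral; congr fine; apply: ae_eq_integral => //.
- exact/measurable_EFinP.
- exact/measurable_EFinP.
- by apply: filterS fg => x /= -> .
Qed.

Lemma integrable_ae_eq f g : measurable_fun setT f -> measurable_fun setT g ->
  {ae m, forall x, f x = g x} -> m.-integrable setT (EFin \o f) ->
  m.-integrable setT (EFin \o g).
Proof.
move=> mf mg fg /integrableP[_ fi]; apply/integrableP; split.
  exact/measurable_EFinP.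
rewrite (_ : (\int[m]_x _)%E = (\int[m]_x `|(EFin \o f) x|)%E)//.
apply: ae_eq_integral => //.
- by apply: measurableT_comp => //; exact/measurable_EFinP.
- by apply: measurableT_comp => //; exact/measurable_EFinP.
- by apply: filterS fg => x /= -> .
Qed.

Lemma integrableM_sq f g : measurable_fun setT f -> measurable_fun setT g ->
  m.-integrable setT (EFin \o (fun x => f x ^+ 2)) ->
  m.-integrable setT (EFin \o (fun x => g x ^+ 2)) ->
  m.-integrable setT (EFin \o (fun x => f x * g x)).
Proof.
move=> mf mg fi gi; apply: (@integrable_le _ (fun x => f x ^+ 2 + g x ^+ 2)).
- exact: measurable_funM.
- by move=> x; rewrite ler_norml; apply/andP; split; nra.
- exact: integrable_add.
Qed.

Lemma Rintegral_sq_eq0 f : measurable_fun setT f ->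
  m.-integrable setT (EFin \o (fun x => f x ^+ 2)) ->
  \int[m]_x f x ^+ 2 = 0 -> {ae m, forall x, f x = 0}.
Proof.
move=> mf fi f0.
have := congr1 EFin f0; rewrite -(integral_Rintegral fi) => i0.
have mf2 : measurable_fun setT (fun x => ((f x ^+ 2)%:E : \bar R)).
  by apply/measurable_EFinP; exact: measurable_funX.
have /ae_eq_integral_abs := mf2 => /(_ m measurableT) [h _].
have : (\int[m]_x `|(f x ^+ 2)%:E| = 0)%E.
  rewrite -[RHS]i0; apply: eq_integral => x _.
  by rewrite gee0_abs// lee_fin sqr_ge0.
move=> /h; apply: filterS => x /= /(_ Logic.I) [].
by move=> /eqP; rewrite sqrf_eq0 => /eqP.
Qed.

End real_integral.

(** Tonelli's measurability theorem, applied separately to the positive and the negative part,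
    covers every section; where the extended integral is infinite, [fine] supplies the value 0.
    Random integrals are thus measurable before their almost sure finiteness is known. *)
Lemma measurable_Rintegral_section d1 d2 (T1 : measurableType d1)
    (T2 : measurableType d2) (R : realType)
    (m1 : {sigma_finite_measure set T1 -> \bar R}) (f : T1 * T2 -> R) :
  measurable_fun setT f -> measurable_fun setT (fun y => \int[m1]_x f (x, y)).
Proof.
move=> mf; apply: measurableT_comp => //.
have mE : measurable_fun setT (EFin \o f) by exact/measurable_EFinP.
rewrite (_ : (fun y => _) =
  (fun y => (\int[m1]_x ((EFin \o f)^\+ (x, y)) - \int[m1]_x ((EFin \o f)^\- (x, y)))%E)).
  apply: emeasurable_funB.
  - apply: (@measurable_fun_fubini_tonelli_G _ _ T1 T2 R m1 _ (measurable_funepos mE)).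
    by move=> z; exact: funepos_ge0.
  - apply: (@measurable_fun_fubini_tonelli_G _ _ T1 T2 R m1 _ (measurable_funeneg mE)).
    by move=> z; exact: funeneg_ge0.
by apply/funext => y; rewrite integralE; congr (_ - _)%E;
  apply: eq_integral => x _; rewrite ?funeposE ?funenegE.
Qed.

Section real_fubini.
Context d1 d2 (T1 : measurableType d1) (T2 : measurableType d2) (R : realType).
Variables (m1 : {sigma_finite_measure set T1 -> \bar R})
  (m2 : {sigma_finite_measure set T2 -> \bar R}).
Variables (f : T1 * T2 -> R) (g : T1 -> R).
Hypotheses (mf : measurable_fun setT f)
  (fi : forall x, m2.-integrable setT (EFin \o (fun y => f (x, y))))
  (fg : forall x, \int[m2]_y `|f (x, y)| <= g x)
  (gi : m1.-integrable setT (EFin \o g)).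

(** Tonelli's criterion: the L1 norms of the sections are dominated by the integrable [g]. In the
    uses below [g] is a multiple of the averaging weight. *)
Lemma integrable_prod_dominated : (m1 \x m2)%E.-integrable setT (EFin \o f).
Proof.
apply/integrable12ltyP; first exact/measurable_EFinP.
have mfa : measurable_fun setT (fun z : T1 * T2 => (`|f z|)%:E : \bar R).
  by apply/measurable_EFinP; exact: measurableT_comp.
have /integrableP[mg gfin] := gi.
apply: le_lt_trans gfin; apply: ge0_le_integral => //.
- by move=> x _; exact: integral_ge0.
- have := @measurable_fun_fubini_tonelli_F _ _ T1 T2 R m2 _ mfa.
  by apply => z; rewrite lee_fin.
- exact: measurableT_comp.
- move=> x _ /=; have := integrable_norm (fi x) => h.
  rewrite (_ : (\int[m2]_y _)%E = (\int[m2]_y `|f (x, y)|)%:E); last first.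
    by rewrite -(integral_Rintegral h); apply: eq_integral.
  by rewrite lee_fin (le_trans (fg x))// ler_norm.
Qed.

Lemma Rintegral_fubini :
  \int[m1]_x \int[m2]_y f (x, y) = \int[m2]_y \int[m1]_x f (x, y).
Proof.
have F := Fubini integrable_prod_dominated.
have a2 := ae_integrable2 integrable_prod_dominated.

have i2 : measurable_fun setT (fun y => \int[m1]_x (EFin \o f) (x, y))%E :=
  measurable_fubini_G integrable_prod_dominated.
rewrite /Rintegral; congr fine.
transitivity (\int[m1]_x \int[m2]_y (EFin \o f) (x, y))%E.
  apply: eq_integral => x _; rewrite fineK//.
  exact: (integrable_fin_num measurableT (fi x)).
(* On this side the inner integral is known to be finite only for almost every [y], so the passage
   from extended to real values is an almost-everywhere identity. *)
rewrite F; apply: ae_eq_integral => //.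
- by apply/measurable_EFinP; exact: measurable_Rintegral_section.
- apply: filterS a2 => y iy _ /=; rewrite fineK//.
  exact: (integrable_fin_num measurableT iy).
Qed.

Lemma ae_integrable_section :
  {ae m2, forall y, m1.-integrable setT (EFin \o (fun x => f (x, y)))}.
Proof. exact: ae_integrable2 integrable_prod_dominated. Qed.

End real_fubini.

(** * Affine changes of variable and the normal density *)

Section lebesgue_change_of_variable.
Context (R : realType).
Notation mu := (@lebesgue_measure R).

(** Uniqueness of Lebesgue measure: [a] times the image of [mu] under [x -> a * x + b] gives every
    interval []u, v]] its length. *)
Lemma lebesgue_measure_affine (a b : R) (A : set R) : 0 < a -> measurable A ->
  mu ((fun x => a * x + b) @^-1` A) = ((a^-1)%:E * mu A)%E.
Proof.
move=> a0 mA.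
have a0' : 0 <= a by exact: ltW.
have mphi : measurable_fun setT ((fun x => a * x + b) : R -> measurableTypeR R).
  by apply: measurable_funD => //; exact: measurable_funM.
pose nu := mscale (NngNum a0') (pushforward mu ((fun x => a * x + b) : measurableTypeR R -> measurableTypeR R)).
have nuE : mu A = nu mphi A.
  apply: (@lebesgue_measure_unique R (nu mphi)) => //= _ [[u v] _ <-] /=.
  rewrite /nu /mscale /= /pushforward.
  have -> : (fun x : measurableTypeR R => a * x + b) @^-1` `]u, v]%classic
            = `]((u - b) / a), ((v - b) / a)]%classic.
    apply/seteqP; split => x /=; rewrite !in_itv /= ltr_pdivrMr// ler_pdivlMr//
      ltrBlDr lerBrDr; by rewrite (mulrC x).
  rewrite !lebesgue_measure_itv/= !lte_fin ltr_pM2r ?invr_gt0// ltrD2r.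
  case: ifP => uv; last by rewrite mule0.
  rewrite -!EFinB -EFinM; congr EFin; field; exact: lt0r_neq0.
rewrite nuE /nu /mscale /pushforward /= muleA -EFinM mulVf ?mul1e//.
exact: lt0r_neq0.
Qed.

Lemma ge0_integral_affine (a b : R) (f : R -> \bar R) : 0 < a ->
  measurable_fun setT f -> (forall x, 0 <= f x)%E ->
  (\int[mu]_x f (a * x + b)%R = (a^-1)%:E * \int[mu]_x f x)%E.
Proof.
move=> a0 mf f0.
have ai0 : 0 <= a^-1 by rewrite invr_ge0 ltW.
have mphi : measurable_fun setT ((fun x => a * x + b) : R -> measurableTypeR R).
  by apply: measurable_funD => //; exact: measurable_funM.
have := @ge0_integral_pushforward _ _ (measurableTypeR R) (measurableTypeR R) R _ mphi mu setT f
  measurableT mf (fun y _ => f0 y).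
rewrite preimage_setT => <-.
rewrite -(ge0_integral_mscale mu measurableT (NngNum ai0))//=.
apply: eq_measure_integral => A mA _ /=.
by rewrite /pushforward lebesgue_measure_affine.
Qed.

Lemma integrable_affine (a b : R) (f : R -> R) : 0 < a ->
  mu.-integrable setT (EFin \o f) ->
  mu.-integrable setT (EFin \o (fun x => f (a * x + b))).
Proof.
move=> a0 /integrableP[mf fi]; apply/integrableP; split.
  apply: (measurableT_comp mf) => //.
  by apply: measurable_funD => //; exact: measurable_funM.
have := @ge0_integral_affine a b (abse \o (EFin \o f)) a0.
rewrite /= => ->//; first by rewrite lte_mul_pinfty// lee_fin invr_ge0 ltW.
exact: measurableT_comp.
Qed.

Lemma Rintegral_affine (a b : R) (f : R -> R) : 0 < a ->
  mu.-integrable setT (EFin \o f) ->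
  \int[mu]_x f (a * x + b) = a^-1 * \int[mu]_x f x.
Proof.
move=> a0 fi; have mf := measurable_int mu fi.
rewrite /Rintegral; rewrite [in LHS]integralE [in RHS]integralE.
have pE : (\int[mu]_x ((fun x => (f (a * x + b))%:E)^\+ x))%E =
   ((a^-1)%:E * \int[mu]_x ((fun x => (f x)%:E)^\+ x))%E.
  rewrite -(@ge0_integral_affine a b ((fun x => (f x)%:E)^\+)%E)//.
    by apply: eq_integral => x _; rewrite !funeposE.
  exact: measurable_funepos.
have nE : (\int[mu]_x ((fun x => (f (a * x + b))%:E)^\- x))%E =
   ((a^-1)%:E * \int[mu]_x ((fun x => (f x)%:E)^\- x))%E.
  rewrite -(@ge0_integral_affine a b ((fun x => (f x)%:E)^\-)%E)//.
    by apply: eq_integral => x _; rewrite !funenegE.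
  exact: measurable_funeneg.
rewrite pE nE.
have fp := integrable_pos_fin_num measurableT fi.
have fn := integrable_neg_fin_num measurableT fi.
by rewrite -(fineK fp) -(fineK fn) -!EFinM -!EFinB /= mulrBr.
Qed.

Lemma integrable_opp (f : R -> R) : mu.-integrable setT (EFin \o f) ->
  mu.-integrable setT (EFin \o (fun x => f (- x))).
Proof.
move=> /integrableP[mf fi]; apply/integrableP; split.
  exact: (measurableT_comp mf).
have := @ge0_integral_pushforward _ _ (measurableTypeR R) (measurableTypeR R) R
  (-%R : _ -> measurableTypeR R) (@oppr_measurable R setT) mu setT
  (abse \o (EFin \o f)) measurableT.
rewrite preimage_setT => h.
have ma : measurable_fun setT (abse \o (EFin \o f)) by exact: measurableT_comp.
rewrite -(h ma); last by move=> y _; exact: abse_ge0.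
by rewrite (eq_measure_integral mu)// => A mA _; exact: lebesgue_measureN.
Qed.

Lemma Rintegral_opp (f : R -> R) : mu.-integrable setT (EFin \o f) ->
  \int[mu]_x f (- x) = \int[mu]_x f x.
Proof.
move=> fi; rewrite /Rintegral; congr fine.
have := @integral_pushforward _ _ (measurableTypeR R) (measurableTypeR R) R
  (-%R : _ -> measurableTypeR R) (@oppr_measurable R setT) mu setT (EFin \o f)
  (measurable_int mu fi).
rewrite preimage_setT => /(_ (integrable_opp fi) measurableT) /= <-.
by apply: eq_measure_integral => A mA _; exact: lebesgue_measureN.
Qed.

Lemma Rintegral_odd (f : R -> R) : mu.-integrable setT (EFin \o f) ->
  (forall x, f (- x) = - f x) -> \int[mu]_x f x = 0.
Proof.
move=> fi fo; have := Rintegral_opp fi.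
under eq_Rintegral do rewrite fo -mulN1r.
by rewrite RintegralZl//; lra.
Qed.

(** The Radon-Nikodym derivative of the normal law and [normal_pdf] have the same integral over
    every measurable set, hence agree almost everywhere, and the former can be replaced by the
    latter in the change of variables formula. *)
Lemma ge0_integral_normal_prob (s : R) (f : R -> \bar R) :
  measurable_fun setT f -> (forall x, 0 <= f x)%E ->
  (\int[normal_prob 0 s]_x f x = \int[mu]_x (f x * (normal_pdf 0 s x)%:E))%E.
Proof.
move=> mf f0; have dom := normal_prob_dominates 0 s.
rewrite -(Radon_Nikodym_SigmaFinite.change_of_variables dom f0 measurableT mf).
have mn : measurable_fun setT (fun x => (normal_pdf 0 s x)%:E : \bar R).
  by apply/measurable_EFinP; exact: measurable_normal_pdf.
have ir := Radon_Nikodym_SigmaFinite.f_integrable dom.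
apply: ae_eq_integral => //.
- by apply: emeasurable_funM => //; exact: measurable_int ir.
- exact: emeasurable_funM.
- apply: ae_eqe_mul2l => /=; apply: integral_ae_eq => //=.
  by move=> E _ mE; rewrite -(Radon_Nikodym_SigmaFinite.f_integral dom).
Qed.

End lebesgue_change_of_variable.

(** * Expectations under a centred Gaussian law *)

Section gaussian_law.
Context (R : realType) d (T : measurableType d) (P : probability T R).
Notation mu := (@lebesgue_measure R).

Lemma normal_pdf_scaleE (v x : R) : 0 < v ->
  normal_pdf 0 (Num.sqrt v) x = (Num.sqrt pi)^-1 * ((Num.sqrt (2 * v))^-1 *
    expR (- ((Num.sqrt (2 * v))^-1 * x + 0) ^+ 2)).
Proof.
move=> v0; have s0 : Num.sqrt v != 0 by rewrite sqrtr_eq0 -ltNge.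
have v0' := ltW v0.
rewrite normal_pdfE// /normal_peak /normal_fun subr0 addr0 sqr_sqrtr//.
rewrite mulrA -invfM -sqrtrM ?pi_ge0//; congr (_^-1 * expR _).
  by congr Num.sqrt; rewrite mulr2n; ring.
rewrite exprMn exprVn sqr_sqrtr ?mulr_ge0// mulr2n; field.
by rewrite gt_eqF//=; lra.
Qed.

Lemma ge0_integral_gaussian (X : T -> R) (v : R) (f : R -> \bar R) : 0 < v ->
  measurable_fun setT X -> centered_gaussian P X v ->
  measurable_fun setT f -> (forall x, 0 <= f x)%E ->
  (\int[P]_w f (X w) = \int[mu]_x (f x * (normal_pdf 0 (Num.sqrt v) x)%:E))%E.
Proof.
move=> v0 mX; rewrite /centered_gaussian gt_eqF// => gX mf f0.
rewrite -ge0_integral_normal_prob//.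
have := @ge0_integral_pushforward _ _ T (measurableTypeR R) R X mX P setT f
  measurableT mf (fun y _ => f0 y).
rewrite preimage_setT => <-.
by apply: eq_measure_integral => A mA _; exact: gX.
Qed.

(** With [x = sqrt (2 * v) * y] the weight becomes [exp (- y ^ 2) / sqrt pi] for every variance. The
    point mass [v = 0] then obeys the same formula: the argument of [g] is 0 and the weight has
    total mass 1. *)
Lemma gaussian_expectation (X : T -> R) (v : R) (g : R -> R) : 0 <= v ->
  measurable_fun setT X -> centered_gaussian P X v -> measurable_fun setT g ->
  mu.-integrable setT (EFin \o (fun y => g (Num.sqrt (2 * v) * y) * expR (- y ^+ 2))) ->
  P.-integrable setT (EFin \o (g \o X)) /\
  \int[P]_w g (X w) = (Num.sqrt pi)^-1 *
    \int[mu]_y (g (Num.sqrt (2 * v) * y) * expR (- y ^+ 2)).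
Proof.
move=> v0 mX gX mg gi.
have mgX : measurable_fun setT (g \o X) by exact: measurableT_comp.
have sp0 : 0 < Num.sqrt pi :> R by rewrite sqrtr_gt0 pi_gt0.
move: v0; rewrite le_eqVlt => /predU1P[v0|v0].
  have ae0 : {ae P, forall w, cst (g 0) w = (g \o X) w}.
    move: gX; rewrite -v0 /centered_gaussian eqxx => P0.
    exists [set w | X w != 0]; split => //.
      rewrite (_ : mkset _ = X @^-1` (~` [set 0])).
        by rewrite -[X in measurable X]setTI; apply: mX => //; exact: measurableC.
      by apply/seteqP; split => w /= /eqP.
    by move=> w /=; apply: contra_not_neq => -> .
  have ic : P.-integrable setT (EFin \o cst (g 0)).
    exact: finite_measure_integrable_cst.
  split; first exact: integrable_ae_eq ae0 ic.
  rewrite -(ae_eq_Rintegral _ _ ae0)//.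
  rewrite -v0; under [in RHS]eq_Rintegral do rewrite mulr0 sqrtr0 mul0r.
  rewrite RintegralZl//; last exact: integrableT_gauss.
  rewrite [X in _ * (_ * X)](_ : _ = Num.sqrt pi); last first.
    by rewrite /Rintegral integralT_gauss.
  rewrite [LHS](_ : _ = g 0); last first.
    rewrite Rintegral_cst// (_ : fine _ = 1) ?mulr1//.
    exact: (congr1 fine (probability_setT P)).
  by field; rewrite gt_eqF.
set s := Num.sqrt (2 * v) in gi *.
have s0 : 0 < s by rewrite sqrtr_gt0 mulr_gt0.
have is0 : 0 < s^-1 by rewrite invr_gt0.
pose k y := (Num.sqrt pi)^-1 * (g (s * y) * expR (- y ^+ 2)).
have ik : mu.-integrable setT (EFin \o k) by exact: integrable_scale.
have kE x : g x * normal_pdf 0 (Num.sqrt v) x = s^-1 * k (s^-1 * x + 0).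
  have sx : s * (s^-1 * x + 0) = x by rewrite addr0 mulrA mulfV ?gt_eqF// mul1r.
  rewrite normal_pdf_scaleE// -/s /k sx; ring.
have ip : mu.-integrable setT (EFin \o (fun x => g x * normal_pdf 0 (Num.sqrt v) x)).
  rewrite (_ : (fun x => _) = (fun x => s^-1 * k (s^-1 * x + 0))).
    by apply: integrable_scale; exact: integrable_affine.
  by apply/funext => x; exact: kE.
have iX : P.-integrable setT (EFin \o (g \o X)).
  apply/integrableP; split; first exact/measurable_EFinP.
  rewrite /= (ge0_integral_gaussian (f := fun x => `|g x|%:E) v0 mX gX)//; last first.
    by apply/measurable_EFinP; exact: measurableT_comp.
  have /integrableP[_] := ip; apply: le_lt_trans.
  rewrite le_eqVlt; apply/orP; left; apply/eqP; apply: eq_integral => x _ /=.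
  by rewrite normrM EFinM (ger0_norm (normal_pdf_ge0 _ _ _)).
split => //.
transitivity (\int[mu]_x (g x * normal_pdf 0 (Num.sqrt v) x)); last first.
  under eq_Rintegral do rewrite kE.
  rewrite RintegralZl//; last exact: integrable_affine.
  by rewrite Rintegral_affine// mulrA mulfV ?invr_eq0 ?gt_eqF// mul1r RintegralZl.
(* The density is nonnegative, so it passes through positive and negative parts, and each part is
   covered by the formula for nonnegative functions. *)
rewrite /Rintegral [in LHS]integralE [in RHS]integralE; congr fine; congr (_ - _)%E.
- transitivity (\int[P]_w (fun x => (g x)%:E)^\+ (X w))%E.
    by apply: eq_integral => w _; rewrite !funeposE.
  rewrite (ge0_integral_gaussian v0 mX gX)//; last exact/measurable_funepos/measurable_EFinP.
  apply: eq_integral => x _; rewrite !funeposE EFinM.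
  by rewrite maxe_pMl// ?mul0e ?lee_fin ?normal_pdf_ge0.
- transitivity (\int[P]_w (fun x => (g x)%:E)^\- (X w))%E.
    by apply: eq_integral => w _; rewrite !funenegE.
  rewrite (ge0_integral_gaussian v0 mX gX)//; last exact/measurable_funeneg/measurable_EFinP.
  apply: eq_integral => x _; rewrite !funenegE EFinM -mulNe.
  by rewrite maxe_pMl// ?mul0e ?lee_fin ?normal_pdf_ge0.
Qed.

End gaussian_law.

(** * Gaussian integrals and the Fourier transform of the Gaussian *)

Section gauss_fourier.
Context (R : realType).
Notation mu := (@lebesgue_measure R).

Lemma integrable_lebesgue_le (f g : R -> R) : measurable_fun setT f ->
  (forall x, `|f x| <= g x) -> mu.-integrable setT (EFin \o g) ->
  mu.-integrable setT (EFin \o f).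
Proof. exact: (@integrable_le _ (measurableTypeR R) R mu f g). Qed.

Lemma integrable_continuous_le (f g : R -> R) : continuous f ->
  (forall x, `|f x| <= g x) -> mu.-integrable setT (EFin \o g) ->
  mu.-integrable setT (EFin \o f).
Proof.
move=> cf; apply: integrable_lebesgue_le; exact: continuous_measurable_fun.
Qed.

Lemma integrable_gauss (c b : R) : 0 < c ->
  mu.-integrable setT (EFin \o (fun x => expR (- (c * x + b) ^+ 2))).
Proof.
by move=> c0; exact: (@integrable_affine R c b _ c0 (@integrableT_gauss R)).
Qed.

Lemma Rintegral_gauss (c b : R) : 0 < c ->
  \int[mu]_x expR (- (c * x + b) ^+ 2) = Num.sqrt pi / c.
Proof.
move=> c0; rewrite (@Rintegral_affine R c b _ c0 (@integrableT_gauss R)).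
by rewrite /Rintegral integralT_gauss mulrC.
Qed.

Lemma integrable_gaussZ (c : R) : 0 < c ->
  mu.-integrable setT (EFin \o (fun x => expR (- (c * x ^+ 2)))).
Proof.
move=> c0; have s0 : 0 < Num.sqrt c by rewrite sqrtr_gt0.
have := integrable_gauss 0 s0.
under [X in EFin \o X]eq_fun do rewrite addr0 exprMn sqr_sqrtr ?ltW//.
exact.
Qed.

Lemma sq_gauss_le (x : R) : x ^+ 2 * expR (- x ^+ 2) <= 2 * expR (- (2^-1 * x ^+ 2)).
Proof.
have -> : - x ^+ 2 = - (2^-1 * x ^+ 2) + - (2^-1 * x ^+ 2) by lra.
rewrite expRD mulrA ler_pM2r ?expR_gt0// expRN ler_pdivrMr ?expR_gt0//.
have := @expR_ge1Dx R (2^-1 * x ^+ 2); lra.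
Qed.

Lemma integrable_sq_gauss :
  mu.-integrable setT (EFin \o (fun x : R => x ^+ 2 * expR (- x ^+ 2))).
Proof.
apply: (@integrable_lebesgue_le _ (fun x => 2 * expR (- (2^-1 * x ^+ 2)))).
- apply: measurable_funM; first exact: measurable_funX.
  exact: measurable_gauss_fun.
- by move=> x; rewrite ger0_norm ?sq_gauss_le// mulr_ge0 ?sqr_ge0 ?expR_ge0.
- by apply: integrable_scale; apply: integrable_gaussZ; rewrite invr_gt0.
Qed.

(** The fundamental theorem of calculus on [[- (n + 1), n + 1]] leaves boundary terms that vanish in
    the limit, and dominated convergence with majorant [|f|] recovers the whole line. Integration by
    parts is used below in this form. *)
Lemma Rintegral_derive_eq0 (F f : R -> R) : (forall x : R, is_derive x (1 : R) F (f x)) ->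
  continuous f -> mu.-integrable setT (EFin \o f) ->
  F x @[x --> +oo] --> 0 -> F x @[x --> -oo] --> 0 -> \int[mu]_x f x = 0.
Proof.
move=> dF cf fi Fp Fn.
have mf : measurable_fun setT f by exact: continuous_measurable_fun.
have dFx x : derivable F x 1 by apply: ex_derive.
have cF : continuous F.
  by move=> x; apply/differentiable_continuous/derivable1_diffP.
have I n : (\int[mu]_x ((f \_ `[- n.+1%:R, n.+1%:R]) x)%:E =
   (F n.+1%:R - F (- n.+1%:R))%:E)%E.
  transitivity (\int[mu]_(x in `[(- n.+1%:R)%R, n.+1%:R%R]) (f x)%:E)%E.
    rewrite [RHS]integral_mkcond; apply: eq_integral => x _.
    by rewrite restrict_EFin.
  rewrite (@continuous_FTC2 _ _ F) ?EFinB//.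
  - by rewrite -subr_gt0 opprK addr_gt0.
  - exact: continuous_subspaceT.
  - split.
    + by move=> x _.
    + exact/cvg_at_right_filter/cF.
    + exact/cvg_at_left_filter/cF.
  - by move=> x _; rewrite derive1E derive_val.
have D : (fun n => \int[mu]_x ((f \_ `[- n.+1%:R, n.+1%:R]) x)%:E)%E @ \oo -->
    (\int[mu]_x (f x)%:E)%E.
  apply: (@dominated_cvg _ _ _ mu setT measurableT _ _ (fun x => `|f x|%:E)) => //.
  - move=> n; apply/measurable_EFinP; apply/(measurable_restrictT _ _).1 => //.
    exact: measurable_funTS.
  - move=> x _; apply: (cvg_near_cst).
    near=> n; rewrite patchE ifT// inE /= in_itv/= -ler_norml.
    rewrite (le_trans (ltW (archi_boundP (normr_ge0 x))))// ler_nat.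
    near: n; exists (Num.bound `|x|) => // n /= h; exact: leq_trans h _.
  - by apply: integrable_norm.
  - move=> n x _; rewrite patchE; case: ifP => _ //=; rewrite lee_fin ?normr0//.
have E : (fun n => (F n.+1%:R - F (- n.+1%:R))%:E) @ \oo --> (0%:E : \bar R).
  apply: cvg_EFin; first by near=> n.
  rewrite /comp /= -[X in _ --> X](subr0 0); apply: cvgB.
  - apply: (cvg_comp _ _ _ Fp); apply/cvgryPge => r.
    near=> n; rewrite (le_trans (ler_norm _))//.
    rewrite (le_trans (ltW (archi_boundP (normr_ge0 r))))// ler_nat.
    near: n; exists (Num.bound `|r|) => // n /= h; exact: leq_trans h _.
  - apply: (cvg_comp _ _ _ Fn); apply/cvgrNyPle => r.
    near=> n; rewrite lerNl (le_trans (ler_norm _))//.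
    rewrite (le_trans (ltW (archi_boundP (normr_ge0 _))))// ler_nat.
    near: n; exists (Num.bound `|- r|) => // n /= h; exact: leq_trans h _.
rewrite /Rintegral.
have -> : (\int[mu]_x (f x)%:E = 0)%E; last by [].
apply: (cvg_unique _ D) => //.
by rewrite /= (funext I).
Unshelve. all: by end_near. Qed.

Lemma cvg_inv_bound (F : R -> R) (K : R) : (forall x, `|F x| * `|x| <= K) ->
  F x @[x --> +oo] --> 0 /\ F x @[x --> -oo] --> 0.
Proof.
move=> FK; split; apply/cvgrPdist_le => e e0; near=> x; rewrite sub0r normrN.
- have x0 : 0 < x by near: x; exact: nbhs_pinfty_gt.
  rewrite -(ler_pM2r x0) (le_trans _ (_ : K <= _))//.
    by rewrite -{2}(gtr0_norm x0).
  rewrite -ler_pdivrMl// mulrC; near: x; exact: nbhs_pinfty_ge.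
- have x0 : 0 < - x by rewrite oppr_gt0; near: x; exact: nbhs_ninfty_lt.
  rewrite -(ler_pM2r x0) (le_trans _ (_ : K <= _))//.
    by rewrite -(gtr0_norm x0) normrN.
  rewrite -ler_pdivrMl// mulrC lerNr; near: x; by apply: nbhs_ninfty_le; exact: num_real.
Unshelve. all: by end_near. Qed.

Lemma norm_gauss_le1 (x : R) : `|x| * expR (- x ^+ 2) <= 1.
Proof.
rewrite expRN ler_pdivrMr ?expR_gt0// mul1r.
have := @expR_ge1Dx R (x ^+ 2); have := real_normK (num_real x).
have := normr_ge0 x; nra.
Qed.

Lemma norm_gauss_le (x : R) :
  `|x| * expR (- x ^+ 2) <= expR (- x ^+ 2) + x ^+ 2 * expR (- x ^+ 2).
Proof.
rewrite -[X in X + _]mul1r -mulrDl ler_pM2r ?expR_gt0//.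
have := real_normK (num_real x); have := normr_ge0 x; nra.
Qed.

Lemma continuous_gauss : continuous (fun x : R => expR (- x ^+ 2)).
Proof. exact: continuous_gauss_fun. Qed.

Lemma continuous_cos_affine (a b : R) : continuous (fun x : R => cos (a * x + b)).
Proof.
move=> x; apply: continuous_comp; last exact: continuous_cos.
apply: cvgD; last exact: cvg_cst.
by apply: cvgM; [exact: cvg_cst|exact: cvg_id].
Qed.

Lemma continuous_sin_affine (a b : R) : continuous (fun x : R => sin (a * x + b)).
Proof.
move=> x; apply: continuous_comp; last exact: continuous_sin.
apply: cvgD; last exact: cvg_cst.
by apply: cvgM; [exact: cvg_cst|exact: cvg_id].
Qed.

Lemma norm_cos_le1 (x : R) : `|cos x| <= 1.
Proof. by rewrite ler_norml cos_geN1 cos_le1. Qed.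

Lemma norm_sin_le1 (x : R) : `|sin x| <= 1.
Proof. by rewrite ler_norml sin_geN1 sin_le1. Qed.

Lemma integrable_gauss_mul (f : R -> R) : measurable_fun setT f ->
  (forall x, `|f x| <= 1) ->
  mu.-integrable setT (EFin \o (fun x => expR (- x ^+ 2) * f x)).
Proof.
move=> mf f1; apply: (@integrable_lebesgue_le _ (fun x => expR (- x ^+ 2))).
- by apply: measurable_funM => //; exact: measurable_gauss_fun.
- by move=> x; rewrite normrM ger0_norm ?expR_ge0// ler_piMr ?expR_ge0.
- exact: integrableT_gauss.
Qed.

(** The derivative [exp (- x ^ 2) - 2 * x ^ 2 * exp (- x ^ 2)] of [x * exp (- x ^ 2)] has integral
    zero. *)
Lemma Rintegral_sq_gauss : \int[mu]_x (x ^+ 2 * expR (- x ^+ 2)) = Num.sqrt pi / 2.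
Proof.
have i1 := @integrableT_gauss R.
have i2 := integrable_scale 2 integrable_sq_gauss.
have h : \int[mu]_x (expR (- x ^+ 2) - 2 * (x ^+ 2 * expR (- x ^+ 2))) = 0.
  apply: (@Rintegral_derive_eq0 (fun x => x * expR (- x ^+ 2))).
  - move=> x; apply: is_derive_eq; rewrite /GRing.scale/=; ring.
  - move=> x; apply: cvgB; first exact: continuous_gauss.
    apply: cvgM; first exact: cvg_cst.
    by apply: cvgM; [exact: sqr_continuous|exact: continuous_gauss].
  - exact: integrable_sub.
  - apply: (proj1 (@cvg_inv_bound _ 1 _)) => x.
    rewrite normrM (ger0_norm (expR_ge0 _)) mulrAC -normrM -expr2.
    rewrite ger0_norm ?sqr_ge0// expRN ler_pdivrMr ?expR_gt0// mul1r.
    have := @expR_ge1Dx R (x ^+ 2); lra.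
  - apply: (proj2 (@cvg_inv_bound _ 1 _)) => x.
    rewrite normrM (ger0_norm (expR_ge0 _)) mulrAC -normrM -expr2.
    rewrite ger0_norm ?sqr_ge0// expRN ler_pdivrMr ?expR_gt0// mul1r.
    have := @expR_ge1Dx R (x ^+ 2); lra.
move: h; rewrite RintegralB// (RintegralZl _ _ integrable_sq_gauss)//.
rewrite [X in X - _](_ : _ = Num.sqrt pi); first lra.
by rewrite /Rintegral integralT_gauss.
Qed.

Lemma integrable_gauss_cos (a : R) :
  mu.-integrable setT (EFin \o (fun x => expR (- x ^+ 2) * cos (a * x))).
Proof.
apply: integrable_gauss_mul => [|x]; last exact: norm_cos_le1.
have := @continuous_cos_affine a 0; under eq_fun do rewrite addr0.
exact: continuous_measurable_fun.
Qed.

Lemma integrable_gauss_ysin (a : R) :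
  mu.-integrable setT (EFin \o (fun x => x * expR (- x ^+ 2) * sin (a * x))).
Proof.
apply: (@integrable_continuous_le _
  (fun x => expR (- x ^+ 2) + x ^+ 2 * expR (- x ^+ 2))).
- move=> x; apply: cvgM.
    by apply: cvgM; [exact: cvg_id|exact: continuous_gauss].
  have := @continuous_sin_affine a 0 x; under eq_fun do rewrite addr0.
  exact.
- move=> x; rewrite !normrM (ger0_norm (expR_ge0 _)).
  apply: (le_trans _ (norm_gauss_le x)).
  by rewrite ler_piMr ?norm_sin_le1// mulr_ge0 ?expR_ge0.
- exact: (integrable_add (@integrableT_gauss R) integrable_sq_gauss).
Qed.

(** Integration by parts, in the form of a zero integral for the derivative of
    [exp (- x ^ 2) * sin (a * x)]. *)
Lemma Rintegral_gauss_ysin (a : R) :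
  \int[mu]_x (x * expR (- x ^+ 2) * sin (a * x)) =
  a / 2 * \int[mu]_x (expR (- x ^+ 2) * cos (a * x)).
Proof.
have i1 := integrable_gauss_cos a; have i2 := integrable_gauss_ysin a.
have b x : `|expR (- x ^+ 2) * sin (a * x)| * `|x| <= 1.
  rewrite normrM (ger0_norm (expR_ge0 _)) mulrAC (le_trans _ (norm_gauss_le1 x))//.
  by rewrite [leRHS]mulrC ler_piMr ?norm_sin_le1// mulr_ge0 ?expR_ge0.
have h : \int[mu]_x (a * (expR (- x ^+ 2) * cos (a * x)) -
    2 * (x * expR (- x ^+ 2) * sin (a * x))) = 0.
  apply: (@Rintegral_derive_eq0 (fun x => expR (- x ^+ 2) * sin (a * x))).
  - move=> x; apply: is_derive_eq; rewrite /GRing.scale/=; ring.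
  - move=> x; apply: cvgB; (apply: cvgM; first exact: cvg_cst).
    + apply: cvgM; first exact: continuous_gauss.
      have := @continuous_cos_affine a 0 x; under eq_fun do rewrite addr0.
      exact.
    + apply: cvgM.
        by apply: cvgM; [exact: cvg_id|exact: continuous_gauss].
      have := @continuous_sin_affine a 0 x; under eq_fun do rewrite addr0.
      exact.
  - by apply: integrable_sub; exact: integrable_scale.
  - exact: (proj1 (cvg_inv_bound b)).
  - exact: (proj2 (cvg_inv_bound b)).
move: h; rewrite RintegralB//; [|exact: integrable_scale..].
rewrite RintegralZl// RintegralZl//; lra.
Qed.

(** As a function of [a] the integral [F] solves [F' = - (a / 2) * F], by differentiation under the
    integral sign, so [F a * exp (a ^ 2 / 4)] is constant and equal to [F 0 = sqrt pi]. The
    derivatives are dominated, uniformly in [a], by [(1 + y ^ 2) * exp (- y ^ 2)]. *)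
Lemma Rintegral_gauss_cos (a : R) :
  \int[mu]_x (expR (- x ^+ 2) * cos (a * x)) = Num.sqrt pi * expR (- (a ^+ 2 / 4)).
Proof.
pose F a := \int[mu]_x (expR (- x ^+ 2) * cos (a * x)).
have dcos (y b : R) : is_derive b (1 : R) (fun b : R => expR (- y ^+ 2) * cos (b * y))
    (- (y * expR (- y ^+ 2) * sin (b * y))).
  by apply: is_derive_eq; rewrite /GRing.scale/=; ring.
have dF (b : R) : is_derive b (1 : R) F (- (b / 2) * F b).
  have dE x y : partial1of2 (fun b y : R => expR (- y ^+ 2) * cos (b * y)) x y =
      - (y * expR (- y ^+ 2) * sin (x * y)).
    by rewrite partial1of2E derive_val.
  have Ib : `]b - 1, b + 1[%classic b by rewrite /= in_itv/=; lra.
  have ic (x : R) := integrable_gauss_cos x.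
  have df (x y : R) : `]b - 1, b + 1[%classic x -> setT y ->
    derivable (fun b : R => expR (- y ^+ 2) * cos (b * y)) x (1 : R).
    by move=> _ _; exact: ex_derive.
  have iG : mu.-integrable setT
      (EFin \o (fun x => expR (- x ^+ 2) + x ^+ 2 * expR (- x ^+ 2))).
    exact: (integrable_add (@integrableT_gauss R) integrable_sq_gauss).
  have G0 (y : R) : 0 <= expR (- y ^+ 2) + y ^+ 2 * expR (- y ^+ 2).
    exact: addr_ge0 (expR_ge0 _) (mulr_ge0 (sqr_ge0 _) (expR_ge0 _)).
  have Gub (x y : R) : `]b - 1, b + 1[%classic x -> setT y ->
      `|partial1of2 (fun b y : R => expR (- y ^+ 2) * cos (b * y)) x y| <=
      expR (- y ^+ 2) + y ^+ 2 * expR (- y ^+ 2).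
    move=> _ _; rewrite dE normrN !normrM (ger0_norm (expR_ge0 _)).
    apply: (@le_trans _ _ (`|y| * expR (- y ^+ 2))).
      by rewrite ler_piMr ?norm_sin_le1// mulr_ge0 ?expR_ge0.
    exact: norm_gauss_le.
  have d1 := @derivable_under_integral R _ _ mu _ setT measurableT b _ _ Ib
    (fun x _ => ic x) df _ G0 iG Gub.
  have d2 := @differentiation_under_integral R _ _ mu _ setT measurableT b _ _ Ib
    (fun x _ => ic x) df _ G0 iG Gub.
  apply: DeriveDef; first exact: d1.
  rewrite -derive1E d2; under eq_Rintegral do rewrite dE -mulN1r.
  rewrite (RintegralZl _ _ (integrable_gauss_ysin b))// Rintegral_gauss_ysin /F; ring.
pose G b := F b * expR (b ^+ 2 / 4).
have dG (b : R) : is_derive b (1 : R) G 0.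
  by apply: is_derive_eq; rewrite /GRing.scale/=; field.
have := is_derive_0_is_cst a 0 dG.
rewrite /G expr0n /= mul0r expR0 mulr1.
have -> : F 0 = Num.sqrt pi.
  rewrite /F; under eq_Rintegral do rewrite mul0r cos0 mulr1.
  by rewrite /Rintegral integralT_gauss.
by move=> <-; rewrite -mulrA -expRD subrr expR0 mulr1.
Qed.

(** After centring at [x] the sine contribution is odd and drops out. The constant phase [p] will
    carry the time dependence, and a shift of it by [pi / 2] yields the sine version. *)
Lemma Rintegral_gauss_cos_shift (x b p : R) :
  \int[mu]_y (expR (- (y - x) ^+ 2) * cos (b * y + p)) =
  Num.sqrt pi * expR (- (b ^+ 2 / 4)) * cos (b * x + p).
Proof.
pose f y := expR (- y ^+ 2) * cos (b * y + (b * x + p)).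
have ic := integrable_gauss_cos b.
have isn : mu.-integrable setT (EFin \o (fun x => expR (- x ^+ 2) * sin (b * x))).
  apply: integrable_gauss_mul => [|y]; last exact: norm_sin_le1.
  have := @continuous_sin_affine b 0; under eq_fun do rewrite addr0.
  exact: continuous_measurable_fun.
have fi : mu.-integrable setT (EFin \o f).
  apply: integrable_gauss_mul => [|y]; last exact: norm_cos_le1.
  apply: continuous_measurable_fun; exact: continuous_cos_affine.
transitivity (\int[mu]_y f (1 * y + - x)).
  apply: eq_Rintegral => y _; rewrite /f mul1r; congr (_ * cos _); ring.
rewrite Rintegral_affine// invr1 mul1r /f.
transitivity (\int[mu]_y (cos (b * x + p) * (expR (- y ^+ 2) * cos (b * y)) -
   sin (b * x + p) * (expR (- y ^+ 2) * sin (b * y)))).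
  by apply: eq_Rintegral => y _; rewrite cosD; ring.
rewrite RintegralB//; [|exact: integrable_scale..].
rewrite RintegralZl// RintegralZl// Rintegral_gauss_cos.
rewrite (Rintegral_odd isn) ?mulr0 ?subr0; first by rewrite mulrC.
by move=> y; rewrite sqrrN mulrN sinN mulrN.
Qed.

Lemma Rintegral_gauss_sin_shift (x b p : R) :
  \int[mu]_y (expR (- (y - x) ^+ 2) * sin (b * y + p)) =
  Num.sqrt pi * expR (- (b ^+ 2 / 4)) * sin (b * x + p).
Proof.
have sE z : sin (b * z + p) = cos (b * z + (p - pi / 2)).
  by rewrite addrA cosBpihalf.
under eq_Rintegral do rewrite sE.
by rewrite Rintegral_gauss_cos_shift sE.
Qed.

End gauss_fourier.

(** * Approximation by trigonometric polynomials through Bernstein averages *)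

Section trigonometric_approximation.
Context (R : realType) (N : nat).
Implicit Types (y x : 'I_N -> R) (s : seq 'I_N) (phi : ('I_N -> nat) -> R).

(** Each entry lists a coefficient, a frequency vector and a phase. The phase absorbs sines, and a
    single shifted cosine has an explicit Gaussian expectation. *)
Definition trig_poly (f : ('I_N -> R) -> R) : Prop :=
  exists s : seq (R * ('I_N -> R) * R),
    forall x, f x = \sum_(c <- s) c.1.1 * cos (\sum_i c.1.2 i * x i + c.2).

Lemma trig_poly_cst (c : R) : trig_poly (fun=> c).
Proof.
exists [:: (c, (fun=> 0), 0)] => x; rewrite big_seq1/= big1 ?addr0 ?cos0 ?mulr1//.
by move=> i _; rewrite mul0r.
Qed.

Lemma trig_polyD f g : trig_poly f -> trig_poly g -> trig_poly (fun x => f x + g x).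
Proof. by move=> [s fs] [t gt]; exists (s ++ t) => x; rewrite big_cat fs gt. Qed.

(** Product-to-sum: [sin u * cos v] is half of [sin (v + u) - sin (v - u)], and each sine is a
    cosine whose phase is lowered by [pi / 2]. Only the frequency of coordinate [i] moves, by [l] or
    [- l]. *)
Lemma trig_poly_mul_sin f (i : 'I_N) (l : R) : trig_poly f ->
  trig_poly (fun x => sin (l * x i) * f x).
Proof.
move=> [s fs].
pose e (a : R) (c : R * ('I_N -> R) * R) : R * ('I_N -> R) * R :=
  (a / 2 * c.1.1, (fun j => c.1.2 j + a * (l *+ (j == i))), c.2 - pi / 2).
exists ([seq e 1 c | c <- s] ++ [seq e (-1) c | c <- s]) => x.
rewrite fs big_cat/= !big_map -big_split/= mulr_sumr; apply: eq_bigr => c _.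
have sumE a : \sum_j (c.1.2 j + a * (l *+ (j == i))) * x j =
    \sum_j c.1.2 j * x j + a * (l * x i).
  under eq_bigr do rewrite mulrDl.
  rewrite big_split/=; congr (_ + _); rewrite (bigD1 i)//= eqxx big1 ?addr0.
    by rewrite mulr1n mulrA.
  by move=> j /negbTE ->; rewrite mulr0n mulr0 mul0r.
rewrite !sumE; set u := \sum_j _.
rewrite !addrA !cosBpihalf.
have -> : u + 1 * (l * x i) + c.2 = (u + c.2) + l * x i by ring.
have -> : u + -1 * (l * x i) + c.2 = (u + c.2) - l * x i by ring.
by rewrite sinD sinB; field.
Qed.

Lemma trig_poly_scale f (k : R) : trig_poly f -> trig_poly (fun x => k * f x).
Proof.
move=> [s fs]; exists [seq (k * c.1.1, c.1.2, c.2) | c <- s] => x.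
rewrite fs big_map mulr_sumr; apply: eq_bigr => c _; by rewrite mulrA.
Qed.

(* The expectation of [phi (n + S)], where [S] counts, coordinate by coordinate,
   the successes of independent trials, one for each entry [i] of [s], with
   success probability [y i]. For constant multiplicities this is the Bernstein
   operator. *)
Fixpoint bernstein y s phi (n : 'I_N -> nat) : R :=
  if s is i :: s' then
    y i * bernstein y s' phi (fun j => n j + (j == i))%N +
    (1 - y i) * bernstein y s' phi n
  else phi n.

Lemma bernstein_cst y s (c : R) n : bernstein y s (fun=> c) n = c.
Proof. by elim: s n => //= i s IH n; rewrite !IH; ring. Qed.

Lemma bernsteinD y s phi psi n :
  bernstein y s (fun m => phi m + psi m) n = bernstein y s phi n + bernstein y s psi n.
Proof. by elim: s n => //= i s IH n; rewrite !IH; ring. Qed.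

Lemma bernsteinZ y s phi (k : R) n :
  bernstein y s (fun m => k * phi m) n = k * bernstein y s phi n.
Proof. by elim: s n => //= i s IH n; rewrite !IH; ring. Qed.

Lemma bernstein_sum y s (I : Type) (r : seq I) (phi : I -> ('I_N -> nat) -> R) n :
  bernstein y s (fun m => \sum_(i <- r) phi i m) n = \sum_(i <- r) bernstein y s (phi i) n.
Proof.
elim: r => [|i r IH].
  rewrite big_nil -[RHS](bernstein_cst y s 0 n); congr (bernstein _ _ _ _).
  by apply/funext => m; rewrite big_nil.
rewrite big_cons -IH -bernsteinD; congr (bernstein _ _ _ _).
by apply/funext => m; rewrite big_cons.
Qed.

Lemma le_bernstein y s phi psi n : (forall i, 0 <= y i <= 1) ->
  (forall m, phi m <= psi m) -> bernstein y s phi n <= bernstein y s psi n.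
Proof.
move=> y01 le; elim: s n => //= i s IH n; have /andP[y0 y1] := y01 i.
by apply: lerD; apply: ler_wpM2l; rewrite ?subr_ge0.
Qed.

(** Squared bias plus variance for [n i] increased by a binomial count with [count_mem i s]
    trials. *)
Lemma bernstein_variance y s (i : 'I_N) (c : R) n :
  bernstein y s (fun m => ((m i)%:R - c) ^+ 2) n =
  ((n i)%:R + (count_mem i s)%:R * y i - c) ^+ 2
  + (count_mem i s)%:R * (y i * (1 - y i)).
Proof.
elim: s n => [|j s IH] n /=; first by rewrite !mul0r addr0 addr0.
rewrite !IH eq_sym; case: (eqVneq i j) => [<-|ij] /=.
  rewrite !natrD /=; ring.
by rewrite addn0 add0n; ring.
Qed.

Lemma trig_poly_bernstein s phi n (l : R) :
  trig_poly (fun x => bernstein (fun i => (1 + sin (l * x i)) / 2) s phi n).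
Proof.
elim: s n => [|i s IH] n /=; first exact: trig_poly_cst.
pose b x n' := bernstein (fun i => (1 + sin (l * x i)) / 2) s phi n'.
pose n1 := (fun j => n j + (j == i))%N.
suff : trig_poly (fun x => (2^-1 * b x n1 + 2^-1 * b x n) +
    (2^-1 * (sin (l * x i) * b x n1) + - 2^-1 * (sin (l * x i) * b x n))).
  by congr trig_poly; apply/funext => x; rewrite /b; field.
apply: trig_polyD; apply: trig_polyD; apply: trig_poly_scale; try exact: IH;
  apply: trig_poly_mul_sin; exact: IH.
Qed.

Lemma count_mem_flatten_enum (K : nat) (i : 'I_N) :
  count_mem i (flatten (nseq K (enum 'I_N))) = K.
Proof.
elim: K => //= K IH; rewrite count_cat IH count_uniq_mem ?enum_uniq//.
by rewrite mem_enum.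
Qed.

Lemma unif_continuous_box (h : 'rV[R]_N -> R) (L e : R) : continuous h -> 0 < e ->
  exists2 r : R, 0 < r & forall v v' : 'rV[R]_N, (forall i, `|v ord0 i| <= L) ->
    (forall i, `|v ord0 i - v' ord0 i| < r) -> `|h v - h v'| <= e.
Proof.
move=> ch e0.
have cb : compact [set v : 'rV[R]_N | forall i, `[- L, L]%classic (v ord0 i)].
  by apply: (@rV_compact _ _ (fun=> `[- L, L]%classic)) => _; exact: segment_compact.
move: cb => /compact_near_coveringP /(_ R (0^'+)
  (fun r v => forall v' : 'rV[R]_N, (forall i, `|v ord0 i - v' ord0 i| < r) -> `|h v - h v'| <= e)).
case.
  move=> v _; have /cvgrPdist_lt := ch v => /(_ (e / 2)).
  rewrite divr_gt0// => /(_ isT) /nbhs_ballP[/= r r0 hr].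
  (* Halving the radius keeps both the moved centre and its perturbation within [r] of [v], so each
     differs from [h v] by less than [e / 2]. *)
  exists ([set v' | ball v (r / 2) v'], [set r' | 0 < r' < r / 2]) => /=.
    split; first by apply: nbhsx_ballx; rewrite divr_gt0.
    near=> r'; apply/andP; split; near: r'; first exact: nbhs_right_gt.
    by apply: nbhs_right_lt; rewrite divr_gt0.
  move=> [v' r'] /= [vv' /andP[r'0 r'r]] v'' v'v''.
  have h1 := hr v' (le_ball _ vv').
  have h2 : ball v r v''.
    rewrite (splitr r); apply: ball_triangle vv' _; split; first by rewrite divr_gt0.
    move=> k i; rewrite /ball/=.
    by rewrite ord1 (lt_trans (v'v'' i)).
  have {}h1 : `|h v - h v'| < e / 2 by apply: h1; lra.
  have {}h2 := hr _ h2; rewrite /= in h2.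
  rewrite (_ : h v' - h v'' = (h v - h v'') - (h v - h v')); last ring.
  by rewrite (le_trans (ler_normB _ _))// (splitr e) lerD// ltW.
move=> r /= r0 hr; exists (r / 2); first by rewrite divr_gt0.
move=> v v' vL vv'; apply: (hr (r / 2)).
- by rewrite /= sub0r normrN gtr0_norm ?divr_gt0// ltr_pdivrMr// ltr_pMr// ltr1n.
- by rewrite divr_gt0.
- by move=> i; rewrite /= in_itv/= -ler_norml.
- exact: vv'.
Unshelve. all: by end_near. Qed.

(** Inverse of [a -> (1 + sin a) / 2] on [[-1, 1]]. Clamping to [[- sin 1, sin 1]], the image of
    [[-1, 1]] under sine, makes it total: values of [u] off the range go to an endpoint. *)
Definition trig_node (u : R) : R :=
  asin (Num.max (- sin 1) (Num.min (sin 1) (2 * u - 1))).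

Lemma sin1_bound : 0 <= sin (1 : R) <= 1.
Proof.
rewrite sin_le1 andbT ltW// sin_gt0_pi// ltr01/=.
by have := @pi_ge2 R; lra.
Qed.

(** Mean value theorem, with cosine at least [cos 1] on [[-1, 1]]. *)
Lemma sin_dist_ge (a b : R) : `|a| <= 1 -> `|b| <= 1 ->
  cos 1 * `|a - b| <= `|sin a - sin b|.
Proof.
wlog ab : a b / a <= b.
  move=> H a1 b1; have [/H|/ltW/H] := leP a b; first exact.
  by rewrite (distrC a) (distrC (sin a)); apply.
move=> a1 b1; have [|c cab sE] := @MVT_segment R sin cos a b ab.
- by apply: continuous_subspaceT; exact: continuous_sin.
rewrite (distrC a) (distrC (sin a)) sE normrM ler_wpM2r//.
have c1 : `|c| <= 1.
  move: cab a1 b1; rewrite in_itv/= !ler_norml => /andP[? ?] /andP[? ?] /andP[? ?].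
  by apply/andP; split; lra.
rewrite (le_trans _ (ler_norm _))// -(cos_norm c) leNgt; apply/negP.
have pi2 := @pi_ge2 R; have c0 := normr_ge0 c.
rewrite ltr_cos ?in_itv/=; [|by apply/andP; split; lra..].
by rewrite ltNge c1.
Qed.

Lemma trig_nodeP (u : R) : `|trig_node u| <= 1 /\
  sin (trig_node u) = Num.max (- sin 1) (Num.min (sin 1) (2 * u - 1)).
Proof.
rewrite /trig_node; set c := Num.max _ _; have /andP[s0 s1] := sin1_bound.
have ph := @pihalf_ge1 R.
have cs : - sin 1 <= c <= sin 1.
  rewrite /c le_max lexx/= ge_max ge_min lexx/= andbT.
  by rewrite (le_trans _ s0)// oppr_le0.
have /andP[cl cr] := cs.
have c1 : -1 <= c <= 1 by apply/andP; split; lra.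
have cK : sin (asin c) = c by apply: asinK; rewrite in_itv.
split => //; rewrite ler_norml; have al := asin_geNpi2 c1; have ar := asin_lepi2 c1.
have ain : asin c \in `[- (pi / 2), pi / 2] by rewrite in_itv/= al ar.
apply/andP; split; rewrite leNgt; apply/negP => h.
- have : sin (asin c) < sin (-1).
    by rewrite ltr_sin// in_itv/=; apply/andP; split; lra.
  by rewrite cK sinN ltNge cl.
- have : sin 1 < sin (asin c).
    by rewrite ltr_sin// in_itv/=; apply/andP; split; lra.
  by rewrite cK ltNge cr.
Qed.

(** Since [sin a] lies in the clamping interval, clamping [2 * u - 1] cannot increase its distance
    to [sin a]. *)
Lemma trig_node_dist (a u : R) : `|a| <= 1 ->
  cos 1 * `|a - trig_node u| <= 2 * `|(1 + sin a) / 2 - u|.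
Proof.
move=> a1; have [n1 nE] := trig_nodeP u.
apply: (le_trans (sin_dist_ge a1 n1)); rewrite nE.
have ph := @pihalf_ge1 R; move: a1; rewrite ler_norml => /andP[al ar].
have sal : - sin 1 <= sin a.
  rewrite -sinN leNgt; apply/negP; rewrite ltr_sin ?in_itv/= ?ltNge ?al//;
  by apply/andP; split; lra.
have sar : sin a <= sin 1.
  rewrite leNgt; apply/negP; rewrite ltr_sin ?in_itv/= ?ltNge ?ar//;
  by apply/andP; split; lra.
have -> : 2 * `|(1 + sin a) / 2 - u| = `|sin a - (2 * u - 1)|.
  by rewrite -[X in X * _](@ger0_norm _ 2)// -normrM; congr `|_|; field.
set t := sin a in sal sar *; set z := 2 * u - 1; set s1 := sin 1 in sal sar *.
rewrite /Num.max /Num.min.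
case: (ltP s1 z) => h1; case: ltP => h2; rewrite ler_norml; apply/andP;
  have := ler_norm (t - z); have := lerNnormlW (lexx `|t - z|); lra.
Qed.

(** On the box [|x i| <= L] the map from [x i] to [(1 + sin (x i / L)) / 2] has an inverse of
    controlled modulus, so Bernstein's argument by Chebyshev's inequality applies. Outside the box
    periodicity ruins the approximation, and the weight [1 + |x| ^ 2] pays for the crude bound
    [2 * B]. *)
Lemma trig_approximation (h : 'rV[R]_N -> R) (B dlt : R) : continuous h ->
  (forall v, `|h v| <= B) -> 0 < dlt ->
  exists2 f, trig_poly f &
    forall x, `|h (\row_i x i) - f x| <= dlt * (1 + \sum_i x i ^+ 2).
Proof.
move=> ch hB d0.
have B0 : 0 <= B by exact: le_trans (normr_ge0 _) (hB 0).
(* As [L >= 1] and [L - 1 = 2 * B / dlt], a coordinate with [|x i| > L] satisfies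
   [dlt * x i ^ 2 >= 2 * B]. *)
pose L := 1 + 2 * B / dlt.
have L0 : 0 < L by rewrite ltr_pwDl// divr_ge0// ?mulr_ge0// ltW.
have [r r0 hr] := @unif_continuous_box h L (dlt / 2) ch (divr_gt0 d0 (ltr0n _ 2)).
have c0 := @cos1_gt0 R.
(* A deviation below [rho] in the variable [y i] places the sample point within
   [2 * L * rho / cos 1 = r] of [x i]. *)
pose rho := r * cos 1 / (2 * L).
have rho0 : 0 < rho by rewrite divr_gt0 ?mulr_gt0.
(* Chebyshev weight: [Q] times the squared deviation exceeds the trivial error [2 * B] once the
   deviation reaches [rho]. *)
have [Q Q0 QE] : exists2 Q : R, 0 <= Q & Q * rho ^+ 2 = 2 * B.
  exists (2 * B / rho ^+ 2); last by rewrite divfK// expf_neq0// gt_eqF.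
  by apply: divr_ge0; [exact: mulr_ge0|exact: sqr_ge0].
(* Trials per coordinate: each of the [N] relative frequencies has variance at most [1 / K]. *)
pose K := (Num.bound (2 * Q * N%:R / dlt)).+1.
have KQ : Q * N%:R / K%:R <= dlt / 2.
  have /archi_boundP h1 : 0 <= 2 * Q * N%:R / dlt.
    by rewrite divr_ge0 ?mulr_ge0// ltW.
  have : 2 * Q * N%:R / dlt <= K%:R by rewrite (le_trans (ltW h1))// ler_nat leqnSn.
  by rewrite ler_pdivrMr// ler_pdivrMr ?ltr0n//; lra.
pose phi (n : 'I_N -> nat) := h (\row_i (L * trig_node ((n i)%:R / K%:R))).
pose s := flatten (nseq K (enum 'I_N)).
pose n0 (i : 'I_N) := 0%N.
exists (fun x => bernstein (fun i => (1 + sin (L^-1 * x i)) / 2) s phi n0).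
  exact: trig_poly_bernstein.
move=> x; set y := (X in bernstein X).
have y01 i : 0 <= y i <= 1.
  rewrite /y; have := sin_geN1 (L^-1 * x i); have := sin_le1 (L^-1 * x i).
  by move=> ? ?; apply/andP; split; lra.
have sx0 : 0 <= \sum_i x i ^+ 2 by apply: sumr_ge0 => i _; exact: sqr_ge0.
have E0 : `|h (\row_i x i) - bernstein y s phi n0| <=
    bernstein y s (fun n => `|h (\row_i x i) - phi n|) n0.
  have -> : h (\row_i x i) - bernstein y s phi n0 =
      bernstein y s (fun n => h (\row_i x i) - phi n) n0.
    under [in RHS]eq_fun do rewrite -mulN1r.
    by rewrite bernsteinD bernstein_cst bernsteinZ mulN1r.
  rewrite ler_norml -mulN1r -bernsteinZ; apply/andP; split;
    apply: le_bernstein => // n; rewrite ?mulN1r; last exact: ler_norm.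
  by rewrite lerNl -normrN ler_norm.
apply: (le_trans E0).
have [/existsP[i xi]|/existsPn xL] := boolP [exists i, L < `|x i|].
  apply: (@le_trans _ _ (2 * B)).
    rewrite -[leRHS](bernstein_cst y s _ n0); apply: le_bernstein => // n.
    by rewrite (le_trans (ler_normB _ _))// mulr_natl mulr2n lerD// hB.
  have : 2 * B / dlt <= x i ^+ 2.
    have L1 : 1 <= L by rewrite lerDl divr_ge0 ?mulr_ge0// ltW.
    rewrite -[x i ^+ 2]real_normK ?num_real//.
    have -> : 2 * B / dlt = L - 1 by rewrite /L; ring.
    by nra.
  rewrite ler_pdivrMr// => /le_trans; apply.
  rewrite mulrC ler_pM2l// (bigD1 i)//=.
  have : 0 <= \sum_(j | j != i) x j ^+ 2 by apply: sumr_ge0 => j _; exact: sqr_ge0.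
  lra.
have {}xL i : `|L^-1 * x i| <= 1.
  by rewrite normrM gtr0_norm ?invr_gt0// ler_pdivrMl// mulr1 leNgt.
apply: (@le_trans _ _ dlt); last by rewrite ler_pMr// lerDl.
(* Counts close to their mean cost [dlt / 2] by uniform continuity, the others at most [2 * B],
   which the quadratic term absorbs. The deviation is scaled by [K] so that [bernstein_variance]
   evaluates its average. *)
apply: (@le_trans _ _ (bernstein y s
   (fun n => dlt / 2 + Q * \sum_i (K%:R ^- 2 * ((n i)%:R - K%:R * y i) ^+ 2)) n0)).
  apply: le_bernstein => // n.
  have K0 : 0 < K%:R :> R by rewrite ltr0n.
  have sq i : K%:R ^- 2 * ((n i)%:R - K%:R * y i) ^+ 2 = (y i - (n i)%:R / K%:R) ^+ 2.
    by field; exact: lt0r_neq0.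
  under eq_bigr do rewrite sq.
  have S0 (P : pred 'I_N) : 0 <= \sum_(i | P i) (y i - (n i)%:R / K%:R) ^+ 2.
    by apply: sumr_ge0 => i _; exact: sqr_ge0.
  have [/forallP near|] := boolP [forall i, `|y i - (n i)%:R / K%:R| < rho].
    apply: (@le_trans _ _ (dlt / 2)); last by rewrite lerDl mulr_ge0//; exact: S0.
    apply: hr => i; rewrite !mxE.
      by move: (xL i); rewrite normrM gtr0_norm ?invr_gt0// ler_pdivrMl// mulr1.
    have := trig_node_dist ((n i)%:R / K%:R) (xL i); rewrite -/(y i).
    set nd := trig_node _ => h1.
    have -> : x i - L * nd = L * (L^-1 * x i - nd) by field; exact: lt0r_neq0.
    rewrite normrM (gtr0_norm L0) -(ltr_pM2l c0) mulrCA.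
    apply: (@le_lt_trans _ _ (L * (2 * `|y i - (n i)%:R / K%:R|))).
      by rewrite ler_pM2l.
    apply: (@lt_le_trans _ _ (L * (2 * rho))); first by rewrite !ltr_pM2l.
    by rewrite /rho le_eqVlt; apply/orP; left; apply/eqP; field; exact: lt0r_neq0.
  rewrite negb_forall => /existsP[i]; rewrite -leNgt => far.
  apply: (@le_trans _ _ (2 * B)).
    by rewrite (le_trans (ler_normB _ _))// mulr_natl mulr2n lerD// hB.
  apply: (@le_trans _ _ (Q * rho ^+ 2)).
    by rewrite QE.
  rewrite -[leLHS]add0r lerD//; first by rewrite divr_ge0// ltW.
  rewrite ler_wpM2l// (bigD1 i)//=.
  have h1 : rho ^+ 2 <= (y i - (n i)%:R / K%:R) ^+ 2.
    by rewrite -[leRHS]real_normK ?num_real// ler_sqr ?nnegrE// ltW.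
  rewrite (le_trans h1)// lerDl; exact: S0.
rewrite bernsteinD bernstein_cst bernsteinZ bernstein_sum.
have K0 : K%:R != 0 :> R by rewrite pnatr_eq0.
rewrite [leRHS](splitr dlt) lerD2l.
apply: le_trans KQ; rewrite -mulrA ler_wpM2l//.
rewrite (_ : N%:R / K%:R = \sum_(i < N) K%:R^-1); last first.
  by rewrite sumr_const card_ord mulr_natl.
apply: ler_sum => i _; rewrite bernsteinZ bernstein_variance.
rewrite count_mem_flatten_enum /n0 add0r subrr expr0n/= add0r mulrA.
have -> : K%:R ^- 2 * K%:R = K%:R^-1 :> R by field.
have /andP[y0 y1] := y01 i; rewrite ler_piMr ?invr_ge0//; nra.
Qed.

End trigonometric_approximation.

(** * Jointly Gaussian families and the convergence of their laws *)

Section gaussian_family.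
Context (R : realType) d (T : measurableType d) (P : probability T R).
Notation mu := (@lebesgue_measure R).

Lemma centered_gaussian_ae (X Y : T -> R) (v : R) : measurable_fun setT X ->
  measurable_fun setT Y -> {ae P, forall w, X w = Y w} ->
  centered_gaussian P X v -> centered_gaussian P Y v.
Proof.
move=> mX mY XY.
have PE (B : set R) : measurable B -> P (X @^-1` B) = P (Y @^-1` B).
  move=> mB; have mXB : measurable (X @^-1` B).
    by rewrite -[X in measurable X]setTI; exact: mX.
  have mYB : measurable (Y @^-1` B).
    by rewrite -[X in measurable X]setTI; exact: mY.
  have IE A : measurable A -> P A = (\int[P]_w (\1_A w)%:E)%E.
    by move=> mA; rewrite integral_indic// setIT.
  rewrite !IE//; apply: ae_eq_integral => //.
  - exact/measurable_EFinP/measurable_indic.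
  - exact/measurable_EFinP/measurable_indic.
  - apply: filterS XY => w XYw _; rewrite /= !indicE.
    by congr ((nat_of_bool _)%:R%:E); apply/idP/idP; rewrite !inE /= XYw.
have P0 (Z : T -> R) : [set w | Z w != 0] = Z @^-1` (~` [set 0]).
  by apply/seteqP; split => w /= /eqP.
rewrite /centered_gaussian; case: ifP => _.
  by rewrite !P0 => <-; rewrite PE//; exact: measurableC.
by move=> gX B mB; rewrite -PE// gX.
Qed.

(** The Gaussian cosine transform at frequency [b = sqrt (2 * v)], where [b ^ 2 / 4 = v / 2]. *)
Lemma expectation_cos_gaussian (X : T -> R) (v a : R) : 0 <= v ->
  measurable_fun setT X -> centered_gaussian P X v ->
  P.-integrable setT (EFin \o (fun w => cos (X w + a))) /\
  \int[P]_w cos (X w + a) = expR (- (v / 2)) * cos a.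
Proof.
move=> v0 mX gX; pose g x : R := cos (x + a).
have cg (s : R) : continuous (fun x => g (s * x)) by exact: continuous_cos_affine.
have mg : measurable_fun setT g.
  apply: continuous_measurable_fun; have := cg 1.
  by under eq_fun do rewrite mul1r.
have gi (s : R) : mu.-integrable setT (EFin \o (fun y => g (s * y) * expR (- y ^+ 2))).
  under [X in EFin \o X]eq_fun do rewrite mulrC.
  apply: integrable_gauss_mul; last by move=> x; exact: norm_cos_le1.
  exact: continuous_measurable_fun.
have [h ->] := gaussian_expectation v0 mX gX mg (gi _).
split => //; set s := Num.sqrt (2 * v).
transitivity ((Num.sqrt pi)^-1 * \int[mu]_y (expR (- (y - 0) ^+ 2) * cos (s * y + a))).
  by congr (_ * _); apply: eq_Rintegral => y _; rewrite subr0 mulrC.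
rewrite Rintegral_gauss_cos_shift mulr0 add0r !mulrA mulVf ?mul1r; last first.
  by rewrite gt_eqF// sqrtr_gt0 pi_gt0.
by rewrite /s sqr_sqrtr ?mulr_ge0//; congr (expR _ * _); field.
Qed.

Lemma expectation_sq_gaussian (X : T -> R) (v : R) : 0 <= v ->
  measurable_fun setT X -> centered_gaussian P X v ->
  P.-integrable setT (EFin \o (fun w => X w ^+ 2)) /\ \int[P]_w X w ^+ 2 = v.
Proof.
move=> v0 mX gX; pose g x : R := x ^+ 2.
have mg : measurable_fun setT g by exact: measurable_funX.
set s := Num.sqrt (2 * v).
have gE y : g (s * y) * expR (- y ^+ 2) = 2 * v * (y ^+ 2 * expR (- y ^+ 2)).
  by rewrite /g exprMn sqr_sqrtr ?mulr_ge0//; ring.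
have gi : mu.-integrable setT (EFin \o (fun y => g (s * y) * expR (- y ^+ 2))).
  under [X in EFin \o X]eq_fun do rewrite gE.
  apply: integrable_scale; exact: integrable_sq_gauss.
have [h ->] := gaussian_expectation v0 mX gX mg gi.
split => //; under eq_Rintegral do rewrite gE.
rewrite (RintegralZl _ _ (@integrable_sq_gauss R))// Rintegral_sq_gauss.
field; by rewrite gt_eqF// sqrtr_gt0 pi_gt0.
Qed.

Lemma expectation_gaussian (X : T -> R) (v : R) : 0 <= v ->
  measurable_fun setT X -> centered_gaussian P X v -> \int[P]_w X w = 0.
Proof.
move=> v0 mX gX.
set s := Num.sqrt (2 * v).
have iy : mu.-integrable setT (EFin \o (fun y : R => y * expR (- y ^+ 2))).
  apply: (@integrable_lebesgue_le _ _ (fun x => expR (- x ^+ 2) + x ^+ 2 * expR (- x ^+ 2))).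
  - by apply: measurable_funM => //; exact: measurable_gauss_fun.
  - by move=> x; rewrite normrM (ger0_norm (expR_ge0 _)); exact: norm_gauss_le.
  - exact: (integrable_add (@integrableT_gauss R) (@integrable_sq_gauss R)).
have gi : mu.-integrable setT (EFin \o (fun y => id (s * y) * expR (- y ^+ 2))).
  under [X in EFin \o X]eq_fun do rewrite -mulrA.
  exact: integrable_scale.
have [h ->] := gaussian_expectation v0 mX gX (@measurable_id _ _ setT) gi.
rewrite (Rintegral_odd gi) ?mulr0// => y.
by rewrite sqrrN mulrN mulNr.
Qed.

(** Joint Gaussianity is encoded by all linear combinations, with [S] as covariance matrix. The
    quadratic form is recorded as nonnegative because the expectation lemmas ask for a nonnegative
    variance. *)
Definition gaussian_family (N : nat) (X : 'I_N -> T -> R) (S : 'I_N -> 'I_N -> R) :=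
  (forall i, measurable_fun setT (X i)) /\
  forall al : 'I_N -> R, 0 <= \sum_i \sum_j al i * al j * S i j /\
    centered_gaussian P (fun w => \sum_i al i * X i w)
      (\sum_i \sum_j al i * al j * S i j).

Lemma measurable_trig_poly (N : nat) (X : 'I_N -> T -> R) f : trig_poly f ->
  (forall i, measurable_fun setT (X i)) -> measurable_fun setT (fun w => f (X^~ w)).
Proof.
move=> [s fs] mX; under eq_fun do rewrite fs.
apply: measurable_sum => c; apply: measurable_funM => //.
apply: (measurableT_comp (continuous_measurable_fun (@continuous_cos R))).
apply: measurable_funD => //; apply: measurable_sum => i.
exact: measurable_funM.
Qed.

(** At a fixed [w] the approximation with [dlt = 1 / (n + 1)] has error at most
    [(1 + |X w| ^ 2) / (n + 1)], so the composite is a pointwise limit of trigonometric polynomials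
    in measurable coordinates. *)
Lemma measurable_continuous_row (N : nat) (X : 'I_N -> T -> R) (h : 'rV[R]_N -> R) :
  continuous h -> (exists B, forall v, `|h v| <= B) ->
  (forall i, measurable_fun setT (X i)) ->
  measurable_fun setT (fun w => h (\row_i X i w)).
Proof.
move=> ch [B hB] mX.
have /= d0 (n : nat) : 0 < n.+1%:R^-1 :> R by rewrite invr_gt0.
have ap n := trig_approximation ch hB (d0 n).
pose F n := sval (cid2 (ap n)).
apply: (@measurable_fun_cvg _ _ _ setT (fun n w => F n (X^~ w))).
- by move=> n; apply: measurable_trig_poly => //; rewrite /F; case: cid2.
- move=> w _; set q := 1 + \sum_i X i w ^+ 2.
  have q0 : 0 < q by rewrite ltr_pwDl// sumr_ge0// => i _; exact: sqr_ge0.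
  apply/cvgrPdist_le => e e0.
  near=> n; rewrite /F; case: cid2 => f _ /= hf.
  apply: le_trans (hf _) _; rewrite -/q mulrC ler_pdivrMr// -ler_pdivrMl// mulrC.
  near: n; exists (Num.bound (q / e)) => // m /= hm.
  rewrite (le_trans (ltW (archi_boundP _)))// ?divr_ge0 ?(ltW q0) ?(ltW e0)//.
  by rewrite ler_nat ltnW.
Unshelve. all: by end_near. Qed.

Lemma gaussian_family_sq (N : nat) (X : 'I_N -> T -> R) S : gaussian_family X S ->
  forall i, P.-integrable setT (EFin \o (fun w => X i w ^+ 2)) /\
    \int[P]_w X i w ^+ 2 = S i i.
Proof.
move=> [mX gX] i; have [v0 g] := gX (fun j => (j == i)%:R).
have E1 : (fun w => \sum_j (j == i)%:R * X j w) = X i.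
  apply/funext => w; rewrite (bigD1 i)//= eqxx mul1r big1 ?addr0//.
  by move=> j /negbTE ->; rewrite mul0r.
have E2 : \sum_k \sum_j (k == i)%:R * (j == i)%:R * S k j = S i i.
  rewrite (bigD1 i)//= [X in _ + X]big1 ?addr0; last first.
    by move=> k /negbTE ->; rewrite big1// => j _; rewrite !mul0r.
  rewrite (bigD1 i)//= [X in _ + X]big1 ?addr0; last first.
    by move=> k /negbTE ->; rewrite mulr0 mul0r.
  by rewrite eqxx !mul1r.
by rewrite E1 E2 in v0 g; exact: expectation_sq_gaussian.
Qed.

Lemma gaussian_family_trig (N : nat) (X : 'I_N -> T -> R) S
    (s : seq (R * ('I_N -> R) * R)) : gaussian_family X S ->
  P.-integrable setT (EFin \o
    (fun w => \sum_(c <- s) c.1.1 * cos (\sum_i c.1.2 i * X i w + c.2))) /\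
  \int[P]_w (\sum_(c <- s) c.1.1 * cos (\sum_i c.1.2 i * X i w + c.2)) =
  \sum_(c <- s) c.1.1 * (expR (- ((\sum_i \sum_j c.1.2 i * c.1.2 j * S i j) / 2)) * cos c.2).
Proof.
move=> [mX gX].
have ic (c : R * ('I_N -> R) * R) :
    P.-integrable setT (EFin \o (fun w => cos (\sum_i c.1.2 i * X i w + c.2))) /\
    \int[P]_w cos (\sum_i c.1.2 i * X i w + c.2) =
    expR (- ((\sum_i \sum_j c.1.2 i * c.1.2 j * S i j) / 2)) * cos c.2.
  have [v0 g] := gX c.1.2; apply: expectation_cos_gaussian => //.
  by apply: measurable_sum => i; exact: measurable_funM.
split; first by apply: integrable_sum_real => c; apply: integrable_scale; case: (ic c).
rewrite Rintegral_sum; last by move=> c; apply: integrable_scale; case: (ic c).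
apply: eq_bigr => c _; rewrite RintegralZl//; last by case: (ic c).
by case: (ic c) => _ ->.
Qed.

(** The weight [1 + |x| ^ 2] has mean 1 plus the trace of [S]. *)
Lemma gaussian_family_approx (N : nat) (X : 'I_N -> T -> R) S h f (B dlt : R) :
  gaussian_family X S -> continuous h -> (forall v : 'rV[R]_N, `|h v| <= B) ->
  0 < dlt -> trig_poly f ->
  (forall x, `|h (\row_i x i) - f x| <= dlt * (1 + \sum_i x i ^+ 2)) ->
  `|\int[P]_w h (\row_i X i w) - \int[P]_w f (X^~ w)| <= dlt * (1 + \sum_i S i i).
Proof.
move=> gX ch hB d0 tf hf; have mX := gX.1.
have mh : measurable_fun setT (fun w => h (\row_i X i w)).
  by apply: measurable_continuous_row => //; exists B.
have mf := measurable_trig_poly tf mX.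
have sqi := gaussian_family_sq gX.
have ih : P.-integrable setT (EFin \o (fun w => h (\row_i X i w))).
  apply: (@integrable_le _ _ _ _ _ (cst B)) => //.
  exact: finite_measure_integrable_cst.
have if_ : P.-integrable setT (EFin \o (fun w => f (X^~ w))).
  case: tf {mf hf} => s fs; have [i _] := gaussian_family_trig s gX.
  by under [X in EFin \o X]eq_fun do rewrite fs.
have i1 : P.-integrable setT (EFin \o cst 1) by exact: finite_measure_integrable_cst.
have is_ : P.-integrable setT (EFin \o (fun w => \sum_i X i w ^+ 2)).
  by apply: integrable_sum_real => i; case: (sqi i).
rewrite -RintegralB//.
apply: le_trans (Rintegral_norm_le (g := fun w => dlt * (1 + \sum_i X i w ^+ 2)) _ _ _) _.
- exact: measurable_funB.
- by move=> w; have := hf (X^~ w).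
- by apply: integrable_scale; exact: (integrable_add i1 is_).
rewrite RintegralZl//; last exact: (integrable_add i1 is_).
rewrite ler_pM2l// (RintegralD _ i1 is_)// Rintegral_sum; last by move=> i; case: (sqi i).
rewrite Rintegral_cst// [X in _ * X](_ : _ = 1); last exact: (congr1 fine (probability_setT P)).
rewrite mulr1 lerD2l; apply: ler_sum => i _; by case: (sqi i) => _ ->.
Qed.

(* Cramer-Wold: convergence of the covariances gives that of the expectations of
   trigonometric polynomials, and these approximate [h] up to
   [dlt * (1 + |x|^2)], whose expectation stays bounded. *)
Lemma gaussian_family_cvg (U : Type) (F : set_system U) {FF : Filter F} (N : nat)
    (X : U -> 'I_N -> T -> R) (S : U -> 'I_N -> 'I_N -> R)
    (Y : 'I_N -> T -> R) (S0 : 'I_N -> 'I_N -> R) (h : 'rV[R]_N -> R) :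
  (\forall u \near F, gaussian_family (X u) (S u)) -> gaussian_family Y S0 ->
  (forall i j, S u i j @[u --> F] --> S0 i j) ->
  continuous h -> (exists B, forall v, `|h v| <= B) ->
  (\int[P]_w (h (\row_i X u i w))%:E)%E @[u --> F] -->
  (\int[P]_w (h (\row_i Y i w))%:E)%E.
Proof.
move=> gX gY cS ch [B hB].
have ih (Z : 'I_N -> T -> R) : (forall i, measurable_fun setT (Z i)) ->
    P.-integrable setT (EFin \o (fun w => h (\row_i Z i w))).
  move=> mZ; apply: (@integrable_le _ _ _ _ _ (cst B)) => //.
    by apply: measurable_continuous_row => //; exists B.
  exact: finite_measure_integrable_cst.
rewrite (integral_Rintegral (ih _ gY.1)).
apply: (@cvg_trans _ ((\int[P]_w h (\row_i X u i w))%:E @[u --> F])).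
  apply: near_eq_cvg; near=> u; rewrite integral_Rintegral//; apply: ih.
  have : gaussian_family (X u) (S u) by near: u.
  by case.
apply: cvg_EFin; first by near=> u.
apply/cvgrPdist_le => e e0.
have SY0 : 0 <= \sum_i S0 i i.
  apply: sumr_ge0 => i _; have [_ <-] := gaussian_family_sq gY i.
  by apply: Rintegral_ge0 => w _; exact: sqr_ge0.
(* One unit is the constant of the weight; the other is slack for the traces of [S u], eventually
   within 1 of the limiting trace. One [dlt] thus serves the limit and all nearby [u]. *)
set q := 2 + \sum_i S0 i i; have q0 : 0 < q by rewrite ltr_pwDl.
have d0 : 0 < e / (3 * q) by rewrite divr_gt0// mulr_gt0.
have [f tf hf] := trig_approximation ch hB d0.
have aY := gaussian_family_approx gY ch hB d0 tf hf.
have [s fs] := tf.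
have IE (Z : 'I_N -> T -> R) : \int[P]_w f (Z^~ w) =
    \int[P]_w (\sum_(c <- s) c.1.1 * cos (\sum_i c.1.2 i * Z i w + c.2)).
  by apply: eq_Rintegral => w _; rewrite fs.
have cT : (\sum_(c <- s) c.1.1 * (expR (- ((\sum_i \sum_j c.1.2 i * c.1.2 j * S u i j) / 2))
     * cos c.2)) @[u --> F] -->
   (\sum_(c <- s) c.1.1 * (expR (- ((\sum_i \sum_j c.1.2 i * c.1.2 j * S0 i j) / 2))
     * cos c.2)).
  apply: cvg_big => //=; first exact: add_continuous.
  move=> c _; apply: cvgM; first exact: cvg_cst.
  apply: cvgM; last exact: cvg_cst.
  apply: (cvg_comp _ expR); last exact: continuous_expR.
  apply: cvgN; apply: cvgM; last exact: cvg_cst.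
  apply: cvg_big => //=; first exact: add_continuous.
  move=> i _; apply: cvg_big => //=; first exact: add_continuous.
  by move=> j _; apply: cvgM; [exact: cvg_cst|exact: cS].
have cV : (\sum_i S u i i) @[u --> F] --> \sum_i S0 i i.
  by apply: cvg_big => //=; exact: add_continuous.
move/cvgrPdist_le : cT => /(_ (e / 3)); rewrite divr_gt0// => /(_ isT) cT.
move/cvgrPdist_le : cV => /(_ 1 ltr01) cV.
near=> u.
have gu : gaussian_family (X u) (S u) by near: u.
have aX := gaussian_family_approx gu ch hB d0 tf hf.
have cTu : `|\int[P]_w f (Y^~ w) - \int[P]_w f ((X u)^~ w)| <= e / 3.
  rewrite !IE (gaussian_family_trig s gY).2 (gaussian_family_trig s gu).2.
  by near: u.
have cVu : `|\sum_i S0 i i - \sum_i S u i i| <= 1 by near: u.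
have b1 : e / (3 * q) * (1 + \sum_i S0 i i) <= e / 3.
  rewrite invfM mulrA -mulrA ler_piMr ?divr_ge0 ?(ltW e0)// mulrC ler_pdivrMr// mul1r.
  by rewrite /q; lra.
have b2 : e / (3 * q) * (1 + \sum_i S u i i) <= e / 3.
  rewrite invfM mulrA -mulrA ler_piMr ?divr_ge0 ?(ltW e0)// mulrC ler_pdivrMr// mul1r.
  by move: cVu; rewrite /q ler_norml => /andP[? ?]; lra.
move: (le_trans aY b1) (le_trans aX b2) cTu; rewrite /= !ler_norml.
move=> /andP[? ?] /andP[? ?] /andP[? ?]; apply/andP; split; lra.
Unshelve. all: by end_near. Qed.

End gaussian_family.

(** * Bounds, integrability and continuity of the Bessel terms *)

Section bessel.
Context (R : realType).
Notation mu := (@lebesgue_measure R).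
Notation D := (`]0%R, +oo[%classic : set R).

Lemma integrable_expRN_itv (q : R) : 0 < q ->
  mu.-integrable D (EFin \o (fun s => expR (- (q * s)))).
Proof.
move=> q0.
have ms A : measurable_fun A (fun s : R => expR (- (q * s))).
  apply: measurable_funTS; apply: continuous_measurable_fun => x.
  apply: continuous_comp; last exact: continuous_expR.
  by apply: cvgN; apply: cvgM; [exact: cvg_cst|exact: cvg_id].
have E : (\int[mu]_(s in `[0%R, +oo[) (expR (- (q * s)))%:E)%E = 
    (0%:E - (- (q^-1 * expR (- (q * 0))))%:E)%E.
  apply: (@ge0_continuous_FTC2y R _ (fun s => - (q^-1 * expR (- (q * s))))).
  - by move=> x _; exact: expR_ge0.
  - apply: continuous_subspaceT => x.
    apply: continuous_comp; last exact: continuous_expR.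
    by apply: cvgN; apply: cvgM; [exact: cvg_cst|exact: cvg_id].
  - rewrite -oppr0; apply: cvgN; rewrite -(mulr0 q^-1); apply: cvgM; first exact: cvg_cst.
    apply/cvgrPdist_le => e e0; near=> x; rewrite sub0r normrN ger0_norm ?expR_ge0//.
    have x0 : 0 < x by near: x; exact: nbhs_pinfty_gt.
    rewrite expRN -[leRHS]invrK lef_pV2 ?posrE ?expR_gt0 ?invr_gt0//.
    apply: le_trans (expR_ge1Dx _); apply: (@le_trans _ _ (q * x)); last by rewrite lerDr.
    rewrite -ler_pdivrMl//; near: x; exact: nbhs_pinfty_ge.
  - by move=> x _; exact: ex_derive.
  - apply: cvg_at_right_filter; apply: cvgN; apply: cvgM; first exact: cvg_cst.
    apply: (cvg_comp _ expR); last exact: continuous_expR.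
    by apply: cvgN; apply: cvgM; [exact: cvg_cst|exact: cvg_id].
  - move=> x _; rewrite derive1E derive_val /GRing.scale/=; field; exact: lt0r_neq0.
apply: (@integrableS _ _ _ mu `[0, +oo[%classic) => //.
  by apply: subset_itvr; rewrite bnd_simp.
apply/integrableP; split; first by apply/measurable_EFinP; exact: ms.
under eq_integral do rewrite /= ger0_norm ?expR_ge0//.
by rewrite E -EFinB ltry.
Unshelve. all: by end_near. Qed.

(** On [[1 / (n + 2), 1]] the primitive [x ^ (1 - q) / (1 - q)] bounds the integral by [1 / (1 - q)]
    for all [n], and these intervals exhaust []0, 1]]. *)
Lemma integrable_powR_itv (q : R) : 0 < q < 1 ->
  mu.-integrable `]0%R, 1%R]%classic (EFin \o (fun x => x `^ (- q))).
Proof.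
move=> /andP[q0 q1].
have mp A : measurable_fun A (fun x : R => x `^ (- q)).
  by apply: measurable_funTS; exact: measurable_powR.
have dx (x : R) : 0 < x -> is_derive x (1 : R) (fun x => (1 - q)^-1 * x `^ (1 - q)) (x `^ (- q)).
  move=> x0; have := is_derive1_powR (1 - q) x0 => h.
  apply: is_derive_eq; rewrite /GRing.scale/= mulrA mulVf ?mul1r; last lra.
  by congr powR; ring.
have E n : (\int[mu]_(x in `[(n.+2%:R^-1)%R, 1%R]) (x `^ (- q))%:E <= ((1 - q)^-1)%:E)%E.
  have n0 : 0 < n.+2%:R^-1 :> R by rewrite invr_gt0.
  have n1 : n.+2%:R^-1 < 1 :> R by rewrite invf_lt1// ltr1n.
  have cd (x : R) : 0 < x -> {for x, continuous (fun x => (1 - q)^-1 * x `^ (1 - q))}.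
    move=> x0; apply/differentiable_continuous/derivable1_diffP.
    by have := dx x x0 => ?; exact: ex_derive.
  rewrite (@continuous_FTC2 R _ (fun x => (1 - q)^-1 * x `^ (1 - q)) _ _ n1).
  - rewrite powR1 mulr1 -EFinB lee_fin gerBl mulr_ge0 ?powR_ge0// invr_ge0; lra.
  - apply: continuous_in_subspaceT => x; rewrite inE/= in_itv/= => /andP[nx _].
    have x0 := lt_le_trans n0 nx.
    apply/differentiable_continuous/derivable1_diffP.
    by have := is_derive1_powR (- q) x0 => ?; exact: ex_derive.
  - split.
    + move=> x; rewrite in_itv/= => /andP[nx _].
      by have := dx x (lt_trans n0 nx) => ?; exact: ex_derive.
    + exact/cvg_at_right_filter/cd.
    + exact/cvg_at_left_filter/cd.
  - move=> x; rewrite in_itv/= => /andP[nx _].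
    by have := dx x (lt_trans n0 nx) => ?; rewrite derive1E derive_val.
apply/integrableP; split; first by apply/measurable_EFinP; exact: mp.
under eq_integral do rewrite /= ger0_norm ?powR_ge0//.
pose J (n : nat) : set R := `[n.+2%:R^-1, 1%R]%classic.
have U : `]0%R, 1%R]%classic = \bigcup_n J n.
  apply/seteqP; split => x /=.
    rewrite in_itv/= => /andP[x0 x1]; exists (Num.bound x^-1) => //=.
    rewrite /J /= in_itv/= x1 andbT -[leRHS]invrK lef_pV2 ?posrE ?invr_gt0//.
    rewrite (le_trans (ltW (archi_boundP _)))// ?invr_ge0 ?ltW// ltr_nat.
    by rewrite leqW.
  by move=> [n _] /=; rewrite /J /= !in_itv/= => /andP[nx ->]; rewrite (lt_le_trans _ nx)// invr_gt0.
have nd : nondecreasing_seq J.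
  move=> m n mn; apply/subsetPset => x /=; rewrite /J /= !in_itv/= => /andP[nx ->].
  by rewrite (le_trans _ nx)// lef_pV2 ?posrE// ler_nat.
have h := @ge0_nondecreasing_set_cvg_integral _ (measurableTypeR R) R J
  (fun x : R => (x `^ (- q))%:E) mu nd.
have {}h : (\int[mu]_(x in `[(n.+2%:R^-1)%R, 1%R]) (x `^ (- q))%:E)%E @[n --> \oo] -->
    (\int[mu]_(x in `]0%R, 1%R]) (x `^ (- q))%:E)%E.
  rewrite U; apply: h.
  - by move=> n; exact: measurable_itv.
  - by move=> n; apply/measurable_EFinP; exact: mp.
  - by move=> n x _; rewrite lee_fin powR_ge0.
apply: (@le_lt_trans _ _ ((1 - q)^-1)%:E); last exact: ltry.
rewrite -(cvg_lim (@ereal_hausdorff R) h); apply: lime_le.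
  by apply/cvg_ex; eexists; exact: h.
by near=> n; exact: E.
Unshelve. all: by end_near. Qed.

(* the majorant of [K_p(|x|) / |x|^p] *)
Lemma integrable_powR_expR (q : R) : 0 < q < 1 ->
  mu.-integrable setT (EFin \o (fun x => `|x| `^ (- q) * expR (- (2^-1 * `|x|)))).
Proof.
move=> q01.
have nm : measurable_fun setT (fun x : R => `|x|) by exact: measurableT_comp.
have mf : measurable_fun setT (fun x : R => `|x| `^ (- q) * expR (- (2^-1 * `|x|))).
  apply: measurable_funM; first exact: (measurableT_comp (measurable_powR _)).
  by apply: measurableT_comp => //; apply: measurableT_comp => //; exact: measurable_funM.
pose u (x : R) : R := ((fun x => x `^ (- q)) \_ `]0%R, 1%R]) x.
pose v (x : R) : R := ((fun x => expR (- (2^-1 * x))) \_ D) x.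
have iu : mu.-integrable setT (EFin \o u).
  have := integrable_powR_itv q01; rewrite integrable_mkcond// /u.
  by rewrite restrict_EFin.
have iv : mu.-integrable setT (EFin \o v).
  have := @integrable_expRN_itv 2^-1; rewrite invr_gt0 ltr0n => /(_ isT).
  by rewrite integrable_mkcond// /v restrict_EFin.
have iz : mu.-integrable setT (EFin \o (fun x : R => \1_`[0%R, 0%R] x)).
  exact: (@integrable_indic_itv R 0 0).
have u0 x : 0 <= u x by rewrite /u patchE; case: ifP => // _; exact: powR_ge0.
have v0 x : 0 <= v x by rewrite /v patchE; case: ifP => // _; exact: expR_ge0.
have key (x : R) : 0 < x -> x `^ (- q) * expR (- (2^-1 * x)) <= u x + v x.
  move=> x0; have [x1|x1] := leP x 1.
    have -> : u x = x `^ (- q) by rewrite /u patchE ifT// inE/= in_itv/= x0.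
    rewrite -[leLHS]addr0 lerD// ler_piMr ?powR_ge0// -expR0 ler_expR.
    by rewrite oppr_le0 mulr_ge0 ?invr_ge0// ltW.
  have -> : v x = expR (- (2^-1 * x)) by rewrite /v patchE ifT// inE/= in_itv/= x0.
  rewrite -[leLHS]add0r lerD// ler_piMl ?expR_ge0//.
  have /andP[q0 _] := q01.
  by rewrite -(powRr0 x) ler_powR ?(ltW x1)// oppr_le0 ltW.
have iun := integrable_opp iu; have ivn := integrable_opp iv.
apply: (@integrable_lebesgue_le R _
  (fun x => ((u x + v x) + (u (- x) + v (- x))) + \1_`[0%R, 0%R] x)) => //.
  move=> x; rewrite ger0_norm ?mulr_ge0 ?powR_ge0 ?expR_ge0//.
  have [x0|x0|->] := ltgtP x 0.
  - have nx : 0 < - x by rewrite oppr_gt0.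
    rewrite ltr0_norm//; apply: le_trans (key _ nx) _.
    rewrite [X in _ <= X + _]addrC -addrA lerDl addr_ge0// ?addr_ge0//.
  - rewrite gtr0_norm//; apply: le_trans (key _ x0) _.
    rewrite -[X in _ <= X]addrA lerDl addr_ge0// ?addr_ge0//.
  - rewrite normr0 mulr0 oppr0 expR0 mulr1 powR0; last first.
      by have /andP[q0 _] := q01; rewrite oppr_eq0 gt_eqF.
    by rewrite !addr_ge0.
apply: integrable_add => //.
by apply: integrable_add; exact: integrable_add.
Qed.

Lemma cosh_ge1 (s : R) : 1 <= cosh s.
Proof.
rewrite /cosh ler_pdivlMr// mul1r -(@ler_pM2r _ (expR s)) ?expR_gt0//.
have -> : (expR s + expR (- s)) * expR s = expR s ^+ 2 + 1.
  by rewrite expRN; field; rewrite gt_eqF ?expR_gt0.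
have := sqr_ge0 (expR s - 1); nra.
Qed.

Lemma cosh_ge_expR (s : R) : expR s / 2 <= cosh s.
Proof. by rewrite /cosh ler_pM2r// lerDl expR_ge0. Qed.

Lemma cosh_le (p nu s : R) : `|nu| <= p -> 0 <= s -> cosh (nu * s) <= expR (p * s).
Proof.
rewrite ler_norml => /andP[pl pr] s0; rewrite /cosh ler_pdivrMr//.
rewrite mulr_natr mulr2n lerD// ler_expR; first by rewrite ler_wpM2r.
by rewrite -mulNr ler_wpM2r// lerNl.
Qed.

Lemma cosh_gt0 (s : R) : 0 < cosh s.
Proof. exact: lt_le_trans ltr01 (cosh_ge1 s). Qed.

Lemma continuous_cosh : continuous (@cosh R).
Proof.
move=> x; apply: cvgM; last exact: cvg_cst; apply: cvgD; first exact: continuous_expR.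
apply: (@continuous_comp _ _ _ -%R expR); last exact: continuous_expR.
exact: opp_continuous.
Qed.

(** Averaging [cosh s >= 1] and [cosh s >= exp s / 2] gives [cosh s >= 1/2 + exp s / 4]. The first
    summand yields the decay in [z]; for the second, [exp (- y ^ 2 / 4) <= 2 / y] at
    [y = sqrt z * exp (s / 2)] produces [exp (- s / 2)], which beats [cosh (nu * s) <= exp (p * s)]
    when [p < 1/2]. *)
Lemma bessel_integrand_le (p nu z s : R) : `|nu| <= p -> 0 < z -> 0 <= s ->
  expR (- (z * cosh s)) * cosh (nu * s) <=
  2 * z `^ (- 2^-1) * expR (- (2^-1 * z)) * expR (- ((2^-1 - p) * s)).
Proof.
move=> nup z0 s0.
have h1 : expR (- (z * cosh s)) <= expR (- (2^-1 * z)) * expR (- (z * expR s / 4)).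
  rewrite -expRD ler_expR; have := cosh_ge1 s; have := cosh_ge_expR s => a b.
  have : z * (2^-1 + expR s / 4) <= z * cosh s by rewrite ler_pM2l//; lra.
  lra.
have h2 : expR (- (z * expR s / 4)) <= 2 * z `^ (- 2^-1) * expR (- (2^-1 * s)).
  rewrite powRN powR12_sqrt ?(ltW z0)//.
  set t := Num.sqrt z; have t0 : 0 < t by rewrite sqrtr_gt0.
  have zE : z = t ^+ 2 by rewrite sqr_sqrtr ?ltW.
  set r := expR (2^-1 * s); have r0 : 0 < r by exact: expR_gt0.
  have rE : expR s = r ^+ 2.
    by rewrite -expRM_natl -mulr_natl mulrA divff ?mul1r.
  rewrite !expRN -/r zE rE.
  have -> : 2 / t / r = (t * r / 2)^-1 by field; rewrite !gt_eqF.
  rewrite lef_pV2 ?posrE ?expR_gt0 ?divr_gt0 ?mulr_gt0//.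
  apply: le_trans (expR_ge1Dx _).
  have : 0 <= (t * r / 2 - 1) ^+ 2 by exact: sqr_ge0.
  have : 0 <= t * r by rewrite mulr_ge0 ?ltW.
  nra.
have h3 := cosh_le nup s0.
apply: (@le_trans _ _ (expR (- (2^-1 * z)) * (2 * z `^ (- 2^-1) * expR (- (2^-1 * s))) *
   expR (p * s))).
  apply: ler_pM => //; first exact: ltW (cosh_gt0 _).
  by apply: (le_trans h1); rewrite ler_pM2l ?expR_gt0.
rewrite le_eqVlt; apply/orP; left; apply/eqP.
have -> : expR (- ((2^-1 - p) * s)) = expR (- (2^-1 * s)) * expR (p * s).
  by rewrite -expRD; congr expR; ring.
ring.
Qed.

Lemma measurable_bessel_integrand (nu z : R) A :
  measurable_fun A (fun s : R => expR (- (z * cosh s)) * cosh (nu * s)).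
Proof.
apply: measurable_funTS; apply: continuous_measurable_fun => x; apply: cvgM.
  apply: continuous_comp; last exact: continuous_expR.
  by apply: cvgN; apply: cvgM; [exact: cvg_cst|exact: continuous_cosh].
apply: (@continuous_comp _ _ _ (fun s => nu * s) cosh); last exact: continuous_cosh.
by apply: cvgM; [exact: cvg_cst|exact: cvg_id].
Qed.

Lemma bessel_integrand_ge0 (nu z s : R) : 0 <= expR (- (z * cosh s)) * cosh (nu * s).
Proof. by rewrite mulr_ge0 ?expR_ge0// ltW// cosh_gt0. Qed.

Lemma integrable_bessel (nu z : R) : `|nu| < 2^-1 -> 0 < z ->
  mu.-integrable D (EFin \o (fun s => expR (- (z * cosh s)) * cosh (nu * s))).
Proof.
move=> nu2 z0.
apply: (@le_integrable _ _ _ mu D _ _ (EFin \o (fun s =>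
  (2 * z `^ (- 2^-1) * expR (- (2^-1 * z))) * expR (- ((2^-1 - `|nu|) * s))))) => //.
- by apply/measurable_EFinP; exact: measurable_bessel_integrand.
- move=> s; rewrite /= in_itv/= andbT => s0.
  rewrite lee_fin ger0_norm ?bessel_integrand_ge0//.
  rewrite (le_trans _ (ler_norm _))//.
  by apply: bessel_integrand_le => //; exact: ltW.
- apply: (@integrableZl _ _ _ mu D _ _ (EFin \o _)) => //.
  by apply: integrable_expRN_itv; rewrite subr_gt0.
Qed.

Lemma BesselK_ge0 (nu z : R) : 0 <= BesselK nu z.
Proof. by apply: fine_ge0; apply: integral_ge0 => s _; rewrite lee_fin bessel_integrand_ge0. Qed.

(** The power [-1/2] is cruder than the true singularity at 0, but it suffices: multiplied by
    [z ^ (- (1 - kappa) / 2)] it has order [1 - kappa / 2 < 1], still integrable. *)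
Lemma BesselK_le (nu : R) : `|nu| < 2^-1 -> exists2 C : R, 0 <= C &
  forall z, 0 < z -> BesselK nu z <= C * (z `^ (- 2^-1) * expR (- (2^-1 * z))).
Proof.
move=> nu2; pose J := \int[mu]_(s in D) expR (- ((2^-1 - `|nu|) * s)).
have iJ : mu.-integrable D (EFin \o (fun s => expR (- ((2^-1 - `|nu|) * s)))).
  by apply: integrable_expRN_itv; rewrite subr_gt0.
exists (2 * J).
  by rewrite mulr_ge0//; apply: Rintegral_ge0 => s _; exact: expR_ge0.
move=> z z0.
have -> : 2 * J * (z `^ (- 2^-1) * expR (- (2^-1 * z))) =
    \int[mu]_(s in D) (2 * z `^ (- 2^-1) * expR (- (2^-1 * z)) *
      expR (- ((2^-1 - `|nu|) * s))).
  by rewrite RintegralZl// -/J; ring.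
apply: le_Rintegral => //.
- exact: integrable_bessel.
- exact: (@integrableZl _ _ _ mu D _ _ (EFin \o _)).
- move=> s; rewrite /= in_itv/= andbT => s0.
  by apply: bessel_integrand_le => //; exact: ltW.
Qed.

Lemma measurable_BesselK (nu : R) : measurable_fun setT (BesselK nu).
Proof.
pose g (p : R * R) : R := \1_D p.1 * (expR (- (p.2 * cosh p.1)) * cosh (nu * p.1)).
have mc : measurable_fun setT (@cosh R).
  by apply: continuous_measurable_fun; exact: continuous_cosh.
have mg : measurable_fun setT g.
  apply: measurable_funM; first by apply: measurableT_comp => //; exact: measurable_indic.
  apply: measurable_funM.
    apply: measurableT_comp => //; apply: measurableT_comp => //.
    by apply: measurable_funM => //; exact: (measurableT_comp mc).
  by apply: (measurableT_comp mc); exact: measurable_funM.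
rewrite (_ : BesselK nu = fun z => \int[mu]_s g (s, z)).
  exact: (@measurable_Rintegral_section _ _ (measurableTypeR R) R R mu g mg).
apply/funext => z; rewrite /BesselK /Rint_on -/(Rintegral mu D _) Rintegral_mkcond.
apply: eq_Rintegral => s _; rewrite /g /= patchE indicE.
by case: ifP => _; rewrite ?mul1r ?mul0r.
Qed.

(** The integrand decreases in its argument, so on []z / 2, 2 * z[] it is dominated by its value at
    [z / 2]. *)
Lemma continuous_BesselK (nu z : R) : `|nu| < 2^-1 -> 0 < z ->
  {for z, continuous (BesselK nu)}.
Proof.
move=> nu2 z0.
have := @continuity_under_integral R _ _ mu
  (fun z s => expR (- (z * cosh s)) * cosh (nu * s)) D _ (z / 2) (z * 2) _ _
  (fun s => expR (- (z / 2 * cosh s)) * cosh (nu * s)) _ _ z.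
apply => //.
- move=> x /=; rewrite in_itv/= => /andP[zx _]; apply: integrable_bessel => //.
  by apply: lt_trans zx; rewrite divr_gt0.
- apply: aeW => s _ x _; apply: cvgM; last exact: cvg_cst.
  apply: continuous_comp; last exact: continuous_expR.
  by apply: cvgN; apply: cvgM; [exact: cvg_id|exact: cvg_cst].
- by apply: integrable_bessel => //; rewrite divr_gt0.
- move=> x /=; rewrite in_itv/= => /andP[zx _]; apply: aeW => s _.
  rewrite ger0_norm ?bessel_integrand_ge0// ler_pM2r ?cosh_gt0// ler_expR lerN2.
  by rewrite ler_pM2r ?cosh_gt0// ltW.
- by rewrite inE/= in_itv/=; apply/andP; split; lra.
Qed.

(** Up to a constant, the Fourier transform of [(1 + x ^ 2) ^ (- kappa / 2)]. For [kappa < 1] its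
    singular point [x = 0] receives the value 0 through division by zero. *)
Definition bessel_term (kappa x : R) : R :=
  BesselK ((kappa - 1) / 2) `|x| / `|x| `^ ((1 - kappa) / 2).

Lemma bessel_term_ge0 (kappa x : R) : 0 <= bessel_term kappa x.
Proof. by rewrite mulr_ge0 ?BesselK_ge0// invr_ge0 powR_ge0. Qed.

Lemma measurable_bessel_term (kappa : R) : measurable_fun setT (bessel_term kappa).
Proof.
have nm : measurable_fun setT (fun x : R => `|x|) by exact: measurableT_comp.
apply: measurable_funM; first exact: (measurableT_comp (measurable_BesselK _)).
rewrite (_ : (fun x => _) = (fun x : R => `|x| `^ (- ((1 - kappa) / 2)))).
  exact: (measurableT_comp (measurable_powR _)).
by apply/funext => x; rewrite powRN.
Qed.

Lemma norm_bessel_order_lt (kappa : R) : 0 < kappa < 1 -> `|(kappa - 1) / 2| < 2^-1.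
Proof. by move=> /andP[? ?]; rewrite ltr_norml; apply/andP; split; lra. Qed.

Lemma integrable_bessel_term (kappa : R) : 0 < kappa < 1 ->
  mu.-integrable setT (EFin \o bessel_term kappa).
Proof.
move=> k01; have [C C0 hC] := BesselK_le (norm_bessel_order_lt k01).
have /andP[k0 k1] := k01.
pose q := 2^-1 + (1 - kappa) / 2.
have q01 : 0 < q < 1 by rewrite /q; apply/andP; split; lra.
apply: (@integrable_lebesgue_le R _
  (fun x => C * (`|x| `^ (- q) * expR (- (2^-1 * `|x|))))).
- exact: measurable_bessel_term.
- move=> x; rewrite ger0_norm ?bessel_term_ge0//.
  have [->|x0] := eqVneq x 0.
    rewrite /bessel_term normr0 powR0 ?invr0 ?mulr0; last by rewrite gt_eqF//; lra.
    by rewrite !mulr_ge0 ?powR_ge0 ?expR_ge0.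
  have nx0 : 0 < `|x| by rewrite normr_gt0.
  rewrite /bessel_term -powRN.
  apply: (@le_trans _ _ (C * (`|x| `^ (- 2^-1) * expR (- (2^-1 * `|x|))) *
      `|x| `^ (- ((1 - kappa) / 2)))).
    by rewrite ler_pM2r ?powR_gt0// hC.
  have -> : `|x| `^ (- q) = `|x| `^ (- 2^-1) * `|x| `^ (- ((1 - kappa) / 2)).
    rewrite -powRD; last by apply/implyP => _; rewrite gt_eqF.
    by congr powR; rewrite /q; ring.
  by rewrite le_eqVlt; apply/orP; left; apply/eqP; ring.
- by apply: integrable_scale; exact: integrable_powR_expR.
Qed.

Lemma continuous_bessel_term (kappa x : R) : 0 < kappa < 1 -> x != 0 ->
  {for x, continuous (bessel_term kappa)}.
Proof.
move=> k01 x0; have nx0 : 0 < `|x| by rewrite normr_gt0.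
rewrite (_ : bessel_term kappa = (fun x => BesselK ((kappa - 1) / 2) `|x| *
   `|x| `^ (- ((1 - kappa) / 2)))); last by apply/funext => y; rewrite powRN.
have nc : `|y| @[y --> x] --> `|x| by exact: norm_continuous.
apply: cvgM.
  by apply: (cvg_comp _ _ nc); exact: (continuous_BesselK (norm_bessel_order_lt k01)).
have pc : {for `|x|, continuous (fun y : R => y `^ (- ((1 - kappa) / 2)))}.
  apply/differentiable_continuous/derivable1_diffP.
  by apply: derivable_powR; rewrite in_itv/= nx0.
exact: (cvg_comp _ (fun y => y `^ (- ((1 - kappa) / 2))) nc pc).
Qed.

End bessel.

(** * The spectral density and its behaviour at the origin *)

Section spectral_density.
Context (R : realType) (n : nat) (A w kappa : nat -> R).
Notation mu := (@lebesgue_measure R).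
Notation f := (specB n A w kappa).
Hypothesis A_ge0 : forall j, (j <= n)%N -> 0 <= A j.
Hypothesis w_neq0 : forall j, (1 <= j <= n)%N -> w j != 0.
Hypothesis kappa01 : forall j, (j <= n)%N -> 0 < kappa j < 1.
Hypothesis A0 : A 0%N = 0.

Lemma c1_ge0 (k : R) : 0 <= c1 k.
Proof.
rewrite /c1 divr_ge0 ?powR_ge0// mulr_ge0 ?sqrtr_ge0//.
by apply: fine_ge0; apply: integral_ge0 => x _; rewrite lee_fin mulr_ge0 ?powR_ge0 ?expR_ge0.
Qed.

Lemma specBE (l : R) : f l = \sum_(j < n.+1) c1 (kappa j) / 2 * A j *
  (bessel_term (kappa j) (l + w j) + bessel_term (kappa j) (l - w j)).
Proof. by []. Qed.

Lemma specB_ge0 (l : R) : 0 <= f l.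
Proof.
rewrite specBE; apply: sumr_ge0 => j _; have jn : (j <= n)%N by rewrite -ltnS.
apply: mulr_ge0; last by rewrite addr_ge0 ?bessel_term_ge0.
by apply: mulr_ge0; [rewrite divr_ge0 ?c1_ge0|exact: A_ge0].
Qed.

Lemma specB_even (l : R) : f (- l) = f l.
Proof.
rewrite !specBE; apply: eq_bigr => j _; congr (_ * _).
rewrite addrC /bessel_term; congr (_ + _).
  by rewrite -opprD normrN.
by rewrite -[- l + w j]opprK normrN opprD opprK.
Qed.

Lemma integrable_specB : mu.-integrable setT (EFin \o f).
Proof.
apply: (@integrable_sum_real _ (measurableTypeR R) R mu 'I_n.+1 (index_enum 'I_n.+1)
  (fun j l => c1 (kappa j) / 2 * A j *
  (bessel_term (kappa j) (l + w j) + bessel_term (kappa j) (l - w j)))) => j.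
have jn : (j <= n)%N by rewrite -ltnS.
have ib := integrable_bessel_term (kappa01 jn).
apply: integrable_scale; apply: integrable_add.
- have := integrable_affine (w j) ltr01 ib.
  by under [X in EFin \o X]eq_fun do rewrite mul1r.
- have := integrable_affine (- w j) ltr01 ib.
  by under [X in EFin \o X]eq_fun do rewrite mul1r.
Qed.

(** At the origin the translates by [w j] and [- w j] coincide by evenness, which cancels the factor
    1/2 of each coefficient. *)
Lemma specB0 : f 0 = constC n A w kappa.
Proof.
rewrite specBE /constC big_ord_recl A0 mulr0 mul0r add0r.
rewrite big_add1 /= big_mkord; apply: eq_bigr => j _.
rewrite /bump /= add1n /bessel_term !add0r normrN.
have -> : (kappa j.+1 - 1) / 2 = - ((1 - kappa j.+1) / 2) by field.
have wj : w j.+1 != 0 by apply: w_neq0; rewrite /= ltn_ord.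
by rewrite powRN; field; rewrite gt_eqF// powR_gt0// normr_gt0.
Qed.

(** The term [j = 0] vanishes identically because [A 0 = 0]; the others evaluate [bessel_term] near
    [w j] and [- w j], away from its only singularity. *)
Lemma continuous_specB0 : {for 0, continuous f}.
Proof.
pose F (l : R) (j : nat) := c1 (kappa j) / 2 * A j *
  (bessel_term (kappa j) (l + w j) + bessel_term (kappa j) (l - w j)).
suff h : \sum_(j < n.+1) F l j @[l --> (0 : R)] --> \sum_(j < n.+1) F 0 j by exact: h.
apply: cvg_big => //=; first exact: add_continuous.
move=> [[|j] jn] _ /=.
  rewrite (_ : F ^~ 0%N = fun=> 0); last by apply/funext => l; rewrite /F A0 mulr0 mul0r.
  by rewrite /F A0 mulr0 mul0r; exact: cvg_cst.
rewrite /F.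
have wj : w j.+1 != 0 by apply: w_neq0.
have kj := kappa01 (jn : (j.+1 <= n)%N).
apply: cvgM; first exact: cvg_cst.
apply: cvgD.
- have c : l + w j.+1 @[l --> (0 : R)] --> 0 + w j.+1.
    by apply: cvgD; [exact: cvg_id|exact: cvg_cst].
  apply: (cvg_comp _ _ c); apply: continuous_bessel_term => //.
  by rewrite add0r.
- have c : l - w j.+1 @[l --> (0 : R)] --> 0 - w j.+1.
    by apply: cvgB; [exact: cvg_id|exact: cvg_cst].
  apply: (cvg_comp _ _ c); apply: continuous_bessel_term => //.
  by rewrite sub0r oppr_eq0.
Qed.

End spectral_density.

(** * Approximate identities against an integrable function continuous at 0 *)

Section approximate_identity.
Context (R : realType).
Notation mu := (@lebesgue_measure R).

(* [c q(c l)] is an approximate identity; the pointwise bound below splits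
   [|f - f 0|] without splitting the domain of integration. *)
Lemma cvg_approximate_identity (q f : R -> R) : measurable_fun setT q ->
  (forall l, `|q l| <= expR (- (2^-1 * l ^+ 2))) ->
  mu.-integrable setT (EFin \o f) -> (forall l, 0 <= f l) -> {for 0, continuous f} ->
  \int[mu]_l (c * q (c * l) * f l) @[c --> +oo] --> f 0 * \int[mu]_l q l.
Proof.
move=> mq qb fi f0 cf.
pose g l : R := expR (- (2^-1 * l ^+ 2)).
pose g' l : R := expR (- (4^-1 * l ^+ 2)).
have gi : mu.-integrable setT (EFin \o g) by apply: integrable_gaussZ; rewrite invr_gt0.
have gi' : mu.-integrable setT (EFin \o g') by apply: integrable_gaussZ; rewrite invr_gt0.
have qi : mu.-integrable setT (EFin \o q) by exact: integrable_lebesgue_le gi.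
pose G := \int[mu]_l g l; pose G' := \int[mu]_l g' l; pose Fi := \int[mu]_l f l.
have G0 : 0 <= G by apply: Rintegral_ge0 => l _; exact: expR_ge0.
have G'0 : 0 <= G' by apply: Rintegral_ge0 => l _; exact: expR_ge0.
have Fi0 : 0 <= Fi by exact: Rintegral_ge0.
have sc (h : R -> R) (c : R) : 0 < c -> mu.-integrable setT (EFin \o h) ->
    mu.-integrable setT (EFin \o (fun l => c * h (c * l))) /\
    \int[mu]_l (c * h (c * l)) = \int[mu]_l h l.
  move=> c0 hi; have hi' := integrable_affine 0 c0 hi.
  have E : (fun l => h (c * l + 0)) = (fun l => h (c * l)).
    by apply/funext => l; rewrite addr0.
  rewrite E in hi'; split; first exact: integrable_scale.
  rewrite (RintegralZl _ _ hi')//; have := Rintegral_affine 0 c0 hi.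
  under eq_Rintegral do rewrite addr0.
  by move=> ->; rewrite mulrA mulfV ?gt_eqF// mul1r.
apply/cvgrPdist_le => e e0.
(* The near part costs [e1 * G <= e / 2]; the [+ 1] keeps the denominator positive. *)
set e1 := e / (2 * (G + 1)).
have e10 : 0 < e1 by rewrite divr_gt0// mulr_gt0// ltr_wpDl.
have /cvgrPdist_le /(_ _ e10) /nbhs_ballP [dl /= dl0 hd] := cf.
(* The far part will be at most [K / c]; its second summand even decays like [1 / c ^ 2], weakened
   through [c >= 1]. *)
pose K := 2 / dl ^+ 2 * Fi + f 0 * (4 / dl ^+ 2) * G'.
have d20 : 0 < dl ^+ 2 by rewrite exprn_gt0.
have K0 : 0 <= K.
  by rewrite addr_ge0// !mulr_ge0// ?f0// invr_ge0 ltW.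
near=> c.
have c1 : 1 <= c by near: c; exact: nbhs_pinfty_ge.
have c0 : 0 < c by exact: lt_le_trans ltr01 c1.
have [qci qcE] := sc q c c0 qi; have [gci gcE] := sc g c c0 gi.
have [gci' gcE'] := sc g' c c0 gi'.
have bnd l : `|f 0 * (c * q (c * l)) - c * q (c * l) * f l| <=
    e1 * (c * g (c * l)) + (2 / (c * dl ^+ 2) * f l +
      f 0 * (4 / (c ^+ 2 * dl ^+ 2)) * (c * g' (c * l))).
  have -> : f 0 * (c * q (c * l)) - c * q (c * l) * f l =
     c * q (c * l) * (f 0 - f l) by ring.
  rewrite !normrM (gtr0_norm c0).
  have r0 : 0 <= 2 / (c * dl ^+ 2) * f l by apply: mulr_ge0 => //; apply: divr_ge0 => //; apply: mulr_ge0; exact: ltW.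
  have r1 : 0 <= f 0 * (4 / (c ^+ 2 * dl ^+ 2)) * (c * g' (c * l)).
    apply: mulr_ge0; last by apply: mulr_ge0; [exact: ltW|exact: expR_ge0].
    apply: mulr_ge0 => //; apply: divr_ge0 => //; apply: mulr_ge0; last exact: ltW.
    exact: sqr_ge0.
  have r2 : 0 <= e1 * (c * g (c * l)) by apply: mulr_ge0; [exact: ltW|apply: mulr_ge0; [exact: ltW|exact: expR_ge0]].
  have qc : c * `|q (c * l)| <= c * g (c * l) by rewrite ler_pM2l//; exact: qb.
  have [ld|ld] := ltP `|l| dl.
    apply: (@le_trans _ _ (e1 * (c * g (c * l)))); last by rewrite lerDl addr_ge0.
    rewrite mulrC; apply: ler_pM => //; first by rewrite mulr_ge0// ltW.
    by apply: hd; rewrite /ball/= sub0r normrN.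
  apply: (@le_trans _ _ (2 / (c * dl ^+ 2) * f l +
      f 0 * (4 / (c ^+ 2 * dl ^+ 2)) * (c * g' (c * l)))); last by rewrite lerDr.
  have l2 : dl ^+ 2 <= l ^+ 2.
    by rewrite -[l ^+ 2]real_normK ?num_real// ler_sqr ?nnegrE// ltW.
  have cl2 : c ^+ 2 * dl ^+ 2 <= (c * l) ^+ 2.
    by rewrite exprMn ler_pM2l// exprn_gt0.
  have cd0 : 0 < c ^+ 2 * dl ^+ 2 by rewrite mulr_gt0// exprn_gt0.
  have expb (u v : R) : 0 < v -> v <= u -> expR (- u) <= v^-1.
    move=> v0 vu; rewrite expRN lef_pV2 ?posrE ?expR_gt0//.
    by apply: le_trans (expR_ge1Dx _); lra.
  (* Two far bounds for the two summands of [f l + f 0]. Against the integrable [f l] a constant is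
     enough; against the constant [f 0] a Gaussian factor must survive, so only half of the exponent
     is spent in [g2]. *)
  have g1 : g (c * l) <= 2 / (c ^+ 2 * dl ^+ 2).
    rewrite /g; apply: le_trans (expb _ (2^-1 * (c ^+ 2 * dl ^+ 2)) _ _) _.
    - by rewrite mulr_gt0// invr_gt0.
    - by rewrite ler_pM2l// invr_gt0.
    - by rewrite invfM invrK.
  have g2 : g (c * l) <= 4 / (c ^+ 2 * dl ^+ 2) * g' (c * l).
    have -> : g (c * l) = g' (c * l) * g' (c * l).
      by rewrite /g /g' -expRD; congr expR; field.
    rewrite ler_pM2r ?expR_gt0//.
    rewrite /g'; apply: le_trans (expb _ (4^-1 * (c ^+ 2 * dl ^+ 2)) _ _) _.
    - by rewrite mulr_gt0// invr_gt0.
    - by rewrite ler_pM2l// invr_gt0.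
    - by rewrite invfM invrK.
  have nf : `|f 0 - f l| <= f l + f 0.
    by rewrite ler_norml; apply/andP; split; have := f0 0; have := f0 l; lra.
  apply: (@le_trans _ _ (c * g (c * l) * (f l + f 0))).
    by apply: ler_pM => //; rewrite mulr_ge0// ltW.
  rewrite mulrDr; apply: lerD.
    rewrite ler_wpM2r//.
    have -> : 2 / (c * dl ^+ 2) = c * (2 / (c ^+ 2 * dl ^+ 2)).
      by field; rewrite !gt_eqF.
    by rewrite ler_pM2l.
  have -> : f 0 * (4 / (c ^+ 2 * dl ^+ 2)) * (c * g' (c * l)) =
     c * (4 / (c ^+ 2 * dl ^+ 2) * g' (c * l)) * f 0 by ring.
  by rewrite ler_wpM2r// ler_pM2l.
have mq' : measurable_fun setT (fun l => c * q (c * l)) by exact: integrable_measurable qci.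
have mf : measurable_fun setT f by exact: integrable_measurable fi.
have ib := integrable_add (integrable_scale e1 gci)
  (integrable_add (integrable_scale (2 / (c * dl ^+ 2)) fi)
     (integrable_scale (f 0 * (4 / (c ^+ 2 * dl ^+ 2))) gci')).
have md : measurable_fun setT (fun l => f 0 * (c * q (c * l)) - c * q (c * l) * f l).
  by apply: measurable_funB; exact: measurable_funM.
have id := integrable_lebesgue_le md bnd ib.
have i1 := integrable_scale (f 0) qci.
have iqf : mu.-integrable setT (EFin \o (fun l => c * q (c * l) * f l)).
  have := integrable_sub i1 id; congr (integrable _ _ _).
  by apply/funext => l /=; congr EFin; ring.
rewrite -qcE -(RintegralZl _ _ qci)// -(RintegralB _ i1 iqf)//.
apply: le_trans (@Rintegral_norm_le _ (measurableTypeR R) R mu _ _ md bnd ib) _.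
rewrite (RintegralD _ (integrable_scale e1 gci)
  (integrable_add (integrable_scale (2 / (c * dl ^+ 2)) fi)
     (integrable_scale (f 0 * (4 / (c ^+ 2 * dl ^+ 2))) gci')))//.
rewrite (RintegralD _ (integrable_scale (2 / (c * dl ^+ 2)) fi)
     (integrable_scale (f 0 * (4 / (c ^+ 2 * dl ^+ 2))) gci'))//.
rewrite (RintegralZl _ _ gci)// (RintegralZl _ _ fi)// (RintegralZl _ _ gci')//.
rewrite gcE gcE' -/G -/G' -/Fi.
have t1 : e1 * G <= e / 2.
  rewrite /e1 invfM mulrA -mulrA ler_piMr ?divr_ge0 ?(ltW e0)// mulrC.
  by rewrite ler_pdivrMr ?ltr_wpDl// mul1r lerDl.
have t2 : 2 / (c * dl ^+ 2) * Fi + f 0 * (4 / (c ^+ 2 * dl ^+ 2)) * G' <= K / c.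
  rewrite /K [leRHS]mulrDl; apply: lerD.
    by rewrite le_eqVlt; apply/orP; left; apply/eqP; field; rewrite !gt_eqF.
  have -> : f 0 * (4 / (c ^+ 2 * dl ^+ 2)) * G' = f 0 * (4 / dl ^+ 2) * G' / c * c^-1.
    by field; rewrite !gt_eqF.
  rewrite ler_piMr ?invf_le1//; apply: mulr_ge0; last by rewrite invr_ge0 ltW.
  apply: mulr_ge0 => //; apply: mulr_ge0 => //.
  by apply: divr_ge0 => //; exact: ltW.
have t3 : K / c <= e / 2.
  rewrite ler_pdivrMr// -ler_pdivrMl ?divr_gt0//; near: c; exact: nbhs_pinfty_ge.
lra.
Unshelve. all: by end_near. Qed.

End approximate_identity.

(** * Second-order calculus of the white noise integral *)

Section white_noise.
Context (R : realType) d (T : measurableType d) (P : probability T R).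
Notation mu := (@lebesgue_measure R).
Variable I : (R -> R) -> (R -> R) -> T -> R.
Hypothesis WI : sym_white_noise_integral P I.
Implicit Types a b : R -> R.

Lemma sq_integrable_mul a b : sq_integrable a -> sq_integrable b ->
  mu.-integrable setT (EFin \o (fun l => a l * b l)).
Proof.
move=> [ma ia] [mb ib].
exact: (@integrableM_sq _ (measurableTypeR R) R mu a b ma mb ia ib).
Qed.

Lemma sq_integrable_lin a b (al be : R) : sq_integrable a -> sq_integrable b ->
  sq_integrable (fun l => al * a l + be * b l).
Proof.
move=> sa sb; have [ma ia] := sa; have [mb ib] := sb; split.
  by apply: measurable_funD; exact: measurable_funM.
have -> : (fun x => ((al * a x + be * b x) ^+ 2)%:E) =
    EFin \o (fun x => al ^+ 2 * a x ^+ 2 + (be ^+ 2 * b x ^+ 2 + 2 * al * be * (a x * b x))).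
  by apply/funext => x /=; congr EFin; ring.
apply: integrable_add; first exact: integrable_scale.
by apply: integrable_add; apply: integrable_scale => //; exact: sq_integrable_mul.
Qed.

Lemma herm_L2_lin a b a' b' (al be : R) : herm_L2 a b -> herm_L2 a' b' ->
  herm_L2 (fun l => al * a l + be * a' l) (fun l => al * b l + be * b' l).
Proof.
move=> [ea [ob [sa sb]]] [ea' [ob' [sa' sb']]]; split.
  by move=> l; rewrite ea ea'.
split; first by move=> l; rewrite ob ob'; ring.
by split; exact: sq_integrable_lin.
Qed.

Lemma herm_L2_inner a b a' b' : herm_L2 a b -> herm_L2 a' b' ->
  mu.-integrable setT (EFin \o (fun l => a l * a' l + b l * b' l)).
Proof.
move=> [_ [_ [sa sb]]] [_ [_ [sa' sb']]].
by apply: integrable_add; exact: sq_integrable_mul.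
Qed.

Lemma herm_L2_0 : herm_L2 (fun=> 0 : R) (fun=> 0).
Proof.
have s0 : sq_integrable (fun=> 0 : R).
  split => //; rewrite (_ : (fun _ => _) = cst 0%E); first exact: integrable0.
  by apply/funext => x; rewrite expr0n.
by split => //; split; [move=> l; rewrite oppr0|].
Qed.

Lemma measurable_white_noise a b : herm_L2 a b -> measurable_fun setT (I a b).
Proof. by move=> h; case: WI => /(_ a b h) []. Qed.

Lemma LInt_norm_ge0 a b : 0 <= LInt (fun l => a l ^+ 2 + b l ^+ 2).
Proof. by apply: Rintegral_ge0 => l _; rewrite addr_ge0 ?sqr_ge0. Qed.

Lemma expectation_sq_white_noise a b : herm_L2 a b ->
  P.-integrable setT (EFin \o (fun w => I a b w ^+ 2)) /\
  \int[P]_w I a b w ^+ 2 = \int[mu]_l (a l * a l + b l * b l).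
Proof.
move=> h; case: WI => /(_ a b h) [mI gI] _.
have [i e] := expectation_sq_gaussian (LInt_norm_ge0 a b) mI gI.
by split.
Qed.

Lemma expectation_white_noise a b : herm_L2 a b -> \int[P]_w I a b w = 0.
Proof.
move=> h; case: WI => /(_ a b h) [mI gI] _.
exact: (expectation_gaussian (LInt_norm_ge0 a b) mI gI).
Qed.

Lemma integrable_white_noiseM a b a' b' : herm_L2 a b -> herm_L2 a' b' ->
  P.-integrable setT (EFin \o (fun w => I a b w * I a' b' w)).
Proof.
move=> h h'; apply: integrableM_sq; try exact: measurable_white_noise.
- by case: (expectation_sq_white_noise h).
- by case: (expectation_sq_white_noise h').
Qed.

(** Polarisation: the integral of the sum is almost surely the sum of the integrals, so expanding
    its second moment isolates the cross term. *)
Lemma expectation_white_noiseM a b a' b' : herm_L2 a b -> herm_L2 a' b' ->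
  \int[P]_w (I a b w * I a' b' w) = \int[mu]_l (a l * a' l + b l * b' l).
Proof.
move=> h h'; have [i1 e1] := expectation_sq_white_noise h.
have [i2 e2] := expectation_sq_white_noise h'.
have h12 := herm_L2_lin 1 1 h h'.
have [i3 e3] := expectation_sq_white_noise h12.
have i4 := integrable_white_noiseM h h'.
have j1 := herm_L2_inner h h; have j2 := herm_L2_inner h' h'.
have j4 := herm_L2_inner h h'.
have lin : {ae P, forall w, I (fun l => 1 * a l + 1 * a' l) (fun l => 1 * b l + 1 * b' l) w
    = 1 * I a b w + 1 * I a' b' w} by case: WI => _; apply.
have E3 : \int[P]_w (I (fun l => 1 * a l + 1 * a' l) (fun l => 1 * b l + 1 * b' l) w) ^+ 2 =
    \int[P]_w (I a b w ^+ 2 + (I a' b' w ^+ 2 + 2 * (I a b w * I a' b' w))).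
  apply: ae_eq_Rintegral.
  - exact/measurable_funX/measurable_white_noise.
  - have m1 := measurable_white_noise h; have m2 := measurable_white_noise h'.
    apply: measurable_funD; first exact: measurable_funX.
    apply: measurable_funD; first exact: measurable_funX.
    by apply: measurable_funM => //; exact: measurable_funM.
  - by apply: filterS lin => w ->; ring.
rewrite E3 RintegralD// in e3; last by apply: integrable_add => //; exact: integrable_scale.
rewrite RintegralD// in e3; last exact: integrable_scale.
rewrite RintegralZl// e1 e2 in e3.
have E4 : \int[mu]_l ((1 * a l + 1 * a' l) * (1 * a l + 1 * a' l) +
      (1 * b l + 1 * b' l) * (1 * b l + 1 * b' l)) =
    \int[mu]_l ((a l * a l + b l * b l) + ((a' l * a' l + b' l * b' l) +
      2 * (a l * a' l + b l * b' l))).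
  by apply: eq_Rintegral => l _; ring.
have j24 := integrable_add j2 (integrable_scale 2 j4).
rewrite E4 (RintegralD _ j1 j24)// (RintegralD _ j2 (integrable_scale 2 j4))// in e3.
rewrite (RintegralZl _ _ j4)// in e3; lra.
Qed.

Lemma white_noise_sum (J : Type) (r : seq J) (al : J -> R) (a b : J -> R -> R) :
  (forall i, herm_L2 (a i) (b i)) ->
  herm_L2 (fun l => \sum_(i <- r) al i * a i l) (fun l => \sum_(i <- r) al i * b i l) /\
  {ae P, forall w, I (fun l => \sum_(i <- r) al i * a i l)
     (fun l => \sum_(i <- r) al i * b i l) w = \sum_(i <- r) al i * I (a i) (b i) w}.
Proof.
move=> h; elim: r => [|i r [hr IH]].
  have E : (fun l : R => \sum_(i <- [::]) al i * a i l) = (fun=> 0).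
    by apply/funext => l; rewrite big_nil.
  have E' : (fun l : R => \sum_(i <- [::]) al i * b i l) = (fun=> 0).
    by apply/funext => l; rewrite big_nil.
  rewrite E E'; split; first exact: herm_L2_0.
  (* Linearity with both coefficients 0 shows that the integral of the zero function vanishes almost
     surely. *)
  have z : (fun l : R => 0 * 0 + 0 * 0 : R) = (fun=> 0).
    by apply/funext => l; rewrite mul0r addr0.
  have := WI.2 _ _ _ _ 0 0 herm_L2_0 herm_L2_0.
  by rewrite z; apply: filterS => w ->; rewrite !mul0r addr0 big_nil.
have E : (fun l : R => \sum_(j <- i :: r) al j * a j l) =
    (fun l => al i * a i l + 1 * \sum_(j <- r) al j * a j l).
  by apply/funext => l; rewrite big_cons mul1r.
have E' : (fun l : R => \sum_(j <- i :: r) al j * b j l) =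
    (fun l => al i * b i l + 1 * \sum_(j <- r) al j * b j l).
  by apply/funext => l; rewrite big_cons mul1r.
rewrite E E'; split; first exact: herm_L2_lin.
have lin := WI.2 _ _ _ _ (al i) 1 (h i) hr.
apply: filterS2 lin IH => w -> ->; by rewrite big_cons mul1r.
Qed.

(** A linear combination is almost surely the integral of the combined integrand, whose squared norm
    expands into the quadratic form of the inner products. *)
Lemma white_noise_gaussian_family (N : nat) (X : 'I_N -> T -> R) (a b : 'I_N -> R -> R) :
  (forall i, herm_L2 (a i) (b i)) -> (forall i, measurable_fun setT (X i)) ->
  (forall i, {ae P, forall w, X i w = I (a i) (b i) w}) ->
  gaussian_family P X (fun i j => \int[mu]_l (a i l * a j l + b i l * b j l)).
Proof.
move=> h mX XI; split => // al.
have [hs ls] := white_noise_sum (index_enum 'I_N) al h.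
have vE : LInt (fun l => (\sum_i al i * a i l) ^+ 2 + (\sum_i al i * b i l) ^+ 2) =
    \sum_i \sum_j al i * al j * \int[mu]_l (a i l * a j l + b i l * b j l).
  rewrite -[LHS]/(\int[mu]_l ((\sum_i al i * a i l) ^+ 2 + (\sum_i al i * b i l) ^+ 2)).
  transitivity (\int[mu]_l (\sum_i \sum_j al i * al j * (a i l * a j l + b i l * b j l))).
    apply: eq_Rintegral => l _.
    rewrite !expr2 !mulr_suml -big_split; apply: eq_bigr => i _ /=.
    rewrite !mulr_sumr -big_split; apply: eq_bigr => j _ /=; ring.
  rewrite Rintegral_sum; last first.
    move=> i; apply: integrable_sum_real => j; apply: integrable_scale.
    exact: herm_L2_inner.
  apply: eq_bigr => i _; rewrite Rintegral_sum; last first.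
    by move=> j; apply: integrable_scale; exact: herm_L2_inner.
  apply: eq_bigr => j _; rewrite RintegralZl//; exact: herm_L2_inner.
rewrite -vE; split; first exact: LInt_norm_ge0.
have [mI gI] := WI.1 _ _ hs.
apply: centered_gaussian_ae gI => //.
  by apply: measurable_sum => i; exact: measurable_funM.
have XIall : {ae P, forall w, forall i, X i w = I (a i) (b i) w}.
  exact: filter_forall.
apply: filterS2 ls XIall => w -> XIw.
by apply: eq_bigr => i _; rewrite XIw.
Qed.

End white_noise.

(** * A stochastic Fubini theorem in mean square *)

Section stochastic_fubini.
Context (R : realType) d (T : measurableType d) (P : probability T R).
Notation mu := (@lebesgue_measure R).
Variable I : (R -> R) -> (R -> R) -> T -> R.
Hypothesis WI : sym_white_noise_integral P I.
Variables (e : R -> R) (a b : R -> R -> R) (r A B : R -> R) (v : R -> T -> R).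
Hypothesis e_ge0 : forall y, 0 <= e y.
Hypothesis ei : mu.-integrable setT (EFin \o e).
Hypothesis e_gt0 : 0 < \int[mu]_y e y.
Hypothesis hab : forall y, herm_L2 (a y) (b y).
Hypothesis ma : measurable_fun setT (fun p : R * R => a p.1 p.2).
Hypothesis mb : measurable_fun setT (fun p : R * R => b p.1 p.2).
Hypothesis r2 : sq_integrable r.
Hypothesis ar : forall y l, `|a y l| <= r l.
Hypothesis br : forall y l, `|b y l| <= r l.
Hypothesis hAB : herm_L2 A B.
Hypothesis AE : forall l, A l = \int[mu]_y (e y * a y l).
Hypothesis BE : forall l, B l = \int[mu]_y (e y * b y l).
Hypothesis mv : measurable_fun setT (fun p : R * T => v p.1 p.2).
Hypothesis vI : forall y, {ae P, forall w, v y w = I (a y) (b y) w}.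

(** Bound on the second moment of [v y], uniform in [y]; the 2 accounts for the real and the
    imaginary part. *)
Let M := 2 * \int[mu]_l (r l ^+ 2).
Let Z w := \int[mu]_y (e y * v y w).

Let me : measurable_fun setT e. Proof. exact: integrable_measurable ei. Qed.

Let mvy y : measurable_fun setT (v y).
Proof. exact: (measurable_fun_pair2 y mv). Qed.

Let mevY (Y : T -> R) : measurable_fun setT Y ->
  measurable_fun setT (fun p : R * T => e p.1 * v p.1 p.2 * Y p.2).
Proof.
move=> mY; apply: measurable_funM; last exact: measurableT_comp.
by apply: measurable_funM => //; exact: measurableT_comp.
Qed.

Let vsq y : P.-integrable setT (EFin \o (fun w => v y w ^+ 2)) /\
  \int[P]_w v y w ^+ 2 <= M.
Proof.
have [i E] := expectation_sq_white_noise WI (hab y).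
have mI := measurable_white_noise WI (hab y).
have ae2 : {ae P, forall w, I (a y) (b y) w ^+ 2 = v y w ^+ 2}.
  by apply: filterS (vI y) => w ->.
have mI2 : measurable_fun setT (fun w => I (a y) (b y) w ^+ 2) by exact: measurable_funX.
have mv2 : measurable_fun setT (fun w => v y w ^+ 2) by exact: measurable_funX.
split; first exact: integrable_ae_eq ae2 i.
rewrite -(ae_eq_Rintegral mI2 mv2 ae2) E /M.
have ir : mu.-integrable setT (EFin \o (fun l => r l ^+ 2)) by case: r2.
rewrite -(RintegralZl _ _ ir)//; apply: le_Rintegral => //.
- exact: herm_L2_inner.
- exact: integrable_scale.
- move=> l _; rewrite -!expr2 -[a y l ^+ 2]real_normK ?num_real//.
  rewrite -[b y l ^+ 2]real_normK ?num_real// mulr_natl mulr2n.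
  by apply: lerD; rewrite ler_sqr ?nnegrE// (le_trans _ (ar y l)).
Qed.

(** As [|v * Y| <= v ^ 2 + Y ^ 2], the section at [y] has L1 norm at most [(M + E Y ^ 2) * e y],
    which is integrable in [y]. *)
Let evY_fubini (Y : T -> R) : measurable_fun setT Y ->
  P.-integrable setT (EFin \o (fun w => Y w ^+ 2)) ->
  [/\ {ae P, forall w, mu.-integrable setT (EFin \o (fun y => e y * v y w * Y w))} &
  \int[mu]_y (e y * \int[P]_w (v y w * Y w)) =
  \int[P]_w \int[mu]_y (e y * v y w * Y w)].
Proof.
move=> mY iY.
have ivY y : P.-integrable setT (EFin \o (fun w => v y w * Y w)).
  by apply: integrableM_sq => //; case: (vsq y).
have iy y : P.-integrable setT (EFin \o (fun w => e y * v y w * Y w)).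
  by under [X in EFin \o X]eq_fun do rewrite -mulrA; exact: integrable_scale.
have bd y : \int[P]_w `|e y * v y w * Y w| <= (M + \int[P]_w Y w ^+ 2) * e y.
  have [iv vM] := vsq y.
  apply: (@le_trans _ _ (\int[P]_w (e y * (v y w ^+ 2 + Y w ^+ 2)))).
    apply: le_Rintegral => //.
    - exact: integrable_norm.
    - by apply: integrable_scale; exact: integrable_add.
    - move=> w _; rewrite -mulrA normrM (ger0_norm (e_ge0 y)) ler_wpM2l//.
      by rewrite ler_norml; apply/andP; split; nra.
  rewrite RintegralZl//; last exact: integrable_add.
  by rewrite RintegralD// mulrC ler_wpM2r// lerD2r.
have gi := integrable_scale (M + \int[P]_w Y w ^+ 2) ei.
split.
  exact: (@ae_integrable_section _ _ (measurableTypeR R) T R mu P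
    (fun p => e p.1 * v p.1 p.2 * Y p.2) _ (mevY mY) iy bd gi).
rewrite -(@Rintegral_fubini _ _ (measurableTypeR R) T R mu P
    (fun p => e p.1 * v p.1 p.2 * Y p.2) _ (mevY mY) iy bd gi)/=.
apply: eq_Rintegral => y _.
under [RHS]eq_Rintegral do rewrite -mulrA.
by rewrite RintegralZl.
Qed.

Let ev_int : {ae P, forall w, mu.-integrable setT (EFin \o (fun y => e y * v y w))}.
Proof.
have i1 : P.-integrable setT (EFin \o (fun w : T => 1 ^+ 2 : R)).
  exact: finite_measure_integrable_cst.
have [h _] := evY_fubini (Y := fun=> 1) (measurable_cst _) i1.
apply: filterS h => w; congr (integrable _ _ _).
by apply/funext => y /=; rewrite mulr1.
Qed.

Let mZ : measurable_fun setT Z.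
Proof.
apply: (@measurable_Rintegral_section _ _ (measurableTypeR R) T R mu
  (fun p => e p.1 * v p.1 p.2)).
by apply: measurable_funM => //; exact: measurableT_comp.
Qed.

Let EZY (Y : T -> R) : measurable_fun setT Y ->
  P.-integrable setT (EFin \o (fun w => Y w ^+ 2)) ->
  \int[P]_w (Z w * Y w) = \int[mu]_y (e y * \int[P]_w (v y w * Y w)).
Proof.
move=> mY iY; have [_ ->] := evY_fubini mY iY.
apply: ae_eq_Rintegral.
- exact: measurable_funM.
- exact: (@measurable_Rintegral_section _ _ (measurableTypeR R) T R mu
    (fun p => e p.1 * v p.1 p.2 * Y p.2) (mevY mY)).
- apply: filterS ev_int => w iw.
  by rewrite RintegralZr.
Qed.

(* Cauchy-Schwarz for the finite measure [e y dy]. *)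
Let Z_sq : P.-integrable setT (EFin \o (fun w => Z w ^+ 2)).
Proof.
set E0 := \int[mu]_y e y.
have mev2 : measurable_fun setT (fun p : R * T => e p.1 * v p.1 p.2 ^+ 2).
  apply: measurable_funM; first exact: measurableT_comp.
  exact: measurable_funX.
have iy y : P.-integrable setT (EFin \o (fun w => e y * v y w ^+ 2)).
  by apply: integrable_scale; case: (vsq y).
have bd y : \int[P]_w `|e y * v y w ^+ 2| <= M * e y.
  have [iv vM] := vsq y.
  rewrite (_ : \int[P]_w `|_| = \int[P]_w (e y * v y w ^+ 2)); last first.
    by apply: eq_Rintegral => w _; rewrite ger0_norm// mulr_ge0// sqr_ge0.
  by rewrite RintegralZl// mulrC ler_wpM2r.
have gi := integrable_scale M ei.
have ip := @integrable_prod_dominated _ _ (measurableTypeR R) T R mu P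
  (fun p => e p.1 * v p.1 p.2 ^+ 2) _ mev2 iy bd gi.
pose g := (EFin \o (fun p : measurableTypeR R * T => e p.1 * v p.1 p.2 ^+ 2)%R).
have mg : measurable_fun setT g by exact/measurable_EFinP.
have fG := (integrable21ltyP mu P mg).1 ip.
have aeG := ae_integrable2 ip.
pose H w := (\int[mu]_y `|g (y, w)|)%E.
have mH : measurable_fun setT H.
  apply: (@measurable_fun_fubini_tonelli_G _ _ (measurableTypeR R) T R mu (abse \o g)).
    exact: measurableT_comp.
  by move=> p; exact: abse_ge0.
have H0 w : (0 <= H w)%E by exact: integral_ge0.
apply/integrableP; split; first by apply/measurable_EFinP; exact: measurable_funX.
apply: (@le_lt_trans _ _ (E0%:E * \int[P]_w H w)%E); last first.
  by rewrite lte_mul_pinfty// ?lee_fin ?(ltW e_gt0)//; exact: integral_ge0.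
rewrite -ge0_integralZl//; last by rewrite lee_fin ltW.
apply: ae_ge0_le_integral => //.
- by do 2 apply: measurableT_comp => //; exact: measurable_funX.
- by move=> w _; rewrite mule_ge0// lee_fin ltW.
- exact: measurable_funeM.
apply: filterS2 ev_int aeG => w i1 i2 _ /=.
have -> : H w = (\int[mu]_y (e y * v y w ^+ 2))%:E.
  rewrite -(integral_Rintegral i2); apply: eq_integral => y _ /=.
  by rewrite ger0_norm// mulr_ge0// sqr_ge0.
rewrite -EFinM lee_fin ger0_norm ?sqr_ge0//.
set Q := \int[mu]_y _.
(* The mean of [v] for the normalised weight. Nonnegativity of the integral of [e * (v - t) ^ 2]
   reads [Z ^ 2 <= E0 * Q]. *)
pose t := Z w / E0.
have : 0 <= \int[mu]_y (e y * v y w ^+ 2 + ((- (2 * t)) * (e y * v y w) + t ^+ 2 * e y)).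
  apply: Rintegral_ge0 => y _.
  rewrite (_ : _ + _ = e y * (v y w - t) ^+ 2); last ring.
  by rewrite mulr_ge0// sqr_ge0.
have i3 := integrable_scale (- (2 * t)) i1; have i4 := integrable_scale (t ^+ 2) ei.
rewrite (RintegralD _ i2 (integrable_add i3 i4))// (RintegralD _ i3 i4)//.
rewrite (RintegralZl _ _ i1)// (RintegralZl _ _ ei)// -/E0 -/(Z w) -/Q.
have -> : Q + (- (2 * t) * Z w + t ^+ 2 * E0) = Q - Z w ^+ 2 / E0.
  by rewrite /t; field; rewrite gt_eqF.
by rewrite subr_ge0 ler_pdivrMr// mulrC.
Qed.

(** The deterministic counterpart of the exchange: covariances with a fixed noise integral are L2
    inner products, and these average to the inner product with [(A, B)]. The majorant
    [2 * r ^ 2 + a' ^ 2 + b' ^ 2] makes Fubini applicable. *)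
Let inner_fubini a' b' : herm_L2 a' b' ->
  \int[mu]_y (e y * \int[mu]_l (a y l * a' l + b y l * b' l)) =
  \int[mu]_l (A l * a' l + B l * b' l).
Proof.
move=> h'; have [_ [_ [sa' sb']]] := h'.
have [ma' ia'] := sa'; have [mb' ib'] := sb'; have [mr ir] := r2.
pose g := fun p : R * R => e p.1 * (a p.1 p.2 * a' p.2 + b p.1 p.2 * b' p.2).
have mg : measurable_fun setT g.
  apply: measurable_funM; first exact: measurableT_comp.
  by apply: measurable_funD; apply: measurable_funM => //; exact: measurableT_comp.
have ii y : mu.-integrable setT (EFin \o (fun l => a y l * a' l + b y l * b' l)).
  exact: herm_L2_inner.
have iy y : mu.-integrable setT (EFin \o (fun l => g (y, l))).
  exact: (integrable_scale (e y) (ii y)).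
pose q l := 2 * r l ^+ 2 + (a' l ^+ 2 + b' l ^+ 2).
have iq : mu.-integrable setT (EFin \o q).
  exact: (integrable_add (integrable_scale 2 ir) (integrable_add ia' ib')).
have bd y : \int[mu]_l `|g (y, l)| <= (\int[mu]_l q l) * e y.
  rewrite mulrC -(RintegralZl _ _ iq)//; apply: le_Rintegral => //.
  - exact: integrable_norm.
  - exact: integrable_scale.
  - move=> l _; rewrite normrM (ger0_norm (e_ge0 y)) ler_wpM2l//.
    rewrite (le_trans (ler_normD _ _))// !normrM /q.
    rewrite -[a' l ^+ 2]real_normK ?num_real// -[b' l ^+ 2]real_normK ?num_real//.
    have := ar y l; have := br y l; have := normr_ge0 (a y l); have := normr_ge0 (b y l).
    have := normr_ge0 (a' l); have := normr_ge0 (b' l).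
    set A1 := `|a y l|; set B1 := `|b y l|; set A2 := `|a' l|; set B2 := `|b' l|.
    move=> B20 A20 B10 A10 Br Ar.
    have h1 : A1 * A2 <= r l * A2 by rewrite ler_wpM2r.
    have h2 : B1 * B2 <= r l * B2 by rewrite ler_wpM2r.
    have := sqr_ge0 (r l - A2); have := sqr_ge0 (r l - B2); nra.
have gi := integrable_scale (\int[mu]_l q l) ei.
transitivity (\int[mu]_y \int[mu]_l g (y, l)).
  by apply: eq_Rintegral => y _; rewrite /g /= (RintegralZl _ _ (ii y)).
rewrite (@Rintegral_fubini _ _ (measurableTypeR R) (measurableTypeR R) R mu mu
    g _ mg iy bd gi).
apply: eq_Rintegral => l _; rewrite /g /= AE BE.
have iea : mu.-integrable setT (EFin \o (fun y => e y * a y l)).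
  apply: (@integrable_lebesgue_le R _ (fun y => r l * e y)).
  - by apply: measurable_funM => //; exact: (measurable_fun_pair1 l ma).
  - by move=> y; rewrite normrM (ger0_norm (e_ge0 y)) mulrC ler_wpM2r.
  - exact: integrable_scale.
have ieb : mu.-integrable setT (EFin \o (fun y => e y * b y l)).
  apply: (@integrable_lebesgue_le R _ (fun y => r l * e y)).
  - by apply: measurable_funM => //; exact: (measurable_fun_pair1 l mb).
  - by move=> y; rewrite normrM (ger0_norm (e_ge0 y)) mulrC ler_wpM2r.
  - exact: integrable_scale.
have ia := integrable_scale (a' l) iea; have ib := integrable_scale (b' l) ieb.
transitivity (\int[mu]_y (a' l * (e y * a y l) + b' l * (e y * b y l))).
  by apply: eq_Rintegral => y _; ring.
rewrite (RintegralD _ ia ib)// (RintegralZl _ _ iea)// (RintegralZl _ _ ieb)//.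
by congr (_ + _); exact: mulrC.
Qed.

Let EvY (Y : T -> R) y : measurable_fun setT Y ->
  \int[P]_w (v y w * Y w) = \int[P]_w (I (a y) (b y) w * Y w).
Proof.
move=> mY; apply: ae_eq_Rintegral.
- exact: measurable_funM.
- by apply: measurable_funM => //; exact: (measurable_white_noise WI (hab y)).
- by apply: filterS (vI y) => w ->.
Qed.

Let EZI a' b' : herm_L2 a' b' ->
  \int[P]_w (Z w * I a' b' w) = \int[mu]_l (A l * a' l + B l * b' l).
Proof.
move=> h'; have mI := measurable_white_noise WI h'.
have [iI _] := expectation_sq_white_noise WI h'.
rewrite EZY// -inner_fubini//; apply: eq_Rintegral => y _; congr (_ * _).
by rewrite EvY// (expectation_white_noiseM WI (hab y) h').
Qed.

(** The moments [E Z ^ 2], [E (Z * I A B)] and [E (I A B) ^ 2] all equal the squared norm of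
    [(A, B)], so [Z - I A B] has zero mean square. *)
Lemma stochastic_fubini :
  [/\ {ae P, forall w, mu.-integrable setT (EFin \o (fun y => e y * v y w))},
      measurable_fun setT (fun w => \int[mu]_y (e y * v y w)) &
      {ae P, forall w, \int[mu]_y (e y * v y w) = I A B w}].
Proof.
split => //.
have mI := measurable_white_noise WI hAB.
have [iI EI] := expectation_sq_white_noise WI hAB.
(* The exchange is used twice: with [Y = Z], legitimate since [Z] is square integrable, and then for
   each [y] with the noise integral that represents [v y]. *)
have EZ2 : \int[P]_w Z w ^+ 2 = \int[mu]_l (A l * A l + B l * B l).
  transitivity (\int[P]_w (Z w * Z w)); first by apply: eq_Rintegral => w _; rewrite expr2.
  rewrite (EZY mZ Z_sq) -(inner_fubini hAB); apply: eq_Rintegral => y _; congr (_ * _).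
  rewrite EvY// -[RHS](_ : \int[mu]_l (A l * a y l + B l * b y l) = _); last first.
    by apply: eq_Rintegral => l _; ring.
  rewrite -EZI//; apply: eq_Rintegral => w _; exact: mulrC.
have iZI : P.-integrable setT (EFin \o (fun w => Z w * I A B w)).
  exact: integrableM_sq.
have i2 := integrable_scale (- 2) iZI.
have iD : P.-integrable setT (EFin \o (fun w => (Z w - I A B w) ^+ 2)).
  have := integrable_add Z_sq (integrable_add i2 iI); congr (integrable _ _ _).
  by apply/funext => w /=; congr EFin; ring.
have D0 : \int[P]_w (Z w - I A B w) ^+ 2 = 0.
  transitivity (\int[P]_w (Z w ^+ 2 + (- 2 * (Z w * I A B w) + I A B w ^+ 2))).
    by apply: eq_Rintegral => w _; ring.
  rewrite (RintegralD _ Z_sq (integrable_add i2 iI))// (RintegralD _ i2 iI)//.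
  by rewrite (RintegralZl _ _ iZI)// EZ2 EI EZI//; ring.
have := Rintegral_sq_eq0 (measurable_funB mZ mI) iD D0.
by apply: filterS => w /eqP; rewrite subr_eq0 => /eqP.
Qed.

End stochastic_fubini.

(** * The averaged field as a white noise integral *)

Section averaged_field.
Context (R : realType) d (T : measurableType d) (P : probability T R).
Notation mu := (@lebesgue_measure R).
Variable I : (R -> R) -> (R -> R) -> T -> R.
Hypothesis WI : sym_white_noise_integral P I.

Lemma white_noise_scale (k : R) a b : herm_L2 a b ->
  herm_L2 (fun l => k * a l) (fun l => k * b l) /\
  {ae P, forall w, k * I a b w = I (fun l => k * a l) (fun l => k * b l) w}.
Proof.
move=> h.
have kE (g : R -> R) : (fun l => k * g l + 0 * g l) = (fun l => k * g l).
  by apply/funext => l; rewrite mul0r addr0.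
have h0 := herm_L2_lin k 0 h h; have a0 := WI.2 _ _ _ _ k 0 h h.
rewrite !kE in h0 a0; split => //.
by apply: filterS a0 => w ->; rewrite mul0r addr0.
Qed.

Variables (m : nat) (theta : R) (f : R -> R).
Hypothesis m_odd : odd m.
Hypothesis f_ge0 : forall l, 0 <= f l.
Hypothesis f_even : forall l, f (- l) = f l.
Hypothesis fi : mu.-integrable setT (EFin \o f).

Let mf : measurable_fun setT f. Proof. exact: integrable_measurable fi. Qed.

Lemma exprN_odd (l : R) : (- l) ^+ m = - l ^+ m.
Proof. by rewrite exprNn -signr_odd m_odd expr1 mulN1r. Qed.

(** An odd phase makes [exp (i * p)] Hermitian, and its modulus 1 keeps the integrand in L2. The
    phases used below are odd because [m] is. *)
Lemma herm_L2_phase (p rho : R -> R) : measurable_fun setT p ->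
  (forall l, p (- l) = - p l) -> (forall l, rho (- l) = rho l) ->
  sq_integrable rho ->
  herm_L2 (fun l => cos (p l) * rho l) (fun l => sin (p l) * rho l).
Proof.
move=> mp po re [mr ir].
have mc : measurable_fun setT (fun l => cos (p l)).
  exact: (measurableT_comp (continuous_measurable_fun (@continuous_cos R))).
have ms : measurable_fun setT (fun l => sin (p l)).
  exact: (measurableT_comp (continuous_measurable_fun (@continuous_sin R))).
have sq (u : R -> R) : measurable_fun setT u -> (forall l, `|u l| <= 1) ->
    sq_integrable (fun l => u l * rho l).
  move=> mu_ u1; split; first exact: measurable_funM.
  apply: (@integrable_lebesgue_le R (fun l => (u l * rho l) ^+ 2) (fun l => rho l ^+ 2)) => //.
    by apply: measurable_funX; exact: measurable_funM.
  move=> l; rewrite ger0_norm ?sqr_ge0// exprMn ler_piMl ?sqr_ge0//.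
  by rewrite -real_normK ?num_real// expr_le1.
split; first by move=> l; rewrite po cosN re.
split; first by move=> l; rewrite po sinN re mulNr.
by split; apply: sq => // l; [exact: norm_cos_le1|exact: norm_sin_le1].
Qed.

Let phase (t x l : R) : R := l * x + theta * l ^+ m * t.

Let measurable_phase t x : measurable_fun setT (phase t x).
Proof.
apply: measurable_funD; first exact: measurable_funM.
by do 2 apply: measurable_funM => //; exact: measurable_funX.
Qed.

Let phase_odd t x l : phase t x (- l) = - phase t x l.
Proof. by rewrite /phase exprN_odd; ring. Qed.

Let sq_integrable_gauss4 : sq_integrable (fun l : R => expR (- (l ^+ 2) / 4)).
Proof.
split.
  by apply: measurableT_comp => //; apply: measurable_funM => //;
    apply: measurableT_comp => //; exact: measurable_funX.
have i : mu.-integrable setT (EFin \o (fun l : R => expR (- (2^-1 * l ^+ 2)))).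
  by apply: integrable_gaussZ; rewrite invr_gt0.
rewrite (_ : (fun x => _) = EFin \o (fun l : R => expR (- (2^-1 * l ^+ 2))))//.
by apply/funext => l /=; rewrite expr2 -expRD; congr (expR _)%:E; field.
Qed.

Let sq_integrable_sqrt : sq_integrable (fun l => Num.sqrt (f l)).
Proof.
split.
  exact: (measurableT_comp (continuous_measurable_fun (@sqrt_continuous R)) mf).
rewrite (_ : (fun x => _) = EFin \o f)//.
by apply/funext => l /=; rewrite sqr_sqrtr.
Qed.

Lemma herm_L2_gauss (t x : R) :
  herm_L2 (fun l => cos (l * x + theta * l ^+ m * t) * expR (- (l ^+ 2) / 4))
          (fun l => sin (l * x + theta * l ^+ m * t) * expR (- (l ^+ 2) / 4)).
Proof.
apply: (@herm_L2_phase (phase t x)) => //.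
by move=> l; rewrite sqrrN.
Qed.

Lemma herm_L2_spectral (t x : R) :
  herm_L2 (fun l => cos (l * x + theta * l ^+ m * t) * Num.sqrt (f l))
          (fun l => sin (l * x + theta * l ^+ m * t) * Num.sqrt (f l)).
Proof.
apply: (@herm_L2_phase (phase t x)) => //.
by move=> l; rewrite f_even.
Qed.

Lemma herm_L2_spectral_gauss (c t x : R) :
  herm_L2 (fun l => cos (c * l * x + theta * (c * l) ^+ m * t) *
             (expR (- ((c * l) ^+ 2) / 4) * Num.sqrt (f l)))
          (fun l => sin (c * l * x + theta * (c * l) ^+ m * t) *
             (expR (- ((c * l) ^+ 2) / 4) * Num.sqrt (f l))).
Proof.
have mcl : measurable_fun setT (fun l : R => c * l) by exact: measurable_funM.
apply: (@herm_L2_phase (fun l => phase t x (c * l))).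
- exact: (measurableT_comp (measurable_phase t x)).
- by move=> l; rewrite mulrN phase_odd.
- by move=> l; rewrite f_even mulrN sqrrN.
- have [ms is_] := sq_integrable_sqrt.
  have mg : measurable_fun setT (fun l : R => expR (- ((c * l) ^+ 2) / 4)).
    by apply: measurableT_comp => //; apply: measurable_funM => //;
      apply: measurableT_comp => //; exact: measurable_funX.
  split; first exact: measurable_funM.
  apply: (@integrable_lebesgue_le R _ (fun l => Num.sqrt (f l) ^+ 2)) => //.
    by apply: measurable_funX; exact: measurable_funM.
  move=> l; rewrite ger0_norm ?sqr_ge0// exprMn ler_piMl ?sqr_ge0//.
  rewrite expr_le1 ?expR_ge0// -expR0 ler_expR mulNr oppr_le0.
  by rewrite divr_ge0// sqr_ge0.
Qed.

Variables (M : R -> R) (V : R -> R -> T -> R).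
Hypothesis convi : forall t x c, 0 < t -> 0 < c ->
  mu.-integrable setT
    (fun x1 => (expR (- (x1 - x) ^+ 2) * conv_term m theta M t (x1 * c))%:E).
Hypothesis mV : forall t, measurable_fun setT (fun p : R * T => V t p.1 p.2).
Hypothesis VI : forall t x, {ae P, forall om, V t x om = (2 * pi)^-1 *
  I (fun l => cos (l * x + theta * l ^+ m * t) * Num.sqrt (f l))
    (fun l => sin (l * x + theta * l ^+ m * t) * Num.sqrt (f l)) om}.

Lemma averaged_noise (c t x : R) : 0 < c ->
  let Z w := \int[mu]_y (expR (- (y - x) ^+ 2) * (2 * pi * V (t * c ^+ m) (y * c) w)) in
  [/\ {ae P, forall w, mu.-integrable setT
        (EFin \o (fun y => expR (- (y - x) ^+ 2) * (2 * pi * V (t * c ^+ m) (y * c) w)))},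
      measurable_fun setT Z &
      {ae P, forall w, Z w = Num.sqrt pi *
        I (fun l => cos (c * l * x + theta * (c * l) ^+ m * t) *
             (expR (- ((c * l) ^+ 2) / 4) * Num.sqrt (f l)))
          (fun l => sin (c * l * x + theta * (c * l) ^+ m * t) *
             (expR (- ((c * l) ^+ 2) / 4) * Num.sqrt (f l))) w}].
Proof.
move=> c0 Z; set s := t * c ^+ m.
have pi0 : 0 < pi :> R := pi_gt0 R.
pose e y := expR (- (y - x) ^+ 2).
pose a y l := cos (l * (y * c) + theta * l ^+ m * s) * Num.sqrt (f l).
pose b y l := sin (l * (y * c) + theta * l ^+ m * s) * Num.sqrt (f l).
have eE : e = fun y => expR (- (1 * y + - x) ^+ 2).
  by apply/funext => y; rewrite mul1r.
have ei : mu.-integrable setT (EFin \o e) by rewrite eE; exact: integrable_gauss.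
have e_gt0 : 0 < \int[mu]_y e y.
  by rewrite eE Rintegral_gauss// divr1 sqrtr_gt0.
pose h1 := fun l => cos (c * l * x + theta * (c * l) ^+ m * t) *
  (expR (- ((c * l) ^+ 2) / 4) * Num.sqrt (f l)).
pose h2 := fun l => sin (c * l * x + theta * (c * l) ^+ m * t) *
  (expR (- ((c * l) ^+ 2) / 4) * Num.sqrt (f l)).
have hh : herm_L2 h1 h2 by exact: herm_L2_spectral_gauss.
(* Linearity is stated for two-term combinations, so scaling is written with a second coefficient
   0. *)
have hAB := herm_L2_lin (Num.sqrt pi) 0 hh hh.
have mph : measurable_fun setT (fun p : R * R => p.2 * (p.1 * c) + theta * p.2 ^+ m * s).
  apply: measurable_funD; first by apply: measurable_funM => //; exact: measurable_funM.
  by do 2 apply: measurable_funM => //; exact: measurable_funX.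
have ms2 : measurable_fun setT (fun p : R * R => Num.sqrt (f p.2)).
  exact: (measurableT_comp sq_integrable_sqrt.1).
have ma : measurable_fun setT (fun p : R * R => a p.1 p.2).
  apply: measurable_funM => //.
  exact: (measurableT_comp (continuous_measurable_fun (@continuous_cos R)) mph).
have mb : measurable_fun setT (fun p : R * R => b p.1 p.2).
  apply: measurable_funM => //.
  exact: (measurableT_comp (continuous_measurable_fun (@continuous_sin R)) mph).
have ar y l : `|a y l| <= Num.sqrt (f l).
  by rewrite normrM (ger0_norm (sqrtr_ge0 _)) ler_piMl ?sqrtr_ge0 ?norm_cos_le1.
have br y l : `|b y l| <= Num.sqrt (f l).
  by rewrite normrM (ger0_norm (sqrtr_ge0 _)) ler_piMl ?sqrtr_ge0 ?norm_sin_le1.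
(* Scale invariance of the dispersion relation: time [t * c ^ m] and position [c * x] amount to
   frequency [c * l]. *)
have phE l : l * c * x + theta * l ^+ m * s = c * l * x + theta * (c * l) ^+ m * t.
  by rewrite /s exprMn; ring.
have AE l : Num.sqrt pi * h1 l + 0 * h1 l = \int[mu]_y (e y * a y l).
  transitivity (\int[mu]_y (Num.sqrt (f l) *
     (expR (- (y - x) ^+ 2) * cos (l * c * y + theta * l ^+ m * s)))).
    rewrite (@RintegralZl _ (measurableTypeR R)) //; last first.
      apply: (@integrable_lebesgue_le R _ e) => //.
      - apply: measurable_funM; first exact: integrable_measurable ei.
        by apply: continuous_measurable_fun; exact: continuous_cos_affine.
      - move=> y; rewrite normrM (ger0_norm (expR_ge0 _)) ler_piMr ?expR_ge0//.
        exact: norm_cos_le1.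
    rewrite Rintegral_gauss_cos_shift phE /h1.
    have -> : - ((c * l) ^+ 2) / 4 = - ((l * c) ^+ 2 / 4) by rewrite (mulrC l); ring.
    ring.
  by apply: eq_Rintegral => y _; rewrite /e /a (_ : l * (y * c) = l * c * y); ring.
have BE l : Num.sqrt pi * h2 l + 0 * h2 l = \int[mu]_y (e y * b y l).
  transitivity (\int[mu]_y (Num.sqrt (f l) *
     (expR (- (y - x) ^+ 2) * sin (l * c * y + theta * l ^+ m * s)))).
    rewrite (@RintegralZl _ (measurableTypeR R)) //; last first.
      apply: (@integrable_lebesgue_le R _ e) => //.
      - apply: measurable_funM; first exact: integrable_measurable ei.
        by apply: continuous_measurable_fun; exact: continuous_sin_affine.
      - move=> y; rewrite normrM (ger0_norm (expR_ge0 _)) ler_piMr ?expR_ge0//.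
        exact: norm_sin_le1.
    rewrite Rintegral_gauss_sin_shift phE /h2.
    have -> : - ((c * l) ^+ 2) / 4 = - ((l * c) ^+ 2 / 4) by rewrite (mulrC l); ring.
    ring.
  by apply: eq_Rintegral => y _; rewrite /e /b (_ : l * (y * c) = l * c * y); ring.
have mv : measurable_fun setT (fun p : R * T => 2 * pi * V s (p.1 * c) p.2).
  apply: measurable_funM => //.
  apply: (measurableT_comp (mV s) (g := fun p : R * T => (p.1 * c, p.2))).
  by apply: measurable_fun_pair => //; exact: measurable_funM.
have vI y : {ae P, forall w, 2 * pi * V s (y * c) w = I (a y) (b y) w}.
  apply: filterS (VI s (y * c)) => w ->.
  by rewrite mulrA mulfV ?mul1r// mulf_neq0// gt_eqF.
have [s1 s2 s3] := stochastic_fubini WI (fun y => expR_ge0 _) ei e_gt0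
  (fun y => herm_L2_spectral s (y * c)) ma mb sq_integrable_sqrt ar br hAB AE BE mv vI.
split => //.
have lin := WI.2 _ _ _ _ (Num.sqrt pi) 0 hh hh.
by apply: filterS2 s3 lin => w; rewrite /Z => -> ->; rewrite mul0r addr0.
Qed.

(** The constant [al] collects the prefactor [eps ^ (-1/4)], the [1 / (2 * pi)] of the field and the
    [sqrt pi] of the Gaussian average. *)
Lemma averaged_field (eps t x : R) : 0 < eps -> 0 < t ->
  let c := eps `^ (- (1 / 2)) in
  let al := eps `^ (- (1 / 4)) / (2 * Num.sqrt pi) in
  [/\ measurable_fun setT (Ubar P m theta M V eps t x),
   herm_L2
     (fun l => al * (cos (c * l * x + theta * (c * l) ^+ m * t) *
             (expR (- ((c * l) ^+ 2) / 4) * Num.sqrt (f l))))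
     (fun l => al * (sin (c * l * x + theta * (c * l) ^+ m * t) *
             (expR (- ((c * l) ^+ 2) / 4) * Num.sqrt (f l)))) &
   {ae P, forall w, Ubar P m theta M V eps t x w = I
     (fun l => al * (cos (c * l * x + theta * (c * l) ^+ m * t) *
             (expR (- ((c * l) ^+ 2) / 4) * Num.sqrt (f l))))
     (fun l => al * (sin (c * l * x + theta * (c * l) ^+ m * t) *
             (expR (- ((c * l) ^+ 2) / 4) * Num.sqrt (f l)))) w}].
Proof.
move=> eps0 t0 c al.
have pi0 : 0 < pi :> R := pi_gt0 R.
have c0 : 0 < c by exact: powR_gt0.
have cm : eps `^ (- (m%:R / 2)) = c ^+ m.
  rewrite /c -powR_mulrn ?powR_ge0// -powRrM; congr powR; by field.
set s := t * c ^+ m; have s0 : 0 < s by rewrite mulr_gt0// exprn_gt0.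
pose h1 := fun l => cos (c * l * x + theta * (c * l) ^+ m * t) *
  (expR (- ((c * l) ^+ 2) / 4) * Num.sqrt (f l)).
pose h2 := fun l => sin (c * l * x + theta * (c * l) ^+ m * t) *
  (expR (- ((c * l) ^+ 2) / 4) * Num.sqrt (f l)).
have hh : herm_L2 h1 h2 by exact: herm_L2_spectral_gauss.
pose Z w := \int[mu]_y (expR (- (y - x) ^+ 2) * (2 * pi * V s (y * c) w)).
have [Zi mZ ZI] := averaged_noise t x c0.
rewrite -/s -/Z -/h1 -/h2 in Zi mZ ZI.
pose k y := expR (- (y - x) ^+ 2) * conv_term m theta M s (y * c).
have ki : mu.-integrable setT (EFin \o k) by exact: convi.
pose D := \int[mu]_y k y.
pose Y w := \int[mu]_y (expR (- (y - x) ^+ 2) *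
  (conv_term m theta M s (y * c) + V s (y * c) w)).
have mI := measurable_white_noise WI hh.
have tp : 2 * pi != 0 :> R by rewrite mulf_neq0// gt_eqF.
have mY : measurable_fun setT Y.
  have mg : measurable_fun setT (fun p : R * T =>
      k p.1 + expR (- (p.1 - x) ^+ 2) * V s (p.1 * c) p.2).
    apply: measurable_funD.
      by apply: measurableT_comp => //; exact: integrable_measurable ki.
    apply: measurable_funM.
      apply: measurableT_comp => //; apply: measurableT_comp => //.
      by apply: measurable_funX; exact: measurable_funB.
    apply: (measurableT_comp (mV s) (g := fun p : R * T => (p.1 * c, p.2))).
    by apply: measurable_fun_pair => //; exact: measurable_funM.
  have := @measurable_Rintegral_section _ _ (measurableTypeR R) T R mu _ mg.
  rewrite /Y /k /=; under [X in measurable_fun _ X -> _]eq_fun do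
    under eq_Rintegral do rewrite -mulrDr.
  exact.
pose ga : R := (2 * pi)^-1 * Num.sqrt pi.
have YE : {ae P, forall w, Y w = D + ga * I h1 h2 w}.
  apply: filterS2 Zi ZI => w Ziw ZIw.
  have -> : Y w = \int[mu]_y (k y + (2 * pi)^-1 *
     (expR (- (y - x) ^+ 2) * (2 * pi * V s (y * c) w))).
    by apply: eq_Rintegral => y _; rewrite /k mulrDr [in RHS]mulrCA mulKf.
  rewrite (RintegralD _ ki (integrable_scale (2 * pi)^-1 Ziw))//.
  by rewrite (RintegralZl _ _ Ziw)// [X in _ + _ * X = _]ZIw -/D mulrA.
have EY : Expect P Y = D.
  rewrite -[LHS]/(\int[P]_w Y w).
  have mDI : measurable_fun setT (fun w => D + ga * I h1 h2 w).
    by apply: measurable_funD => //; exact: measurable_funM.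
  rewrite (ae_eq_Rintegral mY mDI YE).
  have iI : P.-integrable setT (EFin \o I h1 h2).
    have i1 : P.-integrable setT (EFin \o (fun w : T => 1 ^+ 2 : R)).
      exact: finite_measure_integrable_cst.
    have [i2 _] := expectation_sq_white_noise WI hh.
    have := integrableM_sq mI (@measurable_cst _ _ _ _ setT (1 : R)) i2 i1.
    by under [X in EFin \o X]eq_fun do rewrite mulr1.
  have iD : P.-integrable setT (EFin \o (fun w : T => D)).
    exact: finite_measure_integrable_cst.
  rewrite (RintegralD _ iD (integrable_scale ga iI))// (RintegralZl _ _ iI)//.
  rewrite (expectation_white_noise WI hh) mulr0 addr0 Rintegral_cst//.
  by rewrite [X in _ * X](_ : _ = 1) ?mulr1//; exact: (congr1 fine (probability_setT P)).
have UE : Ubar P m theta M V eps t x = fun w => eps `^ (- (1 / 4)) * (Y w - D).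
  by apply/funext => w; rewrite /Ubar cm -/s -/c -EY.
have [hal lin] := white_noise_scale al hh.
split.
- by rewrite UE; apply: measurable_funM => //; exact: measurable_funB.
- exact: hal.
- apply: filterS2 YE lin => w Yw <-; rewrite UE Yw /ga /al addrAC subrr add0r.
  rewrite mulrA; congr (_ * _).
  have sp : Num.sqrt pi != 0 :> R by rewrite gt_eqF// sqrtr_gt0.
  rewrite -[in (2 * pi)^-1](sqr_sqrtr (ltW pi0)); field.
  by [].
Qed.

End averaged_field.


(** * Convergence of the finite-dimensional distributions and the limit covariance *)

Theorem theorem4 (R : realType) (d : measure_display) (T : measurableType d)
  (P : probability T R)
  (k : nat) (mu_ : R) (n : nat) (A w kappa : nat -> R) (M : R -> R)
  (I : (R -> R) -> (R -> R) -> T -> R)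
  (xi : R -> T -> R) (V : R -> R -> T -> R) :
  let m := (2 * k + 1)%N in
  let theta := mu_ * (-1) ^+ k in
  let f := specB n A w kappa in
  let C := constC n A w kappa in
  let U0 := fun (t x : R) (om : T) =>
    Num.sqrt C / (2 * Num.sqrt pi) *
    I (fun l => cos (l * x + theta * l ^+ m * t) * expR (- (l ^+ 2) / 4))
      (fun l => sin (l * x + theta * l ^+ m * t) * expR (- (l ^+ 2) / 4)) om in
  (mu_ = 1 \/ mu_ = -1) ->
  (* Assumption B, with A_0 = 0 *)
  (forall j, (j <= n)%N -> 0 <= A j) ->
  \sum_(j < n.+1) A j = 1 ->
  w 0%N = 0 ->
  (forall j, (1 <= j <= n)%N -> w j != 0) ->
  (forall j, (j <= n)%N -> 0 < kappa j < 1) ->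
  A 0%N = 0 ->
  (* the symmetric complex Gaussian white noise W, through its integral *)
  sym_white_noise_integral P I ->
  (* xi: measurable process with spectral representation \int e^{i l x} sqrt f W(dl) *)
  measurable_fun setT (fun p : R * T => xi p.1 p.2) ->
  (forall x, {ae P, forall om, xi x om =
     I (fun l => cos (l * x) * Num.sqrt (f l))
       (fun l => sin (l * x) * Num.sqrt (f l)) om}) ->
  (* M : the convolution integrals are well defined *)
  (forall t x, 0 < t ->
     lebesgue_measure.-integrable setT
       (fun y => (M (x - y) * um m theta t y)%:E)) ->
  (forall t x c, 0 < t -> 0 < c ->
     lebesgue_measure.-integrable setT
       (fun x1 => (expR (- (x1 - x) ^+ 2) * conv_term m theta M t (x1 * c))%:E)) ->
  (* V: a measurable version of the stochastic part of u,
     (1/2pi) \int e^{i l x + i theta l^m t} sqrt f W(dl) *)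
  (forall t, measurable_fun setT (fun p : R * T => V t p.1 p.2)) ->
  (forall t x, {ae P, forall om, V t x om =
     (2 * pi)^-1 *
     I (fun l => cos (l * x + theta * l ^+ m * t) * Num.sqrt (f l))
       (fun l => sin (l * x + theta * l ^+ m * t) * Num.sqrt (f l)) om}) ->
  (* convergence of finite-dimensional distributions *)
  (forall (N : nat) (pts : 'I_N -> R * R), (forall i, 0 < (pts i).1) ->
   forall h : 'rV[R]_N -> R, continuous h -> (exists B, forall v, `|h v| <= B) ->
     (\int[P]_om (h (\row_i Ubar P m theta M V eps (pts i).1 (pts i).2 om))%:E)%E
        @[eps --> 0^'+]
     --> (\int[P]_om (h (\row_i U0 (pts i).1 (pts i).2 om))%:E)%E)
  (* the limit field is zero-mean with the stated covariance *)
  /\ (forall t x, Expect P (U0 t x) = 0)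
  /\ (forall t x t' x',
        Expect P (fun om => U0 t x om * U0 t' x' om)
          - Expect P (U0 t x) * Expect P (U0 t' x')
        = C / (4 * pi) *
          LInt (fun l => cos (l * (x - x') + theta * (t - t') * l ^+ m)
                         * expR (- (l ^+ 2) / 2))).
Proof.
move=> m theta f C U0 _ A_ge0 _ _ w_neq0 kappa01 A0 WI _ _ _ convi mV VI.
have m_odd : odd m by rewrite /m oddD oddM.
have f_ge0 : forall l, 0 <= f l by exact: specB_ge0.
have f_even : forall l, f (- l) = f l by exact: specB_even.
have fi : lebesgue_measure.-integrable setT (EFin \o f) by exact: integrable_specB.
have cf : {for 0, continuous f} by exact: continuous_specB0.
have fC : f 0 = C by exact: specB0.
have C0 : 0 <= C by rewrite -fC.
have pi0 : 0 < pi :> R := pi_gt0 R.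
have sp0 : Num.sqrt pi != 0 :> R by rewrite gt_eqF// sqrtr_gt0.
pose kap : R := Num.sqrt C / (2 * Num.sqrt pi).
have kap2 : kap ^+ 2 = C / (4 * pi).
  rewrite /kap exprMn exprVn exprMn !sqr_sqrtr ?(ltW pi0)//; congr (_ / (_ * _)).
  by rewrite expr2 -natrM.
pose ga (t x l : R) := cos (l * x + theta * l ^+ m * t) * expR (- (l ^+ 2) / 4).
pose gb (t x l : R) := sin (l * x + theta * l ^+ m * t) * expR (- (l ^+ 2) / 4).
have hg t x : herm_L2 (ga t x) (gb t x) by exact: herm_L2_gauss.
(* Real part of the product of one limit integrand with the conjugate of the other; only differences
   of times and positions survive. *)
pose q (t x t' x' l : R) :=
  cos (l * (x - x') + theta * (t - t') * l ^+ m) * expR (- (l ^+ 2) / 2).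
have qE t x t' x' l : ga t x l * ga t' x' l + gb t x l * gb t' x' l = q t x t' x' l.
  rewrite /q (_ : l * (x - x') + _ = (l * x + theta * l ^+ m * t) -
    (l * x' + theta * l ^+ m * t')); last ring.
  rewrite (_ : - (l ^+ 2) / 2 = - (l ^+ 2) / 4 + - (l ^+ 2) / 4); last by field.
  by rewrite expRD cosB /ga /gb; ring.
have Uw t x : herm_L2 (fun l => kap * ga t x l) (fun l => kap * gb t x l) /\
    {ae P, forall w, U0 t x w = I (fun l => kap * ga t x l) (fun l => kap * gb t x l) w}.
  exact: white_noise_scale.
have mU t x : measurable_fun setT (U0 t x).
  by apply: measurable_funM => //; exact: (measurable_white_noise WI (hg t x)).
have SE t x t' x' : \int[lebesgue_measure]_l
    (kap * ga t x l * (kap * ga t' x' l) + kap * gb t x l * (kap * gb t' x' l)) =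
    C / (4 * pi) * \int[lebesgue_measure]_l q t x t' x' l.
  have iq := herm_L2_inner (hg t x) (hg t' x').
  rewrite -kap2; under [in RHS]eq_Rintegral do rewrite -qE.
  rewrite -(RintegralZl _ _ iq)//.
  by apply: eq_Rintegral => l _; ring.
have EU t x : Expect P (U0 t x) = 0.
  have [h u] := Uw t x; rewrite -[LHS]/(\int[P]_w U0 t x w).
  rewrite (ae_eq_Rintegral (mU t x) (measurable_white_noise WI h) u).
  exact: (expectation_white_noise WI h).
split; last first.
  split => // t x t' x'; rewrite !EU mulr0 subr0.
  have [h u] := Uw t x; have [h' u'] := Uw t' x'.
  rewrite -[LHS]/(\int[P]_w (U0 t x w * U0 t' x' w)) -[LInt _]/(\int[lebesgue_measure]_l q t x t' x' l).
  rewrite -SE -(expectation_white_noiseM WI h h'); apply: ae_eq_Rintegral.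
  - exact: measurable_funM.
  - exact: (measurable_funM (measurable_white_noise WI h) (measurable_white_noise WI h')).
  - by apply: filterS2 u u' => om -> ->.
move=> N pts pts0 h ch hB.
pose c (eps : R) := eps `^ (- (1 / 2)).
pose al (eps : R) := eps `^ (- (1 / 4)) / (2 * Num.sqrt pi).
pose sa eps (i : 'I_N) l := al eps * (cos (c eps * l * (pts i).2 +
  theta * (c eps * l) ^+ m * (pts i).1) *
  (expR (- ((c eps * l) ^+ 2) / 4) * Num.sqrt (f l))).
pose sb eps (i : 'I_N) l := al eps * (sin (c eps * l * (pts i).2 +
  theta * (c eps * l) ^+ m * (pts i).1) *
  (expR (- ((c eps * l) ^+ 2) / 4) * Num.sqrt (f l))).
have cy : c eps @[eps --> 0^'+] --> +oo.
  apply/cvgryPge => B; near=> eps.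
  have e0 : 0 < eps by near: eps; exact: nbhs_right_gt.
  pose B1 := Num.max B 1; have B10 : 0 < B1 by rewrite lt_max ltr01 orbT.
  rewrite /c powRN (_ : 1 / 2 = 2^-1) ?mul1r// powR12_sqrt ?(ltW e0)//.
  apply: (@le_trans _ _ B1); first by rewrite le_max lexx.
  rewrite -[leLHS]invrK lef_pV2 ?posrE ?invr_gt0 ?sqrtr_gt0//.
  rewrite -[leRHS]ger0_norm ?invr_ge0 ?(ltW B10)// -sqrtr_sqr ler_sqrt ?sqr_ge0//.
  near: eps; apply: nbhs_right_le; rewrite exprn_gt0// invr_gt0.
  by rewrite lt_max ltr01 orbT.
apply: (@gaussian_family_cvg R d T P R (0^'+) _ N
  (fun eps i => Ubar P m theta M V eps (pts i).1 (pts i).2)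
  (fun eps i j => \int[lebesgue_measure]_l (sa eps i l * sa eps j l + sb eps i l * sb eps j l))
  (fun i => U0 (pts i).1 (pts i).2)
  (fun i j => \int[lebesgue_measure]_l (kap * ga (pts i).1 (pts i).2 l *
      (kap * ga (pts j).1 (pts j).2 l) +
      kap * gb (pts i).1 (pts i).2 l * (kap * gb (pts j).1 (pts j).2 l)))) => //.
- near=> eps.
  have e0 : 0 < eps by near: eps; exact: nbhs_right_gt.
  have Ue i := averaged_field WI m_odd f_ge0 f_even fi convi mV VI (pts i).2 e0 (pts0 i).
  apply: (white_noise_gaussian_family WI (a := sa eps) (b := sb eps)) => i;
    by case: (Ue i).
- apply: (white_noise_gaussian_family WI
    (a := fun i l => kap * ga (pts i).1 (pts i).2 l)
    (b := fun i l => kap * gb (pts i).1 (pts i).2 l)) => i.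
  + by case: (Uw (pts i).1 (pts i).2).
  + exact: mU.
  + by case: (Uw (pts i).1 (pts i).2).
(* Both families are Gaussian; what remains is the convergence of each covariance entry. *)
move=> i j; rewrite SE.
set qij := q (pts i).1 (pts i).2 (pts j).1 (pts j).2.
have mq : measurable_fun setT qij.
  have := integrable_measurable (herm_L2_inner (hg (pts i).1 (pts i).2) (hg (pts j).1 (pts j).2)).
  by rewrite (funext (qE _ _ _ _)).
have qb l : `|qij l| <= expR (- (2^-1 * l ^+ 2)).
  rewrite normrM (ger0_norm (expR_ge0 _)) (_ : - (2^-1 * _) = - (l ^+ 2) / 2).
    by rewrite ler_piMl ?expR_ge0 ?norm_cos_le1.
  by field.
have lim := cvg_approximate_identity mq qb fi f_ge0 cf.
have -> : C / (4 * pi) * \int[lebesgue_measure]_l qij l =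
    (4 * pi)^-1 * (f 0 * \int[lebesgue_measure]_l qij l) by rewrite fC; ring.
apply: (@cvg_trans _ ((4 * pi)^-1 *
  \int[lebesgue_measure]_l (c eps * qij (c eps * l) * f l) @[eps --> 0^'+])); last first.
  apply: cvgM; first exact: cvg_cst.
  exact: (cvg_comp _ _ cy lim).
apply: near_eq_cvg; near=> eps.
have e0 : 0 < eps by near: eps; exact: nbhs_right_gt.
(* The square of [eps ^ (-1/4)] is exactly [c], the normalisation of the approximate identity. *)
have al2 : al eps ^+ 2 = (4 * pi)^-1 * c eps.
  rewrite /al /c exprMn exprVn exprMn sqr_sqrtr ?(ltW pi0)//.
  rewrite (_ : - (1 / 2) = - (1 / 4) + - (1 / 4)); last by field.
  rewrite powRD; last by apply/implyP => _; rewrite gt_eqF.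
  rewrite -expr2 [RHS]mulrC; congr (_ / (_ * _)).
  by rewrite expr2 -natrM.
have E l : sa eps i l * sa eps j l + sb eps i l * sb eps j l =
    (4 * pi)^-1 * (c eps * qij (c eps * l) * f l).
  rewrite /qij -qE -[in RHS](sqr_sqrtr (f_ge0 l)) /sa /sb /ga /gb.
  transitivity (al eps ^+ 2 * (ga (pts i).1 (pts i).2 (c eps * l) *
    ga (pts j).1 (pts j).2 (c eps * l) + gb (pts i).1 (pts i).2 (c eps * l) *
    gb (pts j).1 (pts j).2 (c eps * l)) * Num.sqrt (f l) ^+ 2).
    by rewrite /ga /gb; ring.
  by rewrite al2 /ga /gb; ring.
have p40 : (4 * pi)^-1 != 0 :> R by rewrite invr_neq0// mulf_neq0// gt_eqF.
have Ue k := averaged_field WI m_odd f_ge0 f_even fi convi mV VI (pts k).2 e0 (pts0 k).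
(* Integrability is read off from the inner product of the two L2 integrands, once the factor
   [1 / (4 * pi)] is removed. *)
have is_ : lebesgue_measure.-integrable setT
    (EFin \o (fun l => c eps * qij (c eps * l) * f l)).
  have [_ hi _] := Ue i; have [_ hj _] := Ue j.
  have := integrable_scale (4 * pi) (herm_L2_inner hi hj); congr (integrable _ _ _).
  apply/funext => l /=; congr EFin.
  rewrite -[X in _ * X]/(sa eps i l * sa eps j l + sb eps i l * sb eps j l) E mulrA.
  by rewrite mulfV ?mul1r// mulf_neq0// gt_eqF.
rewrite -(RintegralZl _ _ is_)//.
by apply: eq_Rintegral => l _; rewrite E.
Unshelve. all: by end_near. Qed.
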